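(* Let $p$ be a prime, $t\ge 1$, $q=p^t$, and let $B$ be a small minimal blocking set in $\mathrm{PG}(n,q)$ with exponent $e$. Put $q_0:=p^e$ and $h:=t/e$, and assume $q_0\geq 7$ and $p>5h-11$. If $B$ spans an $(h-1)$-dimensional subspace of $\mathrm{PG}(n,q)$, then $B$ is an $\mathbb{F}_{q_0}$-linear set.
   Context: A blocking set in $\mathrm{PG}(n,q)$ is a set of points meeting every hyperplane in at least one point. It is small if $|B|<3(q+1)/2$, and minimal if no proper subset is a blocking set. A small minimal blocking set $B$ in $\mathrm{PG}(n,p^t)$, $p$ prime, meets every hyperplane in $1$ mod $p$ points; its exponent $e$ is the largest integer such that every hyperplane meets $B$ in $1 \bmod p^{e}$ points (one has $e\mid t$). A point set $S$ of $\mathrm{PG}(V)$, $V=\mathrm{V}(n+1,p^t)$, is $\mathbb{F}_{q_0}$-linear ($\mathbb{F}_{q_0}$ a subfield of $\mathbb{F}_{p^t}$) if there is an $\mathbb{F}_{q_0}$-subspace $U$ of $V$ with $S=\{\langle u\rangle_{\mathbb{F}_{p^t}} : u\in U\setminus\{0\}\}$. *)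

(* Defs.v *)
From HB Require Import structures.
From mathcomp Require Import all_boot all_order all_algebra.

Set Implicit Arguments.
Unset Strict Implicit.
Unset Printing Implicit Defensive.

Import GRing.Theory.
Local Open Scope ring_scope.

Section FiniteVspace.
Import VectorInternalTheory.
Variables (F : finFieldType) (V : vectType F).

HB.instance Definition _ := [Countable of {vspace V} by <:].
HB.instance Definition _ := [Finite of {vspace V} by <:].

End FiniteVspace.

(* PG(n, q) is PG(V) with V = F^(n+1); a subspace of projective dimension k is
   an F-subspace of V of vector-space dimension k + 1. *)
Definition pg_point (F : finFieldType) (n : nat) :=
  {P : {vspace 'rV[F]_n.+1} | \dim P == 1%N}.

Section BlockingSets.
Variables (F : finFieldType) (n : nat).
Implicit Types (B S : {set pg_point F n}) (H : {vspace 'rV[F]_n.+1}).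

Definition hyperplane H : bool := \dim H == n.

Definition pg_meet B H : {set pg_point F n} := [set P in B | (val P <= H)%VS].

Definition pg_span B : {vspace 'rV[F]_n.+1} := (\sum_(P in B) val P)%VS.

Definition blocking B : bool :=
  [forall (H | hyperplane H), pg_meet B H != set0].

Definition small_set B : Prop := (2 * #|B| < 3 * (#|F| + 1))%N.

Definition meets_1mod (p e : nat) B : Prop :=
  forall H, hyperplane H -> #|pg_meet B H| = 1 %[mod p ^ e].

(* No e is an exponent if every hyperplane meets B in exactly one point.  For a
   blocking set this only happens for n = 1 with B the whole line. *)
Definition is_exponent (p e : nat) B : Prop :=
  meets_1mod p e B /\ forall e', meets_1mod p e' B -> (e' <= e)%N.

Definition subspace_over (K : {set F}) (U : {set 'rV[F]_n.+1}) : Prop :=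
  0 \in U /\ {in K, forall a, {in U &, forall u v, a *: u + v \in U}}.

Definition linear_over (K : {set F}) S : Prop :=
  exists2 U : {set 'rV[F]_n.+1}, subspace_over K U &
    forall P : pg_point F n,
      P \in S <-> exists2 u, u \in U :\ 0 & val P = <[u]>%VS.

(* The subfield of F of order q0, when there is one, is unique. *)
Definition Fq_linear (q0 : nat) S : Prop :=
  exists K : {set F},
    [/\ GRing.divring_closed (mem K), #|K| = q0 & linear_over K S].

End BlockingSets.

(* Main.v *)
Require Import Defs.
From mathcomp Require Import all_boot all_order all_algebra all_field.
From mathcomp Require Import mxabelem zify ring.

Set Implicit Arguments.
Unset Strict Implicit.
Unset Printing Implicit Defensive.

Import GRing.Theory.

(** Choose coordinates on the span of [B]: the points of [B] become vectors of
    [F^h], and [q = s^h] for [s = p^e].  A line with at least two points of [B]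
    has [1 + s w] of them; call [w] its weight.

    Projecting [B] from a subspace [K] of codimension 2 gives the points off
    [K] slopes in [F].  Because hyperplanes meet [B] in [1 mod s] points, the
    product of the factors [X - slope] is an [s]-th power, and its [s]-th root is
    a fully reducible lacunary polynomial [X^(q/s) f + g].  On a line skew to
    [K] the product is [X E1(X^s) + E2(X^s)].  Maximality of [e] provides a line
    of weight prime to [p], for which [E2 / E1] is not a [p]-th power.  If [K]
    has many points, comparing the two polynomials for such a line, and
    bounding distinct roots from below by a Wronskian, shows that every slope
    is a root of one polynomial [X^s (X + a) + b X + c].  Cross-ratios of its
    roots lie in the field of order [s], and this makes [B] linear.

    For [h >= 4] a subspace [K] with many points grows from a line of weight at
    least 2, or from a plane with many points.  Otherwise the vectors [x] such
    that [x + l P] represents a point of [B] for all [l] in the field of order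
    [s] are closed under addition, for some point [P] of [B].  For [h = 3],
    counting lines by weight leaves two cases: one line of weight [s + 1], or
    [s + 1] concurrent lines of weight [s]. *)

(** The difficulty is that the lacunary polynomial may be a common factor [c] times a power
    [(X^Q f3 + g3)^P] with [P = p^j] unknown, and as long as [P > 1] the Wronskian of [f] and [g]
    vanishes. Two counts bound [P] from below. The first two moments of the hyperplane sizes give
    [b = q + 1 + s d] with [d < s^(h-3) (s + 2)], so the degree of [f] is small beside [q / s]. And
    a hyperplane through [K] and a point of [B] off [K] has more than [(s - 1) #|K|] points off [K];
    so if [K] has at least [2 s^(h-3)] points, there are too few slopes for [P <= s^(h-3)]. Hence
    [Q = s p^n] with [n < e]; the line of weight prime to [p] excludes [n > 0], and for [n = 0] the
    degrees of [f3] and [g3] are at most 1. The number [2 s^(h-3)] also sets the size of a starting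
    subspace: each added point multiplies the number of points by at least [s], so it is enough to
    begin with [2 s] points on a line or, for [h >= 5], [2 s^2] in a plane. *)

(** * Numerical inequalities *)

Lemma arith_b_lb q b A S : 1 < q -> 0 < A ->
  b + S = b * (q * A) -> q * (q * A) - 1 <= S -> q + 1 <= b.
Proof.
move=> q1 A0 e le; rewrite addn1 ltnNge; apply/negP => bq.
have [m mE] : exists m, q * A = m + 1.
  by exists (q * A - 1); rewrite subnK // muln_gt0 A0 andbT; lia.
rewrite mE !mulnDr !muln1 in e le; have SE : S = b * m by lia.
have : b * m <= q * m by rewrite leq_mul2r bq orbT.
lia.
Qed.

(** [(x - 1) (x - (s + 1)) >= 0] for [x = 1 + s k]: no such [x] lies strictly between [1] and
    [s + 1]. Summed over all hyperplanes it bounds the excess of [B]. *)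
Lemma arith_second_moment s k :
  (s + 2) * (1 + s * k) <= (1 + s * k) ^ 2 + (s + 1).
Proof.
case: k => [|k]; first by rewrite muln0 addn0 exp1n; lia.
by rewrite expnS expn1; nia.
Qed.

(** [S1] and [S2] are the first and second moments of the hyperplane sizes over the nonzero
    functionals, and [A = q^(h-2)]. Eliminating them leaves a quadratic inequality in [b]. *)
Lemma arith_quadratic s q b A S1 S2 : 0 < A -> s + 1 <= b -> 0 < q ->
  b + S1 = b * (q * A) -> b * b + S2 = b * (q * A) + b * (b - 1) * A ->
  (s + 2) * S1 <= S2 + (q * (q * A) - 1) * (s + 1) ->
  (s + 1) * b * q + b <= b * b + (s + 1) * q * q.
Proof.
move=> A0 sb q0 e1 e2 le.
have [k kE] : exists k, b = k + 1 + s by exists (b - 1 - s); lia.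
have [m mE] : exists m, q * (q * A) = m + 1.
  by exists (q * (q * A) - 1); rewrite subnK // !muln_gt0 q0 A0.
have e1' := congr1 (muln (s + 2)) e1.
have bb : b * (b - 1) = b * k + b * s by rewrite -mulnDr; congr (_ * _); lia.
have nn : (s + 2) * b <= b * b + (s + 1).
  have : b * b + (s + 1) = (s + 2) * b + (k + s) * k by rewrite kE; lia.
  lia.
rewrite mE addnK in le; have mE' := congr1 (muln (s + 1)) mE.
rewrite bb in e2.
have main : (s + 1) * b * q * A + b * A + (b * b + (s + 1)) <=
    b * b * A + (s + 1) * q * q * A + (s + 2) * b.
  have bbA : b * b * A = (b * k + b + b * s) * A by congr (_ * _); rewrite {2}kE; lia.
  rewrite bbA; clear bb kE nn bbA; lia.
rewrite -(leq_pmul2r A0); move: main nn; lia.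
Qed.

(** The quadratic is symmetric about [((s + 1) q + 1) / 2]. It is negative at [b0], the value of [b]
    for [d = u (s + 2)], hence from [b0] up to the mirror image [(s + 1) q + 1 - b0]; smallness
    keeps [b] below that image. *)
Lemma arith_d_bound u s q b d : 7 <= s -> 0 < u -> q = u * (s * (s * s)) ->
  b = q + 1 + s * d -> 2 * b <= 3 * q + 2 ->
  (s + 1) * b * q + b <= b * b + (s + 1) * q * q -> d < u * (s + 2).
Proof.
move=> s7 u0 qE bE b2 quad; rewrite ltnNge; apply/negP => hd.
move: quad; apply/negP; rewrite -ltnNge.
have [k kE] : exists k, s * s * s = k + s + 2 by exists (s * s * s - s - 2); nia.
set b0 := u * s * (s * s + s + 2) + 1.
have [x xE] : exists x, b = b0 + x.
  by exists (b - b0); rewrite subnKC // bE qE /b0; have := leq_mul (leqnn s) hd; lia.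
have [y yE] : exists y, (s + 1) * q + 1 = b + b0 + y.
  exists ((s + 1) * q + 1 - (b + b0)); rewrite subnKC //.
  have : b0 + b <= 3 * q + 2 by lia.
  by nia.
have E1 : (s + 1) * q + 1 = b0 + u * s * k.
  have -> : u * s * k = u * s * (s * s * s - s - 2) by congr (_ * _); lia.
  have e : s * s + s + 2 + (s * s * s - s - 2) = s * s * (s + 1) by lia.
  by rewrite /b0 addnAC -mulnDr e qE; lia.
have key : (s + 1) * q * q < b0 * (u * s * k).
  have -> : (s + 1) * q * q = u * s * ((s + 1) * (s * s * s) * (s * s) * u) by rewrite qE; lia.
  have -> : b0 * (u * s * k) = u * s * (b0 * k) by lia.
  rewrite ltn_pmul2l ?muln_gt0 ?u0 //; last by lia.
  have k0 : 0 < k by nia.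
  have : (s + 1) * (s * s * s) * (s * s) <= s * (s * s + s + 2) * k.
    have -> : (s + 1) * (s * s * s) * (s * s) = s * ((s + 1) * (s * s * s * s)) by lia.
    rewrite -[X in _ <= X]mulnA leq_mul2l; apply/orP; right.
    have c : 3 * (s * s) + 4 * s + 4 <= s * s * s by nia.
    have := congr1 (muln (s * s + s + 2)) kE; move: c; clear; lia.
  move=> /(leq_mul (leqnn u)); rewrite /b0; move: k0; clear; lia.
have : b0 * (u * s * k) <= b * (b0 + y).
  have -> : u * s * k = b + y by lia.
  by rewrite xE; move: (b0) => c; have := leq0n (x * y); clear; lia.
have -> : (s + 1) * b * q = b * ((s + 1) * q) by lia.
have := congr1 (muln b) yE; rewrite !mulnDr muln1; move: key; lia.
Qed.

(** If [P <= u], then there are [N3 >= s (s - 1)] distinct slopes, each with at least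
    [1 + 2 (s - 1) u] points; as [4 (s - 1)^2 >= 3 s^2] for [s >= 11], these are more than [3/2] of
    [q = u s^3]. *)
Lemma arith_P_gt s u Q P d3 delta N3 n bn : 11 <= s -> 0 < u -> 0 < P ->
  Q * P = s * s * u -> P * d3 <= delta -> delta < u * (s + 2) -> Q + 1 <= N3 + d3 ->
  N3 * (1 + (s - 1) * n) <= bn -> 2 * u <= n -> 2 * bn <= 3 * (u * (s * (s * s))) + 2 ->
  u < P.
Proof.
move=> s11 u0 P0 QP Pd dl N3l Nb un bl; rewrite ltnNge; apply/negP => Pu.
have [t tE] : exists t, s = t + 1 by exists (s - 1); lia.
have sE : s - 1 = t by lia.
have k1 : (d3 + (s * t - 2)) * P < Q * P.
  have h1 : P * (s * t - 2) <= u * (s * t - 2) by rewrite leq_mul2r Pu orbT.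
  have h2 : u * (s * t - 2) + u * (s + 2) = s * s * u.
    have -> : s * s * u = u * (s * s) by lia.
    by rewrite -mulnDr; congr (_ * _); rewrite tE; nia.
  rewrite QP mulnDl -h2 [d3 * P]mulnC [_ * P]mulnC; lia.
rewrite ltn_pmul2r // in k1.
have N3s : s * t <= N3 by lia.
have h3 : 1 + t * (2 * u) <= 1 + (s - 1) * n by rewrite sE leq_add2l leq_mul2l un orbT.
have h4 := leq_mul N3s h3.
have h5 : s * t * (1 + t * (2 * u)) <= bn by apply: leq_trans h4 Nb.
have h6 : 2 * (s * t) + 4 * (u * (s * (t * t))) <= 3 * (u * (s * (s * s))) + 2 by lia.
have t10 : 10 <= t by lia.
have t10t : 10 * t <= t * t by rewrite leq_mul2r t10 orbT.
have h7 : 3 * (s * s) <= 4 * (t * t) by rewrite tE; move: t10 t10t; clear; lia.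
have h8 : 3 * (u * (s * (s * s))) <= 4 * (u * (s * (t * t))).
  have -> : 3 * (u * (s * (s * s))) = u * s * (3 * (s * s)) by lia.
  have -> : 4 * (u * (s * (t * t))) = u * s * (4 * (t * t)) by lia.
  by rewrite leq_mul2l h7 orbT.
have h9 : s * 10 <= s * t by rewrite leq_mul2l t10 orbT.
move: h6 h8 h9 s11; clear; lia.
Qed.

(** [Nc] counts the slopes of a line that are roots of [c] only. It is at most [(s + 3) / 2], and
    [pi + w d3] is at most [(w + 1) s / 11]. *)
Lemma arith_hits s u n delta w pi d3 Nc : 11 <= s -> 0 < u -> 2 * u <= n ->
  delta < u * (s + 2) -> Nc * (1 + (s - 1) * n) <= s * delta -> 11 * pi <= s ->
  d3 <= pi -> 0 < w -> pi + w * d3 + Nc <= w * s.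
Proof.
move=> s11 u0 un dl Nb ps dp w0.
have [t tE] : exists t, s = t + 1 by exists (s - 1); lia.
have sE : s - 1 = t by lia.
have h1 : Nc * (t * (2 * u)) <= s * (u * (s + 2)).
  apply: leq_trans (_ : Nc * (1 + (s - 1) * n) <= _).
    rewrite leq_mul2l sE; apply/orP; right.
    by apply: leq_trans (leq_addl _ _); rewrite leq_mul2l un orbT.
  by apply: leq_trans Nb _; rewrite leq_mul2l; apply/orP; right; lia.
have h2 : Nc * (t * 2) <= s * (s + 2).
  rewrite -(leq_pmul2r u0); move: h1; lia.
have h3 : 2 * Nc <= s + 3.
  rewrite leqNgt; apply/negP => lt.
  have : (s + 4) * t <= 2 * Nc * t by rewrite leq_mul2r; apply/orP; right; lia.
  have t10 : 10 <= t by lia.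
  move: h2 t10; rewrite tE; clear; lia.
have h4 : w * d3 <= w * pi by rewrite leq_mul2l dp orbT.
have h5 : w * (11 * pi) <= w * s by rewrite leq_mul2l ps orbT.
have h6 : s <= w * s by rewrite leq_pmull.
lia.
Qed.

(** If [d3 > p^i], the bound on [p^j d3] gives [p^j < 2 u]; but [i < e] gives [2 p^i <= s], so
    [p^j = s u / p^i >= 2 u]. *)
Lemma arith_exponent p e h j d3 u s : 1 < p -> 3 <= h -> s = p ^ e -> u = s ^ (h - 3) -> 0 < e ->
  u < p ^ j -> 0 < d3 -> p ^ j * d3 < u * (s + 2) -> 2 < s ->
  exists i, [/\ i < e, j + i = e * (h - 2), p ^ j * p ^ i = s * u & d3 <= p ^ i].
Proof.
move=> p1 h3 sE uE e0 uj d0 jd s2; have p0 := ltnW p1.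
have uE' : u = p ^ (e * (h - 3)) by rewrite uE sE -expnM.
have u0 : 0 < u by rewrite uE' expn_gt0 p0.
have j1 : e * (h - 3) < j by rewrite -(ltn_exp2l _ _ p1) -uE'.
have h23 : e * (h - 2) = e * (h - 3) + e by rewrite -mulnSr; congr (_ * _); lia.
have j2 : j <= e * (h - 2).
  rewrite -ltnS -(ltn_exp2l _ _ p1) expnS h23 expnD -uE' -sE.
  apply: leq_ltn_trans (_ : p ^ j * d3 < _); first by rewrite leq_pmulr.
  apply: leq_trans jd _; rewrite mulnCA leq_mul2l; apply/orP; right; nia.
exists (e * (h - 2) - j); set i := _ - j.
have ji : j + i = e * (h - 2) by rewrite subnKC.
have ie : i < e by lia.
have PP : p ^ j * p ^ i = s * u by rewrite -expnD ji h23 expnD -uE' -sE mulnC.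
split=> //; rewrite leqNgt; apply/negP => lt.
have k1 : p ^ j * (p ^ i + 1) <= p ^ j * d3 by rewrite leq_mul2l; apply/orP; right; lia.
have k2 : s * u + p ^ j < u * (s + 2) by move: k1 jd; rewrite mulnDr PP muln1; lia.
have k3 : p ^ j < 2 * u by lia.
have k4 : 2 * p ^ i <= s.
  rewrite sE; apply: leq_trans (leq_pexp2l p0 ie); rewrite expnS leq_mul2r.
  by apply/orP; right.
have : p ^ j * (2 * p ^ i) < 2 * u * s.
  apply: leq_ltn_trans (_ : p ^ j * s < _); first by rewrite leq_mul2l k4 orbT.
  by rewrite ltn_pmul2r //; lia.
by rewrite mulnCA PP; lia.
Qed.

Local Open Scope ring_scope.

(** * Polynomials over finite fields *)

Lemma coef_geq (R : nzSemiRingType) (P : {poly R}) i : (size P <= i)%N -> P`_i = 0.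
Proof. exact: nth_default. Qed.

Lemma size_index_enum (K : finType) : size (index_enum K) = #|K|.
Proof. by rewrite -sum1_size sum1_card. Qed.

Section Vanishing.
Variable F : finFieldType.
Local Notation q := #|F|.
Implicit Types P : {poly F}.

Lemma card_finField_gt1 : (1 < q)%N.
Proof. exact: finNzRing_gt1. Qed.

Lemma dvd_genPoly P : (forall x, root P x) -> 'X^q - 'X %| P.
Proof.
move=> h; rewrite finField_genPoly -big_enum /=.
apply: uniq_roots_dvdp; first by apply/allP=> x _; exact: h.
by rewrite uniq_rootsE enum_uniq.
Qed.

Lemma vanish_small P : (forall x, root P x) -> (size P <= q)%N -> P = 0.
Proof.
move=> h sz; apply: (@roots_geq_poly_eq0 _ _ (enum F)).
- by apply/allP=> x _; exact: h.
- exact: enum_uniq.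
- by rewrite -cardE.
Qed.

Lemma vanish_off0 P : (forall x, x != 0 -> root P x) -> (size P < q)%N -> P = 0.
Proof.
move=> h sz; apply: (@roots_geq_poly_eq0 _ _ (enum (predC1 (0 : F)))).
- by apply/allP=> x; rewrite mem_enum; exact: h.
- exact: enum_uniq.
- rewrite -cardE cardC1 -ltnS prednK ?(leq_ltn_trans _ sz) //.
Qed.

Lemma coef_genPolyM P i :
  (('X^q - 'X) * P)`_i = (if (i < q)%N then 0 else P`_(i - q)) -
                         (if i is k.+1 then P`_k else 0).
Proof.
rewrite mulrBl coefB coefXnM coefXM; congr (_ - _).
by case: i.
Qed.

Lemma genPoly_factor P : (forall x, root P x) -> exists D : {poly F}, P = ('X^q - 'X) * D.
Proof. by move=> /dvd_genPoly /dvdpP [D ->]; exists D; rewrite mulrC. Qed.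

Lemma size_genPolyM P : P != 0 -> size (('X^q - 'X) * P) = (size P + q)%N.
Proof.
move=> P0; have q1 := card_finField_gt1.
have szg : size ('X^q - 'X : {poly F}) = q.+1.
  by rewrite size_polyDl size_polyXn // size_polyN size_polyX; lia.
have g0 : 'X^q - 'X != 0 :> {poly F} by rewrite -size_poly_eq0 szg.
by rewrite size_mul // szg addSn /= addnC.
Qed.

(** In [P = (X^q - X) D] the coefficients below degree [q] are those of [- X D], and [D] has degree
    below [i - 1]. *)
Lemma vanish_coef P i : (forall x, root P x) -> (i < q)%N ->
  (size P < i + q)%N -> P`_i = 0.
Proof.
move=> h iq sz; have [D PD] := genPoly_factor h.
have [D0|D0] := eqVneq D 0; first by rewrite PD D0 mulr0 coef0.
have szP : size P = (size D + q)%N by rewrite PD size_genPolyM.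
rewrite PD coef_genPolyM iq sub0r; case: i iq sz => [|i] iq sz; first by rewrite oppr0.
have szD : (size D <= i)%N by move: sz szP; lia.
by rewrite (coef_geq szD) oppr0.
Qed.

(** Among the exponents up to [2 q - 2] only [i] and [q + i - 1] reduce to [i] modulo [X^q - X]. *)
Lemma vanish_pair P i : (forall x, root P x) -> (0 < i < q)%N ->
  (size P < q + q)%N -> P`_i = - P`_(q + i.-1).
Proof.
move=> h /andP[i0 iq] sz; have [D PD] := genPoly_factor h.
have [D0|D0] := eqVneq D 0; first by rewrite PD D0 mulr0 !coef0 oppr0.
have szP : size P = (size D + q)%N by rewrite PD size_genPolyM.
rewrite PD !coef_genPolyM iq sub0r.
rewrite ltnNge leq_addr /= addKn.
case: i i0 iq => // i _ iq /=.
case E: (q + i)%N => [|k]; first by lia.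
have szD : (size D <= k)%N by move: szP sz E; lia.
by rewrite [D`_k](coef_geq szD) subr0.
Qed.

Lemma vanish_coef0 P : (forall x, root P x) -> P`_0 = 0.
Proof. by move=> h; have /rootP := h 0; rewrite horner_coef0. Qed.

End Vanishing.

Section Gap.
Variable F : finFieldType.
Local Notation q := #|F|.

(* Total degree at most [n] in the two variables. *)
Definition tdeg (n : nat) (R : {poly {poly F}}) :=
  forall i : nat, (size (R`_i)%R <= n.+1 - i)%N.

(** The affine form [a + b y + c z], with [y] the outer variable and [z] the inner one. *)
Definition lin2 (a b c : F) : {poly {poly F}} :=
  (a%:P + c *: 'X)%:P + b%:P *: 'X.

Lemma coef_lin2 R a b c i :
  (R * lin2 a b c)`_i = a *: R`_i + c *: ('X * R`_i) +
                        b *: (if i is k.+1 then R`_k else 0).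
Proof.
rewrite /lin2 mulrDr coefD mulrC coefCM mulrDl mul_polyC -scalerAl; congr (_ + _).
by rewrite -scalerAr coefZ coefMX mul_polyC; case: i => //=; rewrite scaler0.
Qed.

Lemma tdeg_lin2 n R a b c : tdeg n R -> tdeg n.+1 (R * lin2 a b c).
Proof.
move=> h i; rewrite coef_lin2.
have hi := h i; apply: leq_trans (size_polyD _ _) _; rewrite geq_max; apply/andP; split.
  apply: leq_trans (size_polyD _ _) _; rewrite geq_max; apply/andP; split.
    by apply: leq_trans (size_scale_leq _ _) _; lia.
  apply: leq_trans (size_scale_leq _ _) _.
  have [->|R0] := eqVneq R`_i 0; first by rewrite mulr0 size_poly0.
  by rewrite mulrC size_mulX //; move: hi; rewrite -size_poly_gt0 in R0; lia.
apply: leq_trans (size_scale_leq _ _) _.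
case: i {hi} => [|k]; first by rewrite size_poly0.
by have := h k; lia.
Qed.

Lemma tdeg_prod (K : Type) (r : seq K) (al be ga : K -> F) :
  tdeg (size r) (\prod_(k <- r) lin2 (al k) (be k) (ga k)).
Proof.
elim: r => [|k r IH]; last by rewrite big_cons mulrC; exact: tdeg_lin2.
rewrite big_nil => i; rewrite coef1; case: i => [|i] /=; first by rewrite size_poly1.
by rewrite size_poly0.
Qed.

Definition ev2 (z : F) : {poly {poly F}} -> {poly F} := map_poly (horner_eval z).

Lemma coef_ev2 z R i : (ev2 z R)`_i = (R`_i).[z].
Proof. by rewrite coef_map_id0 //= /horner_eval horner0. Qed.

Lemma ev2_lin2 z a b c : ev2 z (lin2 a b c) = (a + c * z)%:P + b *: 'X.
Proof.
apply/polyP=> i; rewrite coef_ev2 /lin2 !coefD !coefC !coefZ !coefX.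
case: i => [|[|i]] /=; rewrite ?mulr0 ?mulr1 ?addr0 ?add0r ?hornerE //=.
Qed.

Lemma ev2_prod z (K : Type) (r : seq K) (al be ga : K -> F) :
  ev2 z (\prod_(k <- r) lin2 (al k) (be k) (ga k)) =
  \prod_(k <- r) ((al k + ga k * z)%:P + be k *: 'X).
Proof.
rewrite /ev2 rmorph_prod; apply: eq_bigr => k _; exact: ev2_lin2.
Qed.

(** A Redei polynomial argument. Twisting the factors by [ga k * z] gives, for each [z != 0], a
    polynomial vanishing on [F], so its coefficient of index [i] is zero. As a polynomial in [z]
    this coefficient has degree below [q - 1], so it is zero at [z = 0] as well. *)
Lemma gap (K : eqType) (r : seq K) (al ga : K -> F) i :
  (forall z, z != 0 -> forall x, exists2 k, k \in r & x + al k + ga k * z = 0) ->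
  (size r + 1 < i + q)%N -> (i < q)%N ->
  (\prod_(k <- r) ('X + (al k)%:P))`_i = 0.
Proof.
move=> h Ni iq; pose R := \prod_(k <- r) lin2 (al k) 1 (ga k).
have evR z : ev2 z R = \prod_(k <- r) ('X + (al k + ga k * z)%:P).
  by rewrite /R ev2_prod; apply: eq_bigr => k _; rewrite scale1r addrC.
have td : tdeg (size r) R by exact: tdeg_prod.
have szev z : size (ev2 z R) = (size r).+1.
  rewrite evR (eq_bigr (fun k => 'X - (- (al k + ga k * z))%:P)); last by move=> k _; rewrite polyCN opprK.
  by rewrite size_prod_XsubC.
have R0 : R`_i = 0.
  apply: vanish_off0 => [z z0|]; last by have := td i; lia.
  apply/rootP; rewrite -coef_ev2; apply: vanish_coef => //; last by rewrite szev; lia.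
  move=> x; have [k kr hk] := h z z0 x; apply/rootP; rewrite evR horner_prod.
  by rewrite (big_rem k) //= hornerD hornerX hornerC addrA hk mul0r.
have E : \prod_(k <- r) ('X + (al k)%:P) = ev2 0 R.
  by rewrite evR; apply: eq_bigr => k _; rewrite mulr0 addr0.
by rewrite E coef_ev2 R0 horner0.
Qed.

End Gap.

Section Frobenius.
Variables (R : comNzRingType) (s : nat).
Hypothesis sR : [pchar R].-nat s.

Lemma pnat_pchar_poly : [pchar {poly R}].-nat s.
Proof. by rewrite (eq_pnat _ (@pchar_poly R)). Qed.

Lemma frob_sum (I : Type) (r : seq I) (P : pred I) (G : I -> R) :
  (\sum_(i <- r | P i) G i) ^+ s = \sum_(i <- r | P i) G i ^+ s.
Proof.
apply: (big_morph (fun x => x ^+ s)) => [x y|]; first exact: exprDn_pchar.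
by rewrite expr0n; case: s sR.
Qed.
End Frobenius.

Section FrobeniusPoly.
Variables (R : comNzRingType) (s : nat).
Hypothesis sR : [pchar R].-nat s.

Definition frobp (P : {poly R}) : {poly R} := \poly_(i < size P) (P`_i ^+ s).

Lemma coef_frobp P i : (frobp P)`_i = P`_i ^+ s.
Proof.
rewrite coef_poly; case: ltnP => // h; rewrite [P`_i]coef_geq // expr0n.
by case: s sR.
Qed.

Lemma exp_frobp P : P ^+ s = frobp P \Po 'X^s.
Proof.
rewrite -[in LHS](coefK P) poly_def (frob_sum (pnat_pchar_poly sR)).
rewrite /frobp poly_def rmorph_sum /=; apply: eq_bigr => i _.
rewrite exprZn comp_polyZ; congr (_ *: _).
by rewrite rmorphXn /= comp_polyX exprAC.
Qed.

Lemma coef_exp_frob (P : {poly R}) i :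
  (P ^+ s)`_i = if (s %| i)%N then P`_(i %/ s) ^+ s else 0.
Proof.
have s0 : (0 < s)%N by case/andP: sR.
by rewrite exp_frobp coef_comp_poly_Xn // coef_frobp.
Qed.

End FrobeniusPoly.

Section Fibers.
Variable F : finFieldType.
Local Notation q := #|F|.

Lemma prod_fibers (I : finType) (A : pred I) (r : I -> F) :
  \prod_(i | A i) ('X - (r i)%:P) =
  \prod_x ('X - x%:P) ^+ #|[set i | A i & r i == x]|.
Proof.
rewrite (partition_big r predT) //=; apply: eq_bigr => x _.
rewrite (eq_bigr (fun=> 'X - x%:P)); last by move=> i /andP[_ /eqP->].
rewrite -[RHS](@prodr_const _ _ (mem [set i | A i & r i == x])); apply: eq_bigl => i.
by rewrite inE.
Qed.

Lemma prod_lin_1mod (I : finType) (al be : I -> F) s :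
  (forall y, #|[set i | al i + be i * y == 0]| = 1 %[mod s]) -> (1 < s)%N ->
  exists c u, \prod_i ((al i)%:P + be i *: 'X) = ('X^q - 'X) * (c *: u ^+ s).
Proof.
move=> h s1; case: (pickP (fun i => (al i == 0) && (be i == 0))) => [i /andP[/eqP a0 /eqP b0]|noz].
  by exists 0, 0; rewrite (bigD1 i) //= a0 b0 polyC0 add0r !scale0r mulr0 mul0r.
pose N x := #|[set i | be i != 0 & - (al i / be i) == x]|.
have NE x : N x = (N x %/ s * s).+1.
  suff: N x = 1 %[mod s] by move=> e; rewrite [LHS](divn_eq _ s) e modn_small // addn1.
  rewrite -(h x); congr (_ %% _)%N; apply: eq_card => i; rewrite !inE.
  have := noz i; have [b0|b0] := eqVneq (be i) 0.
    by rewrite b0 mul0r addr0 andbT.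
  move=> _ /=; apply/eqP/eqP => [<-|e]; first by rewrite mulrN mulrC divfK // subrr.
  by apply: (mulfI b0); rewrite mulrN mulrC divfK //; apply/eqP; rewrite eq_sym -addr_eq0 addrC e.
exists (\prod_(i | be i == 0) al i * \prod_(i | be i != 0) be i).
exists (\prod_x ('X - x%:P) ^+ (N x %/ s)).
rewrite (bigID (fun i => be i == 0)) /=.
rewrite (eq_bigr (fun i => (al i)%:P)); last by move=> i /eqP->; rewrite scale0r addr0.
rewrite [X in _ * X](eq_bigr (fun i => (be i)%:P * ('X - (- (al i / be i))%:P))); last first.
  by move=> i b0; rewrite mul_polyC polyCN opprK scalerDr -[_ *: _%:P]mul_polyC -polyCM mulrC divfK // addrC.
rewrite big_split /= -!rmorph_prod prod_fibers mulrA -polyCM mul_polyC -scalerAr; congr (_ *: _).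
rewrite finField_genPoly -prodrXl -big_split /=; apply: eq_bigr => x _.
by rewrite -exprM -exprS -NE.
Qed.
End Fibers.

Section TwoVariables.
Variables (F : finFieldType) (I : finType).
Local Notation q := #|F|.

Lemma tdeg_full (al be ga : I -> F) : tdeg #|I| (\prod_i lin2 (al i) (be i) (ga i)).
Proof. by have := tdeg_prod (index_enum I) al be ga; rewrite size_index_enum. Qed.

Lemma swapXY_lin2 (a b c : F) : swapXY (lin2 a b c) = lin2 a c b.
Proof.
apply/polyP=> i; apply/polyP=> j; rewrite coef_swapXY /lin2.
rewrite !(coefD, coefC, coefZ, coefX).
case: i => [|[|i]]; case: j => [|[|j]];
  by rewrite /= ?(coefD, coefC, coefZ, coefX, coef0, mulr0, mulr1, addr0, add0r) /=
     ?(coefD, coefC, coefZ, coefX, coef0, mulr0, mulr1, addr0, add0r).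
Qed.

Section OneMod.
Variables (s : nat) (al be ga : I -> F).
Hypothesis sF : [pchar F].-nat s.
Hypothesis s1 : (1 < s)%N.
Hypothesis Iq : (#|I| < q + q - 1)%N.
Hypothesis h : forall y z,
  #|[set i | al i + be i * y + ga i * z == 0]| = 1 %[mod s].

Let R := \prod_i lin2 (al i) (be i) (ga i).

Let td k : (size (R`_k)%R <= #|I|.+1 - k)%N.
Proof. exact: tdeg_full. Qed.

Let evRE z : exists c u, ev2 z R = ('X^q - 'X) * (c *: u ^+ s).
Proof.
rewrite /R ev2_prod; apply: prod_lin_1mod => // y; rewrite -(h y z).
by congr (_ %% _)%N; apply: eq_card => i; rewrite !inE addrAC.
Qed.

Let size_ev z : (size (ev2 z R) <= #|I|.+1)%N.
Proof.
apply/leq_sizeP => j hj; rewrite coef_ev2.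
have hs := td j.
have: (size (R`_j)%R <= 0)%N by move: hs hj; lia.
by rewrite leqn0 size_poly_eq0 => /eqP->; rewrite horner0.
Qed.

(** For fixed [z] the product is [(X^q - X) c u^s], whose coefficient at [q + i] is that of [c u^s]
    at [i], hence zero. Its degree in [z] is below [q], so it vanishes identically. *)
Lemma high_coef0 i : ~~ (s %| i)%N -> R`_(q + i) = 0.
Proof.
move=> si; have i0 : (0 < i)%N by case: i si; rewrite ?dvdn0.
have szR : (size (R`_(q + i))%R <= q)%N by have := td (q + i)%N; lia.
apply: vanish_small szR => z.
have [c [u e]] := evRE z; apply/rootP; rewrite -coef_ev2.
have sz := size_ev z.
have [D0|D0] := eqVneq (c *: u ^+ s) 0; first by rewrite e D0 mulr0 coef0.
have szD : (size (c *: u ^+ s) + q <= #|I|.+1)%N.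
  by rewrite -size_genPolyM // -e.
rewrite e coef_genPolyM ltnNge leq_addr /= addKn coefZ (coef_exp_frob sF) (negPf si) mulr0 sub0r.
case E: (q + i)%N => [|k]; first by rewrite oppr0.
have szk : (size (c *: u ^+ s) <= k)%N by move: szD E Iq i0; lia.
by rewrite (coef_geq szk) oppr0.
Qed.

Let pair_coef i : (0 < i < q)%N -> forall x, root (R`_i + R`_(q + i.-1)) x.
Proof.
move=> hi z; apply/rootP; rewrite hornerD -!coef_ev2.
have szE : (size (ev2 z R) < q + q)%N by have := size_ev z; move: Iq; lia.
rewrite (@vanish_pair _ (ev2 z R) i) ?addNr //.
move=> x; have [c [u ->]] := evRE z; apply/rootP.
by rewrite hornerM hornerD hornerN hornerXn hornerX expf_card subrr mul0r.
Qed.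

(** [vanish_pair] in both variables; the coefficient at [(q + i - 1, q + j - 1)] has too large a
    total degree to occur. *)
Lemma mixed_coef i j : (0 < i < q)%N -> (j < q)%N ->
  R`_i`_j = - R`_(q + i.-1)`_j - (if j is k.+1 then R`_i`_(q + k) else 0).
Proof.
move=> hi jq; have v := pair_coef hi.
set E := R`_i + R`_(q + i.-1) in v.
have szE : (size E < q + q)%N.
  apply: leq_ltn_trans (size_polyD _ _) _; rewrite gtn_max.
  by have := td i; have := td (q + i.-1)%N; move: Iq hi; lia.
case: j jq => [|j] jq.
  by have := vanish_coef0 v; rewrite coefD => /eqP; rewrite addr_eq0 => /eqP ->; rewrite subr0.
have := vanish_pair v (_ : (0 < j.+1 < q)%N) szE; rewrite jq => /(_ isT) /=.
rewrite !coefD [(R`_(q + i.-1))`_(q + j)]coef_geq ?addr0; last first.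
  by have := td (q + i.-1)%N; move: Iq hi; lia.
by move=> e; rewrite -[LHS](addrK (R`_(q + i.-1)`_j.+1)) e addrC.
Qed.

End OneMod.

Lemma prod_lin2_swap (al be ga : I -> F) i j :
  (\prod_k lin2 (al k) (be k) (ga k))`_i`_j = (\prod_k lin2 (al k) (ga k) (be k))`_j`_i.
Proof.
rewrite -coef_swapXY rmorph_prod; under eq_bigr do rewrite /= swapXY_lin2.
by [].
Qed.

Section LowestForm.
Variables (s : nat) (al be ga : I -> F).
Hypothesis sF : [pchar F].-nat s.
Hypothesis s1 : (1 < s)%N.
Hypothesis Iq : (#|I| < q + q - 1)%N.
Hypothesis h : forall y z,
  #|[set i | al i + be i * y + ga i * z == 0]| = 1 %[mod s].

Let h' y z : #|[set i | al i + ga i * y + be i * z == 0]| = 1 %[mod s].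
Proof. by rewrite -(h z y); congr (_ %% _)%N; apply: eq_card => i; rewrite !inE addrAC. Qed.

Lemma low_coef i j : (0 < i)%N -> (i < q)%N -> (j < q)%N ->
  ~~ (s %| i.-1)%N -> ((0 < j)%N -> ~~ (s %| j.-1)%N) ->
  (\prod_k lin2 (al k) (be k) (ga k))`_i`_j = 0.
Proof.
move=> i0 iq jq si sj; rewrite (mixed_coef sF s1 Iq h) ?i0 //.
rewrite (high_coef0 sF s1 Iq h) // coef0 oppr0 add0r.
case: j jq sj => [|j] jq sj; first by rewrite oppr0.
rewrite prod_lin2_swap (high_coef0 sF s1 Iq h') ?sj //.
by rewrite coef0 oppr0.
Qed.

(** The form [a + b y + c z] with [y] and [z] scaled by a new outer variable, whose degree records
    the total degree. The inner variable is [y], and [z] is set to 1. *)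
Definition hlin (a b c : F) : {poly {poly F}} := (a%:P)%:P + (b *: 'X + c%:P) *: 'X.

Lemma coef_hlin G a b c m i :
  (G * hlin a b c)`_m`_i = a * G`_m`_i +
    (if m is m'.+1 then b * (if i is i'.+1 then G`_m'`_i' else 0) + c * G`_m'`_i else 0).
Proof.
rewrite /hlin mulrDr coefD coefD mulrC coefCM coefCM; congr (_ + _).
rewrite -scalerAr coefZ coefMX; case: m => [|m] /=; first by rewrite mulr0 coef0.
rewrite mulrDl coefD -scalerAl coefZ coefCM; congr (b * _ + _).
by rewrite coefXM; case: i.
Qed.

Lemma hlin_coef (K : Type) (r : seq K) (a b c : K -> F) :
  let G := \prod_(k <- r) hlin (a k) (b k) (c k) in
  let R := \prod_(k <- r) lin2 (a k) (b k) (c k) in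
  (forall i j, G`_(i + j)`_i = R`_i`_j) /\ (forall m i, (m < i)%N -> G`_m`_i = 0).
Proof.
elim: r => [|k r [IH1 IH2]] /=.
  rewrite !big_nil; split=> [i j|m i mi]; rewrite !coef1.
    by case: i => [|i]; case: j => [|j] /=; rewrite ?coef1 ?coef0.
  by case: m mi => [|m]; case: i => [|i] //= _; rewrite ?coef1 ?coef0.
rewrite !big_cons mulrC [lin2 _ _ _ * _]mulrC; split=> [i j|m i mi]; rewrite coef_hlin.
  rewrite coef_lin2 !coefD !coefZ coefXM IH1.
  rewrite -addrA; congr (_ + _); case: i => [|i]; case: j => [|j] /=.
  - by rewrite coef0 !mulr0 addr0.
  - by rewrite coef0 !mulr0 addr0 add0r (IH1 0%N j).
  - by rewrite mulr0 add0r (IH1 i 0%N) addn0 IH2 // mulr0 addr0.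
  - by rewrite (IH1 i j.+1) addnS -addSn (IH1 i.+1 j) addrC.
rewrite IH2 // mulr0 add0r; case: m mi => // m mi.
case: i mi => // i mi; rewrite !IH2 //; first by rewrite !mulr0 addr0.
by lia.
Qed.

(* The lowest homogeneous part of the product of the affine forms
   al + be y + ga z is, up to a constant, the product of the linear ones. *)
Lemma lowest_form i :
  let n := #|[set k | al k == 0]| in (0 < n < q)%N ->
  ~~ (s %| i)%N -> ~~ (s %| i.-1)%N ->
  (\prod_(k | al k == 0) (be k *: 'X + (ga k)%:P))`_i = 0.
Proof.
move=> n /andP[n0 nq] si si'; have i0 : (0 < i)%N by case: i si {si'}; rewrite ?dvdn0.
have n1 : n = 1 %[mod s].
  by rewrite -(h 0 0); congr (_ %% _)%N; apply: eq_card => k; rewrite !inE !mulr0 !addr0.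
pose G := \prod_k hlin (al k) (be k) (ga k).
set L := \prod_(k | _) _.
pose H := \prod_(k | al k != 0) hlin (al k) (be k) (ga k).
have GE : G = 'X^n * (L%:P * H).
  rewrite /G (bigID (fun k => al k == 0)) /= mulrA; congr (_ * _).
  rewrite (eq_bigr (fun k => 'X * (be k *: 'X + (ga k)%:P)%:P)); last first.
    by move=> k /eqP->; rewrite /hlin !polyC0 add0r -mul_polyC mulrC.
  rewrite big_split /= rmorph_prod; congr (_ * _).
  by rewrite -[RHS](@prodr_const _ _ (mem [set k | al k == 0])); apply: eq_bigl => k; rewrite inE.
have H0 : H`_0 = (\prod_(k | al k != 0) al k)%:P.
  rewrite -horner_coef0 /H horner_prod rmorph_prod; apply: eq_bigr => k _.
  by rewrite /hlin hornerD hornerC hornerZ hornerX mulr0 addr0.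
have LE : L`_i * \prod_(k | al k != 0) al k = G`_n`_i.
  by rewrite GE coefXnM ltnn subnn coefCM H0 coefMC.
have nz : \prod_(k | al k != 0) al k != 0 by apply/prodf_neq0.
apply: (mulIf nz); rewrite LE mul0r.
have [h1 h2] := hlin_coef (index_enum I) al be ga.
case: (leqP i n) => [le_in|]; last exact: h2.
rewrite -(subnKC le_in) h1 low_coef //; [lia | lia | move=> nin].
(* With [j = n - i] one has [i + j = 1] modulo [s], so [s] dividing [j - 1] would divide [i]. *)
apply/negP=> hd; case/negP: si.
have : (s %| n - 1)%N by rewrite -eqn_mod_dvd // n1.
have -> : (n - 1 = (n - i).-1 + i)%N by lia.
by rewrite dvdn_addr.
Qed.

End LowestForm.
End TwoVariables.

Lemma leq_size_mul (R : nzSemiRingType) (f g : {poly R}) a b :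
  (size f <= a)%N -> (size g <= b)%N -> (size (f * g)%R <= (a + b).-1)%N.
Proof. by move=> fa gb; apply: leq_trans (size_polyMleq _ _) _; lia. Qed.

Lemma leq_size_add (R : nzSemiRingType) (f g : {poly R}) a :
  (size f <= a)%N -> (size g <= a)%N -> (size (f + g)%R <= a)%N.
Proof. by move=> fa gb; apply: leq_trans (size_polyD _ _) _; rewrite geq_max fa. Qed.

Lemma leq_size_sub (R : nzRingType) (f g : {poly R}) a :
  (size f <= a)%N -> (size g <= a)%N -> (size (f - g)%R <= a)%N.
Proof. by move=> fa gb; apply: leq_size_add => //; rewrite size_polyN. Qed.

Lemma size_mulD1 (R : idomainType) (f g : {poly R}) :
  f != 0 -> g != 0 -> (size (f * g)%R + 1 = size f + size g)%N.
Proof.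
by move=> f0 g0; rewrite size_mul //; move: f0; rewrite -size_poly_gt0; lia.
Qed.

Lemma size_XnM_add (R : nzRingType) n (f g : {poly R}) :
  f != 0 -> (size g < n + size f)%N -> size ('X^n * f + g) = (n + size f)%N.
Proof.
move=> f0 gf; have e : size ('X^n * f) = (n + size f)%N by rewrite -commr_polyXn size_mulXn.
by rewrite size_polyDl e.
Qed.

(** * Wronskians and the roots of lacunary polynomials *)

Section Wronskian.
Variable F : fieldType.
Implicit Types (f g P : {poly F}) (rs : seq F).

Definition wronskian f g := f * g^`() - f^`() * g.

Definition split_poly rs : {poly F} := \prod_(r <- rs) ('X - r%:P).

Lemma split_dvd_rad_deriv rs :
  split_poly rs %| split_poly (undup rs) * (split_poly rs)^`().
Proof.
rewrite /split_poly; elim: rs => [|a rs IH] /=; first by rewrite big_nil dvd1p.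
rewrite big_cons derivM derivXsubC mul1r.
set P := \prod_(r <- rs) _ in IH *; set D := P^`() in IH *.
case: ifP => [ars|_].
  set U := \prod_(r <- undup rs) _ in IH *.
  have aU : 'X - a%:P %| U by rewrite dvdp_XsubCl root_prod_XsubC mem_undup.
  rewrite mulrDr dvdp_add //; first by rewrite dvdp_mul.
  by rewrite mulrCA dvdp_mul.
rewrite big_cons; set U := \prod_(r <- undup rs) _ in IH *.
rewrite -mulrA dvdp_mul //; rewrite mulrDr dvdp_add //; first by rewrite dvdp_mull.
by rewrite mulrCA dvdp_mull.
Qed.

Lemma size_wronskian f g : (size g <= size f)%N ->
  (size (wronskian f g) <= ((size f).-1).*2)%N.
Proof.
move=> gf; have [->|f0] := eqVneq f 0.
  by rewrite /wronskian deriv0 !mul0r subrr size_poly0.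
have sf : (0 < size f)%N by rewrite size_poly_gt0.
have sd (h : {poly F}) : (size h <= size f)%N -> (size (h^`())%R <= (size f).-1)%N.
  move=> hf; have [->|h0] := eqVneq h 0; first by rewrite deriv0 size_poly0.
  by have := lt_size_deriv h0; move: hf; lia.
apply: leq_size_sub.
  by apply: leq_trans (leq_size_mul (leqnn _) (sd _ gf)) _; move: sf; lia.
by apply: leq_trans (leq_size_mul (sd _ (leqnn _)) gf) _; move: sf; lia.
Qed.

(** As [p] divides [Q], the derivative of [P = X^Q f + g] is [X^Q f' + g'], and [f P' - f' P] is the
    Wronskian. [P] divides the product of its radical with [P'], hence also with the Wronskian,
    whose degree is less than twice that of [f]. *)
Lemma distinct_roots_lb (p Q : nat) c f g rs :
  p \in [pchar F] -> (p %| Q)%N -> c != 0 ->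
  c *: split_poly rs = 'X^Q * f + g -> (0 < Q)%N ->
  (size g <= size f)%N -> wronskian f g != 0 ->
  (Q + 2 <= size (undup rs) + size f)%N.
Proof.
move=> pF pQ c0 PE Q0 gf W0.
have f0 : f != 0 by apply: contraNneq W0 => ->; rewrite /wronskian deriv0 !mul0r subrr.
have sf : (0 < size f)%N by rewrite size_poly_gt0.
have szP : size (split_poly rs) = (Q + size f)%N.
  have szg : (size g < Q + size f)%N by lia.
  by rewrite -(size_scale _ c0) PE size_XnM_add.
have /(congr1 (@deriv F)) := PE.
rewrite derivZ derivD derivM derivXn -mulr_natr.
have /eqP -> : Q%:R == 0 :> {poly F} by rewrite -(dvdn_pcharf (rmorph_pchar (@polyC F) pF)).
rewrite mulr0 mul0r add0r => dPE.
have dv : split_poly rs %| split_poly (undup rs) * wronskian f g.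
  have -> : wronskian f g = f * (c *: (split_poly rs)^`()) - f^`() * (c *: split_poly rs).
    by rewrite dPE PE /wronskian; ring.
  rewrite mulrBr dvdp_sub //; last by rewrite -!scalerAr dvdpZr // mulrA dvdp_mull.
  by rewrite -scalerAr -scalerAr dvdpZr // mulrCA dvdp_mull // split_dvd_rad_deriv.
have u0 : split_poly (undup rs) != 0 by apply: monic_neq0; exact: monic_prod_XsubC.
have le : (size (split_poly rs) + 1 <= size (split_poly (undup rs)) + size (wronskian f g))%N.
  by rewrite -size_mulD1 // leq_add2r dvdp_leq // mulf_neq0.
have szu : size (split_poly (undup rs)) = (size (undup rs)).+1 by exact: size_prod_XsubC.
have sw := size_wronskian gf.
by move: sw sf le szP szu; lia.
Qed.

End Wronskian.

Section PthRoot.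
Variables (F : finFieldType) (p : nat).
Hypothesis pF : p \in [pchar F].
Implicit Types f g : {poly F}.

Let p_pr : prime p := pcharf_prime pF.

Lemma pnat_pcharX j : [pchar F].-nat (p ^ j)%N.
Proof. by rewrite pnatX pnatE // pF. Qed.

Lemma frob_inj j : injective (fun x : F => x ^+ (p ^ j)).
Proof.
move=> x y /= e; have p0 := prime_gt0 p_pr.
have := exprDn_pchar (x - y) y (pnat_pcharX j); rewrite subrK e => /eqP.
rewrite -subr_eq subrr eq_sym expf_eq0 expn_gt0 p0 /= subr_eq0.
by move/eqP.
Qed.

Lemma frob_surj j (x : F) : exists y, y ^+ (p ^ j) = x.
Proof. by exists (invF (@frob_inj j) x); rewrite (f_invF (@frob_inj j)). Qed.

Lemma deriv0_pth_power f : f^`() = 0 -> exists g, f = g ^+ p.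
Proof.
move=> f'0; have p0 := prime_gt0 p_pr.
have [rt rtK] : exists rt : F -> F, forall x, rt x ^+ p = x.
  by exists (invF (@frob_inj 1)) => x; exact: (f_invF (@frob_inj 1) x).
have rt0 : rt 0 = 0.
  by apply/eqP; have /eqP := rtK 0; rewrite expf_eq0 p0.
exists (\poly_(i < size f) rt f`_(p * i)); apply/polyP=> i.
rewrite (coef_exp_frob (pnat_pcharX 1)) expn1.
case: ifP => [/dvdnP [k ->]|pi].
  rewrite mulnK // coef_poly; case: ltnP => [_|kf].
    by rewrite rtK mulnC.
  rewrite expr0n gtn_eqF // [LHS]coef_geq //.
  by apply: leq_trans kf _; rewrite -[k in (k <= _)%N]muln1 leq_mul.
case: i pi => [|i] pi; first by rewrite dvdn0 in pi.
have := coef_deriv f i; rewrite f'0 coef0 -mulr_natr => /esym/eqP.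
by rewrite mulf_eq0 -(dvdn_pcharf pF) pi orbF => /eqP.
Qed.

(** If [f g' = f' g] with [f] and [g] coprime, then [f] divides [f'] and [g] divides [g']; so both
    derivatives vanish and both polynomials are [p]-th powers. Taking roots lowers the degrees. *)
Lemma coprime_frob_reduce f g : coprimep f g -> (1 < maxn (size f) (size g))%N ->
  exists j f3 g3, [/\ f = f3 ^+ (p ^ j), g = g3 ^+ (p ^ j), coprimep f3 g3 &
                     wronskian f3 g3 != 0].
Proof.
have [n] := ubnP (maxn (size f) (size g)); elim: n f g => // n IH f g sn cfg s1.
have [W0|W0] := eqVneq (wronskian f g) 0; last by exists 0, f, g; rewrite expn0 !expr1.
have fg : f * g^`() = f^`() * g by apply/eqP; rewrite -subr_eq0; apply/eqP.
have small (h k : {poly F}) : h %| h^`() * k -> coprimep h k -> h^`() = 0.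
  move=> hk chk; have : h %| h^`() by rewrite -(Gauss_dvdpl _ chk).
  apply: contraTeq => h'0; have [h0|h0] := eqVneq h 0; first by rewrite h0 deriv0 eqxx in h'0.
  by apply: contraL (lt_size_deriv h0) => /(dvdp_leq h'0); rewrite -leqNgt.
have f'0 : f^`() = 0 by apply: (small f g) => //; rewrite -fg dvdp_mulr.
have g'0 : g^`() = 0.
  by apply: (small g f); [rewrite mulrC fg dvdp_mull | rewrite coprimep_sym].
have [f1 fE] := deriv0_pth_power f'0; have [g1 gE] := deriv0_pth_power g'0.
have p0 := prime_gt0 p_pr; have p1 := prime_gt1 p_pr.
have c1 : coprimep f1 g1 by move: cfg; rewrite fE gE coprimep_pexpl // coprimep_pexpr.
have szE (h : {poly F}) : ((size (h ^+ p)%R).-1 = (size h).-1 * p)%N by rewrite size_exp.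
have szf : ((size f).-1 = (size f1).-1 * p)%N by rewrite fE szE.
have szg : ((size g).-1 = (size g1).-1 * p)%N by rewrite gE szE.
have [j [f3 [g3 [f1E g1E c3 W3]]]] : exists j f3 g3,
    [/\ f1 = f3 ^+ (p ^ j), g1 = g3 ^+ (p ^ j), coprimep f3 g3 & wronskian f3 g3 != 0].
  by apply: IH => //; move: sn s1 szf szg p1; rewrite !/maxn; do !case: ifP; nia.
exists j.+1, f3, g3; split=> //.
  by rewrite fE f1E -exprM expnSr.
by rewrite gE g1E -exprM expnSr.
Qed.

(* A common power of the Frobenius map is extracted from the coprime parts of
   [f] and [g], until their Wronskian no longer vanishes. *)
Lemma split_decomposition m f g rs :
  split_poly rs = 'X^(p ^ m) * f + g -> f != 0 -> (size g <= size f)%N ->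
  (size f <= p ^ m)%N -> (forall x, (count_mem x rs < p ^ m)%N) ->
  exists j c f3 g3,
    [/\ (j < m)%N, f = c * f3 ^+ (p ^ j), g = c * g3 ^+ (p ^ j),
        coprimep f3 g3 & wronskian f3 g3 != 0].
Proof.
move=> PE f0 gf fm rsm; set c := gcdp f g.
have p0 := prime_gt0 p_pr; have p1 := prime_gt1 p_pr.
have c0 : c != 0 by rewrite gcdp_eq0 (negPf f0).
have [f1 fE] : exists f1, f = c * f1.
  by have /dvdpP [f1 ->] := dvdp_gcdl f g; exists f1; rewrite mulrC.
have [g1 gE] : exists g1, g = c * g1.
  by have /dvdpP [g1 ->] := dvdp_gcdr f g; exists g1; rewrite mulrC.
have cop : coprimep f1 g1.
  have := coprimep_div_gcd (_ : (f != 0) || (g != 0)); rewrite f0 => /(_ isT).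
  have -> : f %/ gcdp f g = f1 by rewrite -/c fE mulrC mulpK.
  by have -> : g %/ gcdp f g = g1 by rewrite -/c gE mulrC mulpK.
have f10 : f1 != 0 by apply: contraNneq f0 => e; rewrite fE e mulr0.
have [szc|big] := leqP (maxn (size f1) (size g1)) 1.
  (* With constant cofactors the polynomial is a multiple of the [p^m]-th power of a linear one, a
     root of excluded multiplicity. *)
  exfalso; have sf1 : (size f1 <= 1)%N by rewrite (leq_trans (leq_maxl _ _) szc).
  have sg1 : (size g1 <= 1)%N by rewrite (leq_trans (leq_maxr _ _) szc).
  have [a aE] : exists a : F, f1 = a%:P by exists f1`_0; rewrite -size1_polyC.
  have [b bE] : exists b : F, g1 = b%:P by exists g1`_0; rewrite -size1_polyC.
  have a0 : a != 0 by apply: contraNneq f10; rewrite aE => ->; rewrite polyC0.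
  have [y yE] := frob_surj m (b / a).
  have PE2 : split_poly rs = (a *: c) * ('X - (- y)%:P) ^+ (p ^ m).
    rewrite PE fE gE aE bE polyCN opprK (exprDn_pchar _ _ (pnat_pchar_poly (pnat_pcharX m))).
    rewrite -rmorphXn /= yE -!mul_polyC mulrDr; congr (_ + _).
      by rewrite [LHS]mulrC [c * _]mulrC -!mulrA.
    by rewrite mulrAC -polyCM mulrCA divff // mulr1 mulrC.
  have := rsm (- y); rewrite ltnNge => /negP; apply.
  rewrite -mu_prod_XsubC mup_geq; last by apply: monic_neq0; exact: monic_prod_XsubC.
  by rewrite -/(split_poly rs) PE2 dvdp_mull.
have sc0 : (0 < size c)%N by rewrite size_poly_gt0.
have szf : (size f + 1 = size c + size f1)%N by rewrite fE size_mulD1.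
have gf1 : (size g1 <= size f1)%N.
  have [->|g10] := eqVneq g1 0; first by rewrite size_poly0.
  have : (size g + 1 = size c + size g1)%N by rewrite gE size_mulD1.
  by move: gf szf; lia.
have [j [f3 [g3 [f1E g1E c3 W3]]]] := coprime_frob_reduce cop big.
exists j, c, f3, g3; split=> //; [|by rewrite fE f1E|by rewrite gE g1E].
have sE : ((size f1).-1 = (size f3).-1 * p ^ j)%N by rewrite f1E size_exp.
rewrite -(ltn_exp2l _ _ p1); apply: leq_trans fm.
have b2 : (2 <= size f1)%N by move: big gf1; rewrite /maxn; case: ifP; lia.
have : (1 * p ^ j <= (size f3).-1 * p ^ j)%N.
  by rewrite leq_mul2r; apply/orP; right; move: sE b2; case: (size f3).-1 => //; lia.
by rewrite -sE; move: szf b2 sc0; lia.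
Qed.
End PthRoot.

(** * Points, lines and hyperplanes *)

Section Annihilators.
Variables (F : finFieldType) (h : nat).
Local Notation q := #|F|.

Definition ann m (U : 'M[F]_(m, h)) : {set 'cV[F]_h} := [set a | U *m a == 0].

Lemma card_ann m (U : 'M[F]_(m, h)) : #|ann U| = (q ^ (h - \rank U))%N.
Proof.
rewrite -(mxrank_tr U) -mxrank_ker -card_rowg.
rewrite -(card_imset _ (@trmx_inj F h 1)); apply: eq_card => a.
apply/imsetP/idP => [[b]|].
  rewrite !inE => /eqP e ->; apply/sub_kermxP.
  by rewrite -trmx_mul e trmx0.
rewrite inE => /sub_kermxP e; exists a^T; last by rewrite trmxK.
by rewrite inE -[U]trmxK -trmx_mul e trmx0.
Qed.

Lemma mem_ann m (U : 'M[F]_(m, h)) a : (a \in ann U) = (U *m a == 0).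
Proof. by rewrite inE. Qed.

Lemma mem_ann0 m (U : 'M[F]_(m, h)) : 0 \in ann U.
Proof. by rewrite inE mulmx0. Qed.

Lemma annS m1 m2 (U : 'M[F]_(m1, h)) (W : 'M[F]_(m2, h)) (a : 'cV[F]_h) :
  (U <= W)%MS -> W *m a = 0 -> U *m a = 0.
Proof. by move=> /submxP [D ->] e; rewrite -mulmxA e mulmx0. Qed.

Lemma ann_adds m1 m2 (U : 'M[F]_(m1, h)) (W : 'M[F]_(m2, h)) (a : 'cV[F]_h) :
  ((U + W)%MS *m a == 0) = (U *m a == 0) && (W *m a == 0).
Proof.
apply/eqP/andP => [e|[/eqP eU /eqP eW]].
  by split; apply/eqP; apply: annS e; rewrite ?addsmxSl ?addsmxSr.
have: ((U + W)%MS <= col_mx U W)%MS by rewrite addsmxE.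
by move=> hs; apply: annS hs _; rewrite mul_col_mx eU eW col_mx0.
Qed.

Lemma rank_adds1 m (U : 'M[F]_(m, h)) (x : 'rV[F]_h) :
  ~~ (x <= U)%MS -> \rank (U + x)%MS = (\rank U).+1.
Proof.
move=> xU; have := mxrank_sum_cap U x.
have x0 : x != 0 by apply: contraNneq xU => ->; rewrite sub0mx.
rewrite rank_rV x0; suff -> : \rank (U :&: x)%MS = 0%N by lia.
have := mxrankS (capmxSr U x); rewrite rank_rV x0.
case E: (\rank _) => [|[|r]] // _; case/negP: xU.
have := mxrank_leqif_sup (capmxSr U x); rewrite E rank_rV x0 => -[_].
by move=> /esym; rewrite eqxx => /submx_trans; apply; rewrite capmxSl.
Qed.

Lemma rank_eq_sub m1 m2 (U : 'M[F]_(m1, h)) (W : 'M[F]_(m2, h)) :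
  (U <= W)%MS -> (\rank W <= \rank U)%N -> (W <= U)%MS.
Proof. by move=> UW r; have [_ <-] := mxrank_leqif_sup UW; rewrite eqn_leq mxrankS. Qed.

End Annihilators.

Section PointSets.
Variables (F : finFieldType) (h : nat) (I : finType) (v : I -> 'rV[F]_h).
Local Notation q := #|F|.
Local Notation b := #|I|.

Definition zeros (a : 'cV[F]_h) : {set I} := [set i | v i *m a == 0].
Local Notation zr := zeros.
Definition pts m (U : 'M[F]_(m, h)) : {set I} := [set i | (v i <= U)%MS].
Definition line_pts i j : {set I} := pts (v i + v j)%MS.
Local Notation L := line_pts.

Lemma pts_sub_zr m (U : 'M[F]_(m, h)) a : a \in ann U -> pts U \subset zr a.
Proof.
by rewrite mem_ann => /eqP e; apply/subsetP => i; rewrite !inE => /annS ->.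
Qed.

Lemma ptsS m1 m2 (U : 'M[F]_(m1, h)) (W : 'M[F]_(m2, h)) :
  (U <= W)%MS -> pts U \subset pts W.
Proof. by move=> UW; apply/subsetP => i; rewrite !inE => /submx_trans; apply. Qed.

(** Double count of the pairs of a nonzero functional vanishing on [U] and a point off [U] at which
    it vanishes. *)
Lemma sum_extras m (U : 'M[F]_(m, h)) :
  (\sum_(a in ann U :\ 0%R) #|zr a :\: pts U| =
    (b - #|pts U|) * (q ^ (h - (\rank U).+1) - 1))%N.
Proof.
pose E a i := (i \in zr a :\: pts U : nat).
rewrite (eq_bigr (fun a => \sum_i E a i)%N); last first.
  by move=> a _; rewrite -sum1_card big_mkcond /=; apply: eq_bigr => i _; rewrite /E; case: (_ \in _).
rewrite exchange_big /= (bigID (fun i => i \in pts U)) /= big1 ?add0n; last first.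
  by move=> i iU; rewrite big1 // => a _; rewrite /E inE iU.
rewrite (eq_bigr (fun=> q ^ (h - (\rank U).+1) - 1)%N); last first.
  move=> i iU; rewrite -(rank_adds1 (x := v i)); last by rewrite inE in iU.
  rewrite -card_ann (cardsD1 0 (ann _)) mem_ann0 /= add1n subn1 /=.
  rewrite -sum1_card big_mkcond [RHS]big_mkcond; apply: eq_bigr => a _.
  rewrite !inE /E ann_adds !inE; rewrite inE in iU; rewrite iU /=.
  by case: eqP; case: eqP; case: eqP.
have -> : (b - #|pts U| = #|~: pts U|)%N by rewrite [RHS]cardsCs setCK.
by rewrite sum_nat_const; congr (_ * _)%N; apply: eq_card => i; rewrite [RHS]inE.
Qed.

Lemma exists_few_extras m (U : 'M[F]_(m, h)) t :
  ((b - #|pts U|) * (q ^ (h - (\rank U).+1) - 1) < t * (q ^ (h - \rank U) - 1))%N ->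
  exists a, [/\ a != 0, a \in ann U & (#|zr a :\: pts U| < t)%N].
Proof.
move=> hlt; case: (boolP [exists a in ann U :\ 0, (#|zr a :\: pts U| < t)%N]).
  by case/exists_inP => a; rewrite in_setD1 => /andP [a0 aU] lt; exists a.
rewrite negb_exists_in => /forall_inP hall.
move: hlt; rewrite -sum_extras ltnNge => /negP [].
have -> : (q ^ (h - \rank U) - 1 = #|ann U :\ 0%R|)%N.
  by rewrite -card_ann (cardsD1 0 (ann _)) mem_ann0 add1n subn1.
rewrite mulnC -sum_nat_const; apply: leq_sum => a aU.
by have := hall a aU; rewrite -leqNgt.
Qed.

Hypothesis v0 : forall i, v i != 0.
Hypothesis v_inj : forall i j, (v i <= v j)%MS -> i = j.

Lemma rank_v i : \rank (v i) = 1%N.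
Proof. by rewrite rank_rV v0. Qed.

Lemma rank_line i j : i != j -> \rank (v i + v j)%MS = 2%N.
Proof.
move=> ij; rewrite rank_adds1 ?rank_v //; apply: contraNN ij => /v_inj ->.
by rewrite eqxx.
Qed.

Lemma line_pts_l i j : i \in L i j. Proof. by rewrite inE addsmxSl. Qed.
Lemma line_pts_r i j : j \in L i j. Proof. by rewrite inE addsmxSr. Qed.
Lemma line_ptsC i j : L i j = L j i.
Proof. by apply/setP => k; rewrite !inE addsmxC. Qed.

Lemma line_sub i j k l : k \in L i j -> l \in L i j -> k != l ->
  (v i + v j <= v k + v l)%MS.
Proof.
rewrite !inE => hk hl kl; apply: rank_eq_sub; first by rewrite addsmx_sub hk.
by rewrite (rank_line kl); have := (mxrank_adds_leqif (v i) (v j)).1; rewrite !rank_v.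
Qed.

Lemma line_pts_eq i j k l : i != j -> k \in L i j -> l \in L i j -> k != l -> L k l = L i j.
Proof.
move=> ij hk hl kl; apply/eqP; rewrite eqEsubset !ptsS //; last first.
  by move: hk hl; rewrite !inE addsmx_sub => -> ->.
exact: line_sub.
Qed.

Definition closed_set (S : {set I}) :=
  forall i j, i \in S -> j \in S -> i != j -> L i j \subset S.

Lemma closed_pts m (U : 'M[F]_(m, h)) : closed_set (pts U).
Proof.
by move=> i j; rewrite !inE => iU jU _; apply: ptsS; rewrite addsmx_sub iU jU.
Qed.

Lemma closed_setT : closed_set setT.
Proof. by move=> i j _ _ _; exact: subsetT. Qed.

(** The point [i] is taken out of the lines through it, which makes them disjoint. *)
Definition pencil i (S : {set I}) : {set {set I}} := [set L i j :\ i | j in S :\ i].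

Lemma pencil_partition i (S : {set I}) : i \in S -> closed_set S -> partition (pencil i S) (S :\ i).
Proof.
move=> iS cS; have mem_self j : j \in S :\ i -> j \in L i j :\ i.
  by rewrite !inE => /andP[-> _]; rewrite addsmxSr.
have eqL j k : j \in S :\ i -> k \in L i j :\ i -> L i k :\ i = L i j :\ i.
  rewrite !in_setD1 => /andP[ji _] /andP[ki kL].
  by rewrite (@line_pts_eq i j i k) ?line_pts_l // eq_sym.
apply/and3P; split.
- rewrite /cover; apply/eqP/setP => k; apply/bigcupP/idP => [[A /imsetP[j jS ->]]|kS].
    move: jS; rewrite !in_setD1 => /andP[ji jS] /andP[-> kL] /=.
    by apply: (subsetP (cS i j iS jS _)) => //; rewrite eq_sym.
  by exists (L i k :\ i); [apply: imset_f | apply: mem_self].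
- apply/trivIsetP => A B /imsetP[j jS ->] /imsetP[k kS ->].
  apply: contraR => /pred0Pn [l /andP[/= lj lk]].
  by rewrite -(eqL _ _ jS lj) -(eqL _ _ kS lk).
- by apply/negP => /imsetP[j jS e]; have := mem_self j jS; rewrite -e inE.
Qed.

Lemma card_pencil i (S : {set I}) : i \in S -> closed_set S ->
  #|S| = (\sum_(A in pencil i S) #|A|).+1.
Proof.
move=> iS cS; rewrite (cardsD1 i) iS add1n; congr _.+1.
exact: card_partition (pencil_partition iS cS).
Qed.

End PointSets.

(* The columns are the functionals on [F^h]: their kernels are the hyperplanes of
   the span of [B]. *)
Record config (F : finFieldType) (I : finType) (h p s : nat)
    (v : I -> 'rV[F]_h) : Prop := Config {
  cf_p : p \in [pchar F];
  cf_s : exists2 e, (0 < e)%N & s = (p ^ e)%N;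
  cf_s7 : (7 <= s)%N;
  cf_h : (3 <= h)%N;
  cf_q : #|F| = (s ^ h)%N;
  cf_v0 : forall i, v i != 0;
  cf_inj : forall i j, (v i <= v j)%MS -> i = j;
  cf_span : forall a : 'cV[F]_h, a != 0 -> exists i, v i *m a != 0;
  cf_one : forall a : 'cV[F]_h, a != 0 -> #|zeros v a| = 1 %[mod s];
  cf_small : (2 * #|I| < 3 * (#|F| + 1))%N
}.

Section Config.
Variables (F : finFieldType) (I : finType) (h p s : nat) (v : I -> 'rV[F]_h).
Hypothesis C : config p s v.
Local Notation q := #|F|.
Local Notation b := #|I|.
Local Notation L := (line_pts v).
Local Notation pts := (pts v).
Local Notation zr := (zeros v).
Local Notation closed_set := (closed_set v).

Let s7 := cf_s7 C.
Let h3 := cf_h C.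
Let v0 := cf_v0 C.
Let v_inj := cf_inj C.

Lemma card_field_eq : q = (s ^ (h - 3) * s ^ 3)%N.
Proof. by rewrite (cf_q C) -expnD subnK. Qed.

Lemma s_lt_q : (s * s * s <= q)%N.
Proof.
rewrite card_field_eq !expnS expn0 muln1 !mulnA -[X in (X <= _)%N]mul1n -!mulnA.
by rewrite leq_mul2r; apply/orP; right; rewrite expn_gt0; move: s7; lia.
Qed.

Lemma card_points_small : (2 * b <= 3 * q + 2)%N.
Proof. by have := cf_small C; lia. Qed.

Lemma rank_lt_neq0 m (U : 'M[F]_(m, h)) : (\rank U < h)%N -> exists2 k, k \notin pts U & true.
Proof.
move=> r; have: (1 < #|ann U|)%N.
  rewrite card_ann -[1%N](expn0 q) ltn_exp2l ?subn_gt0 //.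
  by have := s_lt_q; move: s7; nia.
rewrite (cardsD1 0 (ann U)) mem_ann0 add1n ltnS card_gt0 => /set0Pn [a].
rewrite in_setD1 => /andP [a0 aU]; have [i ia] := cf_span C a0.
exists i => //; apply: contra ia => iU.
by have /subsetP/(_ i iU) := pts_sub_zr v aU; rewrite inE.
Qed.

Lemma cl_pts m (U : 'M[F]_(m, h)) : closed_set (pts U).
Proof. exact: closed_pts. Qed.

Lemma mod1_sub x y : x = 1 %[mod s] -> y = 1 %[mod s] -> (y <= x)%N -> (s %| x - y)%N.
Proof. by move=> hx hy yx; rewrite -eqn_mod_dvd // hx hy. Qed.

Lemma mod1P x : x = 1 %[mod s] -> x = (1 + s * ((x - 1) %/ s))%N.
Proof.
move=> hx; have x0 : (0 < x)%N by case: x hx => // /eqP; rewrite mod0n modn_small //; move: s7; lia.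
have := mod1_sub hx (erefl _) x0 => /dvdnP [k e].
by rewrite e mulnK; move: s7 e x0; lia.
Qed.

(** As [b] is below [2 q], a hyperplane through the line has on average fewer than two further
    points; take one with at most one. *)
Lemma line_size_dichotomy i j : i != j ->
  #|L i j| = 1 %[mod s] \/
  exists a k, [/\ k \notin L i j, zr a = k |: L i j & (#|L i j|.+1 = 1 %[mod s])].
Proof.
move=> ij; pose U := (v i + v j)%MS; have rU : \rank U = 2%N by rewrite rank_line.
have n2 : (2 <= #|L i j|)%N.
  by have <- : #|[set i; j]| = 2%N by [rewrite cards2 ij]; apply: subset_leq_card;
    rewrite subUset !sub1set line_pts_l line_pts_r.
have [a [a0 aU ext]] : exists a, [/\ a != 0, a \in ann U & (#|zr a :\: pts U| < 2)%N].
  apply: exists_few_extras; rewrite rU.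
  have -> : (h - 2 = (h - 3).+1)%N by move: h3; lia.
  rewrite expnS; set A := (q ^ (h - 3))%N.
  have A0 : (0 < A)%N by rewrite expn_gt0; have := s_lt_q; move: s7; nia.
  have b2 : (b - #|pts U| <= 2 * q - 2)%N.
    by have := card_points_small; have := s_lt_q; move: n2 s7; rewrite /U; nia.
  have q2 : (2 <= q)%N by have := s_lt_q; move: s7; nia.
  apply: leq_ltn_trans (leq_mul b2 (leqnn _)) _; move: A0 q2; case: A => // A _; nia.
have zU := pts_sub_zr v aU.
have zE : #|zr a| = (#|L i j| + #|zr a :\: pts U|)%N.
  by rewrite -(cardsID (pts U) (zr a)) (setIidPr zU).
have := cf_one C a0; rewrite zE.
case E: #|_ :\: _| ext => [|[|n]] // _; first by rewrite addn0; left.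
rewrite addn1 => one; right; have /eqP/cards1P [k kE] := E; exists a, k.
have : k \in zr a :\: pts U by rewrite kE set11.
rewrite in_setD => /andP [kU _]; split=> //.
have -> : L i j = pts U by [].
apply/setP => l; rewrite in_setU1 -(in_set1 l k) -kE in_setD.
by have := subsetP zU l; case: (l \in pts U) => /= [->//|_]; rewrite orbF.
Qed.

(** Otherwise a hyperplane meets [B] in the line and one further point [k]. Then the line through
    [k] and [i] has exactly 2 points, but neither 2 nor 3 is [1] modulo [s >= 7]. *)
Lemma line_1mod i j : i != j -> #|L i j| = 1 %[mod s].
Proof.
move=> ij; case: (line_size_dichotomy ij) => // -[a [k [kU zE _]]]; exfalso.
have ki : k != i by apply: contraNneq kU => ->; exact: line_pts_l.
have Lki : L k i = [set k; i].
  have iz : i \in zr a by rewrite zE !inE -/(pts _) addsmxSl orbT.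
  have kz : k \in zr a by rewrite zE setU11.
  have aM : a \in ann (v k + v i)%MS by move: iz kz; rewrite mem_ann ann_adds !inE => -> ->.
  apply/eqP; rewrite eqEsubset; apply/andP; split; last by rewrite subUset !sub1set line_pts_l line_pts_r.
  apply/subsetP => l lL; have := subsetP (pts_sub_zr v aM) l lL; rewrite zE in_setU1 !inE.
  case/orP => [->//|lU]; apply/orP; right; apply: contraNT kU => li.
  have lU' : l \in L i j by rewrite inE.
  have := line_pts_eq v0 v_inj ki lL (line_pts_r _ _ _) li => Lli.
  rewrite -(line_pts_eq v0 v_inj ij lU' (line_pts_l _ _ _) li) Lli; exact: line_pts_l.
case: (line_size_dichotomy ki) => [|[_ [_ [_ _]]]]; rewrite Lki cards2 ki;
  rewrite !modn_small; by move: s7; lia.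
Qed.

Definition line_weight i j := ((#|L i j| - 1) %/ s)%N.
Local Notation w := line_weight.

Lemma card_line i j : i != j -> #|L i j| = (1 + s * w i j)%N.
Proof. by move=> ij; apply: mod1P; apply: line_1mod. Qed.

Lemma line_weight_gt0 i j : i != j -> (0 < w i j)%N.
Proof.
move=> ij; have := card_line ij; have : (1 < #|L i j|)%N.
  by have <- : #|[set i; j]| = 2%N by [rewrite cards2 ij]; apply: subset_leq_card;
    rewrite subUset !sub1set line_pts_l line_pts_r.
by case: (w i j) => // + e; rewrite e muln0.
Qed.

Lemma line_weightC i j : w i j = w j i. Proof. by rewrite /line_weight line_ptsC. Qed.

Lemma card_pencil_block i (S : {set I}) (A : {set I}) : A \in pencil v i S -> (s %| #|A|)%N /\ (s <= #|A|)%N.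
Proof.
case/imsetP => j; rewrite in_setD1 => /andP [ji _] ->.
have ij : i != j by rewrite eq_sym.
have -> : #|L i j :\ i| = (s * w i j)%N.
  by have := cardsD1 i (L i j); rewrite line_pts_l card_line //; lia.
by rewrite dvdn_mulr // leq_pmulr // line_weight_gt0.
Qed.

Lemma closed_1mod (S : {set I}) i : i \in S -> closed_set S -> #|S| = 1 %[mod s].
Proof.
move=> iS cS; rewrite (card_pencil v0 v_inj iS cS) -addn1 -modnDml.
suff /eqP -> : (s %| \sum_(A in pencil v i S) #|A|)%N by [].
by apply: dvdn_sum => A /card_pencil_block [].
Qed.

(** Averaging gives a hyperplane through [U] with fewer than [s] points off [U]. Both sizes are [1]
    modulo [s], so there are none. *)
Lemma exists_exact m (U : 'M[F]_(m, h)) i : i \in pts U -> (\rank U < h)%N ->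
  exists a, [/\ a != 0, a \in ann U & zr a = pts U].
Proof.
move=> iU rU; have [a [a0 aU ext]] :
    exists a, [/\ a != 0, a \in ann U & (#|zr a :\: pts U| < s)%N].
  apply: exists_few_extras.
  have -> : (h - \rank U = (h - (\rank U).+1).+1)%N by lia.
  rewrite expnS; set A := (q ^ _)%N.
  have q2 : (2 <= q)%N by have := s_lt_q; move: s7; nia.
  have A0 : (0 < A)%N by rewrite expn_gt0; lia.
  have b2 : (b - #|pts U| <= 2 * q)%N by have := card_points_small; lia.
  apply: leq_ltn_trans (leq_mul b2 (leqnn _)) _; move: A0 q2 s7; case: A => // A _; nia.
have zU := pts_sub_zr v aU; exists a; split=> //.
apply/eqP; rewrite eqEsubset zU andbT -setD_eq0 -cards_eq0.
have zE : #|zr a| = (#|pts U| + #|zr a :\: pts U|)%N.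
  by rewrite -(cardsID (pts U) (zr a)) (setIidPr zU).
have dv : (s %| #|zr a| - #|pts U|)%N.
  apply: mod1_sub; [exact: cf_one C _ a0 | | by rewrite subset_leq_card].
  exact: closed_1mod iU (@cl_pts _ U).
move: dv; rewrite zE addKn => /dvdnP [k kE]; rewrite kE in ext *.
by case: k ext {kE} => // k; rewrite mulSn; lia.
Qed.

(** The lines joining [k] to the points of [S] are distinct, because [S] is closed and misses [k].
    Each has at least [s] points besides [k], all of them in [T]. *)
Lemma growth (S T : {set I}) k : closed_set S -> closed_set T -> S \subset T -> k \in T ->
  k \notin S -> (1 + s * #|S| <= #|T|)%N.
Proof.
move=> cS cT ST kT kS; rewrite (card_pencil v0 v_inj kT cT) add1n ltnS.
pose f i := L k i :\ k.
have finj : {in S &, injective f}.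
  move=> i j iS jS e; apply/eqP; apply: contraNT (kS) => ij.
  have ik : i != k by apply: contraNneq kS => <-.
  have iL : i \in L k j.
    have : i \in f i by rewrite in_setD1 ik line_pts_r.
    by rewrite e in_setD1 => /andP[].
  have kj : k != j by apply: contraNneq kS => ->.
  have := subsetP (cS _ _ iS jS ij) k; apply.
  by rewrite (line_pts_eq v0 v_inj kj iL (line_pts_r _ _ _) ij) line_pts_l.
apply: leq_trans (_ : \sum_(A in [set f i | i in S]) s <= _)%N.
  by rewrite sum_nat_const card_in_imset // mulnC.
have sub : [set f i | i in S] \subset pencil v k T.
  apply/subsetP => A /imsetP [i iS ->]; apply: imset_f.
  by rewrite in_setD1 (subsetP ST) // andbT; apply: contraNneq kS => <-.
rewrite [X in (_ <= X)%N](bigID (mem [set f i | i in S])) /=.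
apply: leq_trans (leq_addr _ _).
rewrite [X in (_ <= X)%N](eq_bigl (mem [set f i | i in S])); last first.
  by move=> A /=; apply: andb_idl => /(subsetP sub).
by apply: leq_sum => A /(subsetP sub) /card_pencil_block [].
Qed.

Lemma card_pts_small m (U : 'M[F]_(m, h)) : (\rank U < h)%N ->
  (1 + s * #|pts U| <= b)%N.
Proof.
move=> rU; have [k kU _] := rank_lt_neq0 rU.
have := growth (@cl_pts _ U) (@closed_setT _ _ _ v) (subsetT _) (in_setT k) kU.
by rewrite cardsT.
Qed.

Lemma card_pts_lt_q m (U : 'M[F]_(m, h)) : (\rank U < h)%N -> (#|pts U| < q)%N.
Proof. by move/card_pts_small; have := card_points_small; have := s_lt_q; move: s7; nia. Qed.

Lemma sum_card_zr : (\sum_a #|zr a| = b * q ^ (h - 1))%N.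
Proof.
rewrite (eq_bigr (fun a => \sum_i (v i *m a == 0)%R)%N); last first.
  by move=> a _; rewrite -sum1_card big_mkcond /=; apply: eq_bigr => i _; rewrite inE; case: eqP.
rewrite exchange_big /= (eq_bigr (fun=> q ^ (h - 1))%N) ?sum_nat_const // => i _.
have := card_ann (v i); rewrite (rank_v v0) => <-.
rewrite -sum1_card [RHS]big_mkcond /=; apply: eq_bigr => a _.
by rewrite inE; case: eqP.
Qed.

Lemma sum_card_zr2 :
  (\sum_a #|zr a| ^ 2 = b * q ^ (h - 1) + b * (b - 1) * q ^ (h - 2))%N.
Proof.
rewrite (eq_bigr (fun a => \sum_i \sum_j ((v i *m a == 0) && (v j *m a == 0))%R)%N); last first.
  move=> a _; have E : #|zr a| = (\sum_i (v i *m a == 0)%R)%N.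
    by rewrite -sum1_card big_mkcond /=; apply: eq_bigr => i _; rewrite inE; case: eqP.
  rewrite expnS expn1 {1}E big_distrl /=; apply: eq_bigr => i _; rewrite E big_distrr /=.
  by apply: eq_bigr => j _; case: eqP; case: eqP.
rewrite exchange_big /= (eq_bigr (fun=> q ^ (h - 1) + (b - 1) * q ^ (h - 2)))%N.
  by rewrite sum_nat_const mulnDr mulnA.
move=> i _; rewrite exchange_big /= (bigD1 i) //=; congr (_ + _)%N.
  have := card_ann (v i); rewrite (rank_v v0) => <-.
  rewrite -sum1_card [RHS]big_mkcond /=; apply: eq_bigr => a _.
  by rewrite inE andbb; case: eqP.
rewrite (eq_bigr (fun=> q ^ (h - 2)))%N; last first.
  move=> j ji; have ij : i != j by rewrite eq_sym.
  have := card_ann (v i + v j)%MS; rewrite (rank_line v0 v_inj ij) => <-.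
  rewrite -sum1_card [RHS]big_mkcond /=.
  by apply: eq_bigr => a _; rewrite mem_ann ann_adds; case: andP.
rewrite sum_nat_const; congr (_ * _)%N.
by rewrite subn1 -(cardC1 i); apply: eq_card.
Qed.

Lemma q_gt1 : (1 < q)%N.
Proof. by have := s_lt_q; move: s7; nia. Qed.

Lemma zr0 : zr 0 = setT.
Proof. by apply/setP => i; rewrite !inE mulmx0 eqxx. Qed.

Lemma card_cV : #|{: 'cV[F]_h}| = (q ^ h)%N.
Proof. by rewrite card_mx muln1. Qed.

Lemma zr_gt0 a : a != 0 -> (0 < #|zr a|)%N.
Proof. by move=> a0; rewrite (mod1P (cf_one C a0)). Qed.

Lemma sum_neq0_const c : (\sum_(a : 'cV[F]_h | a != 0%R) c = (q ^ h - 1) * c)%N.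
Proof.
by rewrite sum_nat_const -card_cV subn1 -(cardC1 (0%R : 'cV[F]_h)); congr (_ * _)%N; apply: eq_card.
Qed.

Lemma q_pow_split : exists A, [/\ (0 < A)%N, (q ^ (h - 2) = A)%N,
  (q ^ (h - 1) = q * A)%N & (q ^ h = q * (q * A))%N].
Proof.
exists (q ^ (h - 2))%N; rewrite -!expnS expn_gt0; split=> //; first by have := q_gt1; lia.
  by congr (_ ^ _)%N; move: h3; lia.
by congr (_ ^ _)%N; move: h3; lia.
Qed.

Lemma card_points_lb : (q + 1 <= b)%N.
Proof.
have := sum_card_zr; rewrite (bigD1 0%R) //= zr0 cardsT => e.
have : (\sum_(a : 'cV[F]_h | a != 0%R) 1 <= \sum_(a : 'cV[F]_h | a != 0%R) #|zr a|)%N.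
  by apply: leq_sum => a a0; apply: zr_gt0.
rewrite sum_neq0_const muln1; move: e; have [A [A0 _ -> ->]] := q_pow_split.
exact: arith_b_lb q_gt1 A0.
Qed.

Definition excess := ((b - q - 1) %/ s)%N.
Local Notation d := excess.

Lemma s_dvd_q : (s %| q)%N.
Proof. by rewrite (cf_q C) dvdn_exp //; move: h3; lia. Qed.

Lemma b_1mod : b = 1 %[mod s].
Proof.
have [i _] : exists i : I, true.
  by have := card_points_lb; rewrite addn1 => /(leq_ltn_trans (leq0n _)) /card_gt0P [i _]; exists i.
by rewrite -cardsT; apply: (@closed_1mod _ i) => //; exact: closed_setT.
Qed.

Lemma card_points_eq : b = (q + 1 + s * d)%N.
Proof.
have le := card_points_lb; have dv : (s %| b - q - 1)%N.
  rewrite -subnDA addnC subnDA; apply: dvdn_sub; last exact: s_dvd_q.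
  by apply: mod1_sub; [exact: b_1mod | | move: le; lia].
by rewrite /excess mulnC divnK // ; move: le; lia.
Qed.

Lemma quadratic_bound : ((s + 1) * b * q + b <= b * b + (s + 1) * q * q)%N.
Proof.
have := sum_card_zr; rewrite (bigD1 0%R) //= => e1.
have := sum_card_zr2; rewrite (bigD1 0%R) //= => e2; move: e1 e2; rewrite zr0 cardsT.
set S2 := (\sum_(a | _) _ ^ 2)%N; set S1 := (\sum_(a | _) #|zr a|)%N => e1 e2.
have : ((s + 2) * S1 <= S2 + (q ^ h - 1) * (s + 1))%N.
  rewrite /S1 /S2 big_distrr -sum_neq0_const -big_split /=; apply: leq_sum => a a0.
  by rewrite (mod1P (cf_one C a0)); apply: arith_second_moment.
move: e1 e2; have [A [A0 -> -> ->]] := q_pow_split.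
rewrite expnS expn1; apply: arith_quadratic => //; last by have := q_gt1; lia.
have := card_points_lb; have : (s <= q)%N by apply: dvdn_leq s_dvd_q; have := q_gt1; lia.
lia.
Qed.

Lemma excess_lt : (d < s ^ (h - 3) * (s + 2))%N.
Proof.
apply: (arith_d_bound s7 _ _ card_points_eq card_points_small quadratic_bound).
  by rewrite expn_gt0; move: s7; lia.
by rewrite card_field_eq !expnS expn0 muln1.
Qed.

End Config.

Section Multiset.
Variable F : finFieldType.

Definition mset_seq (mu : F -> nat) : seq F := flatten [seq nseq (mu x) x | x <- index_enum F].

Lemma count_mset_seq mu x : count_mem x (mset_seq mu) = mu x.
Proof.
rewrite /mset_seq count_flatten -map_comp sumnE big_map (bigD1 x) //= count_nseq /= eqxx mul1n.
by rewrite big1 ?addn0 // => y /negPf yx; rewrite count_nseq /= yx mul0n.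
Qed.

Lemma split_mset_seq mu : split_poly (mset_seq mu) = \prod_x ('X - x%:P) ^+ mu x.
Proof.
rewrite /split_poly /mset_seq big_flatten big_map; apply: eq_bigr => x _.
by elim: (mu x) => [|n IH]; rewrite ?big_nil ?expr0 //= big_cons IH exprS.
Qed.

Lemma size_mset_seq mu : size (mset_seq mu) = (\sum_x mu x)%N.
Proof.
by rewrite size_flatten /shape -map_comp sumnE big_map; apply: eq_bigr => x _; rewrite /= size_nseq.
Qed.

Lemma mem_mset_seq mu x : (x \in mset_seq mu) = (0 < mu x)%N.
Proof. by rewrite -has_pred1 has_count count_mset_seq. Qed.

End Multiset.

(** * Projection from a subspace of codimension two *)

Section Codim2Projection.
Variables (F : finFieldType) (I : finType) (h p s : nat) (v : I -> 'rV[F]_h).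
Hypothesis C : config p s v.
Local Notation q := #|F|.
Local Notation b := #|I|.
Local Notation zr := (zeros v).

Let s7 := cf_s7 C.
Let h3 := cf_h C.
Let v0 := cf_v0 C.

Definition fval (a : 'cV[F]_h) i : F := (v i *m a) 0 0.
Local Notation ev := fval.

Lemma zrE a i : (i \in zr a) = (ev a i == 0).
Proof.
rewrite inE /fval; apply/eqP/eqP => [->|e]; first by rewrite mxE.
by apply/matrixP => x y; rewrite !ord1 e mxE.
Qed.

Lemma evD a c i : ev (a + c) i = ev a i + ev c i.
Proof. by rewrite /fval mulmxDr mxE. Qed.

Lemma evZ x a i : ev (x *: a) i = x * ev a i.
Proof. by rewrite /fval -scalemxAr mxE. Qed.

Lemma ev0 i : ev 0 i = 0.
Proof. by rewrite /fval mulmx0 mxE. Qed.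

Lemma pchar_nat_s : [pchar F].-nat s.
Proof. by have [e _ ->] := cf_s C; apply: pnat_pcharX; exact: cf_p C. Qed.

Let sF := pchar_nat_s.

(** Each point is killed by [q^(h-1)] of the [q^h] functionals, so fewer than [q] points cannot rule
    out all functionals. *)
Lemma exists_nowhere_zero (S : {set I}) : (#|S| < q)%N ->
  exists c, forall i, i \in S -> ev c i != 0.
Proof.
move=> Sq; case: (pickP (fun c => [forall (i | i \in S), ev c i != 0])) => [c /forall_inP hc|none].
  by exists c.
exfalso; have sub : [set: 'cV[F]_h] \subset \bigcup_(i in S) ann (v i).
  apply/subsetP => c _; have := none c => /negbT; rewrite negb_forall_in => /exists_inP [i iS].
  by rewrite negbK -zrE => ic; apply/bigcupP; exists i => //; rewrite mem_ann; rewrite inE in ic.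
have := subset_leq_card sub; rewrite cardsT card_mx muln1 => le.
have : (\sum_(i in S) #|ann (v i)| <= #|S| * q ^ (h - 1))%N.
  rewrite -sum_nat_const; apply: leq_sum => i _.
  by have := card_ann (v i); rewrite (rank_v v0) => ->.
have un : (#|\bigcup_(i in S) ann (v i)| <= \sum_(i in S) #|ann (v i)|)%N.
  apply: (big_ind2 (fun (A : {set 'cV[F]_h}) n => (#|A| <= n)%N)) => [|A n B m hA hB|//].
    by rewrite cards0.
  by apply: leq_trans (leq_card_setU _ _) _; exact: leq_add.
move/(leq_trans un)/(leq_trans le).
have -> : (q ^ h = q * q ^ (h - 1))%N by rewrite -expnS; congr (_ ^ _)%N; move: h3; lia.
by rewrite leq_pmul2r ?expn_gt0 ?(ltnW (q_gt1 C)) // leqNgt Sq.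
Qed.

Variables a1 a2 : 'cV[F]_h.
Hypothesis ind : forall x, a2 + x *: a1 != 0.
Hypothesis a1_neq0 : a1 != 0.
(** The hyperplane of [a1] has no points of [B] besides those of the axis, so all other points have
    a finite slope. *)
Hypothesis zsub : zr a1 \subset zr a2.
Variable i0 : I.
Hypothesis i0K : i0 \in zr a1.
Hypothesis nK_lt : (#|zr a1| < q)%N.

Local Notation nK := #|zr a1|.

(* The hyperplanes containing [K = zeros a1], other than [zeros a1] itself, are the
   [zeros (a2 + x *: a1)]; [slope k] is the [x] of the one through [k]. *)
Definition slope k : F := - (ev a2 k / ev a1 k).
Local Notation xi := slope.

Definition slope_class x : {set I} := [set k | (k \notin zr a1) && (xi k == x)].
Local Notation hits := slope_class.

Lemma hitsE k x : k \notin zr a1 -> (k \in hits x) = (k \in zr (a2 + x *: a1)).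
Proof.
move=> ka; rewrite inE ka zrE evD evZ /=; rewrite zrE in ka.
apply/eqP/eqP => [<-|e]; first by rewrite /slope mulNr divfK // subrr.
apply: (mulIf ka); rewrite /slope mulNr divfK //; apply/eqP; rewrite eq_sym -addr_eq0 addrC; exact/eqP.
Qed.

Lemma card_zr_hits x : #|zr (a2 + x *: a1)| = (nK + #|hits x|)%N.
Proof.
rewrite -(cardsID (zr a1)); congr (_ + _)%N.
  apply: eq_card => k; rewrite in_setI; apply: andb_idl => kz.
  have := subsetP zsub k kz; move: kz; rewrite !zrE evD evZ => /eqP -> /eqP ->.
  by rewrite mulr0 addr0.
apply: eq_card => k; rewrite in_setD; case: (boolP (k \in zr a1)) => ka /=.
  by rewrite inE ka.
by rewrite hitsE.
Qed.

Definition slope_mult x := (#|hits x| %/ s)%N.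
Local Notation mu := slope_mult.

Lemma hits_mu x : #|hits x| = (mu x * s)%N.
Proof.
rewrite /slope_mult divnK //; have := mod1_sub (cf_one C (ind x)) (cf_one C a1_neq0).
by rewrite card_zr_hits addKn; apply; exact: leq_addr.
Qed.

Lemma sum_hits : (\sum_x #|hits x| = b - nK)%N.
Proof.
have -> : (b - nK = #|~: zr a1|)%N by rewrite [RHS]cardsCs setCK.
rewrite -sum1_card (partition_big xi predT) //=; apply: eq_bigr => x _.
by rewrite -sum1_card; apply: eq_bigl => k; rewrite !inE.
Qed.

Let FK := \prod_(k | k \notin zr a1) ('X - (xi k)%:P).
Let Fh : {poly F} := \prod_x ('X - x%:P) ^+ mu x.

Let FK_Fh : FK = Fh ^+ s.
Proof.
rewrite /FK prod_fibers -prodrXl; apply: eq_bigr => x _; rewrite -exprM -hits_mu.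
by congr (_ ^+ _); apply: eq_card => k; rewrite !inE.
Qed.

(** With [c] zero at no point of the axis, the hyperplane of [a2 + x a1 + z c] for [z != 0] contains
    no point of the axis. It meets [B], hence off the axis, which is the covering hypothesis of
    [gap]. *)
Let FK_gap i : (b - nK + 1 < i + q)%N -> (i < q)%N -> FK`_i = 0.
Proof.
have [c hc] := exists_nowhere_zero nK_lt.
move=> i1 iq; have -> : FK = \prod_(k <- enum (~: zr a1)) ('X + (ev a2 k / ev a1 k)%:P).
  rewrite big_enum /= /FK; apply: eq_big => [k|k _]; first by rewrite in_setC.
  by rewrite /slope polyCN opprK.
apply: (gap (ga := fun k => ev c k / ev a1 k)) => // [z z0 x|]; last first.
  by rewrite -cardE cardsCs setCK.
have nz : a2 + x *: a1 + z *: c != 0.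
  apply/eqP => e; have := congr1 (fun a => ev a i0) e; rewrite !evD !evZ ev0.
  have := i0K; have := subsetP zsub _ i0K; rewrite !zrE => /eqP -> /eqP ->.
  by rewrite mulr0 !add0r => /eqP; rewrite mulf_eq0 (negPf z0) /= (negPf (hc _ i0K)).
have /card_gt0P [k kz] := zr_gt0 C nz.
have ka : k \notin zr a1.
  apply/negP => ka; have := subsetP zsub _ ka; move: (ka) kz; rewrite !zrE !evD !evZ.
  move=> /eqP -> e2 /eqP e1; move: e2; rewrite e1 mulr0 !add0r mulf_eq0 (negPf z0) /=.
  by apply/negP; exact: hc.
exists k; first by rewrite mem_enum in_setC.
move: kz ka; rewrite !zrE !evD !evZ => /eqP e ka; apply: (mulIf ka).
by rewrite mul0r -[RHS]e; field.
Qed.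

Let sum_mu_s : ((\sum_x mu x) * s = b - nK)%N.
Proof. by rewrite -sum_hits big_distrl; apply: eq_bigr => x _; rewrite hits_mu. Qed.

Let FK_enum : FK = \prod_(k <- enum (~: zr a1)) ('X - (xi k)%:P).
Proof. by rewrite big_enum; apply: eq_bigl => k; rewrite in_setC. Qed.

Let size_FK : size FK = (b - nK).+1.
Proof. by rewrite FK_enum size_prod_XsubC -cardE cardsCs setCK. Qed.

Let monic_FK : FK \is monic.
Proof. exact: monic_prod_XsubC. Qed.

(** Otherwise the leading coefficient 1 of the product would fall into the gap. *)
Lemma codim2_ge_q : (q <= b - nK)%N.
Proof.
rewrite leqNgt; apply/negP => lt; have q1 := q_gt1 C.
have := FK_gap (_ : (b - nK + 1 < (b - nK) + q)%N) lt; rewrite ltn_add2l q1 => /(_ isT).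
have := monic_FK; rewrite monicE lead_coefE size_FK /= => /eqP -> /eqP.
by rewrite oner_eq0.
Qed.

Lemma sum_mu_delta : exists2 delta, (b - nK = q + s * delta)%N &
  (\sum_x mu x = q %/ s + delta)%N.
Proof.
have s0 : (0 < s)%N by move: s7; lia.
have qs := divnK (s_dvd_q C); have := sum_mu_s; have := codim2_ge_q.
set S := (\sum_x mu x)%N; set M := (q %/ s)%N in qs *.
set N := (b - nK)%N => le e; have MS : (M <= S)%N.
  by rewrite -(leq_pmul2r s0) // e qs.
exists (S - M)%N; last by rewrite subnKC.
by rewrite -e -qs mulnBr [(s * S)%N]mulnC [(s * M)%N]mulnC subnKC // leq_mul2r MS orbT.
Qed.

(** The gap of [Fh^s], read at the multiples of [s], is a gap of [Fh] strictly between the degrees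
    [delta] and [q / s]; [f] and [g] are the parts above and below it. *)
Lemma codim2_lacunary : exists delta f g,
  [/\ (b - nK = q + s * delta)%N,
      split_poly (mset_seq mu) = 'X^(q %/ s) * f + g,
      f \is monic, size f = delta.+1 & (size g <= delta.+1)%N].
Proof.
have [delta NE SE] := sum_mu_delta; set M := (q %/ s)%N in SE *.
have FhE : split_poly (mset_seq mu) = Fh by rewrite split_mset_seq.
have szFh : size Fh = (M + delta).+1 by rewrite -FhE size_prod_XsubC size_mset_seq SE.
have s0 : (0 < s)%N by move: s7; lia.
exists delta, (drop_poly M Fh), (take_poly M Fh); split=> //.
- by rewrite FhE -[LHS](poly_take_drop M) addrC mulrC.
- rewrite monicE lead_coefE size_drop_poly szFh -addnS addKn coef_drop_poly /=.
  have : Fh \is monic by rewrite -FhE; exact: monic_prod_XsubC.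
  by rewrite monicE lead_coefE szFh /= addnC.
- by rewrite size_drop_poly szFh -addnS addKn.
apply/leq_sizeP => j hj; rewrite coef_take_poly; case: ltnP => // jM.
have sj : FK`_(j * s) = Fh`_j ^+ s by rewrite FK_Fh (coef_exp_frob sF) dvdn_mull // mulnK.
have jq : (j * s < q)%N by rewrite -(divnK (s_dvd_q C)) ltn_pmul2r.
have : FK`_(j * s) = 0.
  apply: FK_gap => //; rewrite NE; have := leq_mul (leqnn s) hj.
  by rewrite mulnS [(s * j)%N]mulnC; move: s7; lia.
by move/eqP; rewrite sj expf_eq0 s0 => /eqP.
Qed.

End Codim2Projection.

(** * The polynomial of a line skew to the axis *)

Section SkewLinePolynomial.
Variables (F : finFieldType) (I : finType) (h p s : nat) (v : I -> 'rV[F]_h).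
Hypothesis C : config p s v.
Local Notation q := #|F|.
Local Notation L := (line_pts v).
Local Notation zr := (zeros v).
Local Notation ev := (fval v).
Variables (a1 a2 : 'cV[F]_h) (i j : I).
Hypothesis ij : i != j.
Hypothesis skew : forall y z, ev (y *: a1 + z *: a2) i = 0 ->
  ev (y *: a1 + z *: a2) j = 0 -> y = 0 /\ z = 0.
Hypothesis a1L : forall k, k \in L i j -> ev a1 k != 0.

Local Notation xi := (slope v a1 a2).

Lemma xi_inj_line : {in L i j &, injective xi}.
Proof.
move=> k l kL lL e; apply/eqP; apply: contraT => kl.
have z0 (m : I) : m \in L i j -> xi m = xi k -> m \in zr (a2 + xi k *: a1).
  move=> mL <-; rewrite zrE evD evZ /slope mulNr divfK ?subrr //; exact: a1L.
have zk := z0 k kL erefl; have zl := z0 l lL (esym e).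
have LL := line_pts_eq (cf_v0 C) (cf_inj C) ij kL lL kl.
have sub : L k l \subset zr (a2 + xi k *: a1).
  by apply: pts_sub_zr; move: zk zl; rewrite mem_ann ann_adds !inE => -> ->.
have hz m : m \in L i j -> ev (xi k *: a1 + 1 *: a2) m = 0.
  by rewrite -LL => /(subsetP sub); rewrite zrE evD evZ scale1r evD evZ addrC => /eqP.
have [_ /eqP] := skew (hz i (line_pts_l _ _ _)) (hz j (line_pts_r _ _ _)).
by rewrite oner_eq0.
Qed.

Definition line_poly := \prod_(k in L i j) ('X - (xi k)%:P).

(** Take a functional [a] whose zeros in [B] are exactly the points of the line. As the line is skew
    to the axis, [a + y a1 + z a2] is never zero. The lowest form of the product of its values over
    [B] is, up to a constant, the product over the line, so [lowest_form] applies. *)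
Lemma line_poly_coef m : ~~ (s %| m)%N -> ~~ (s %| m.-1)%N -> line_poly`_m = 0.
Proof.
move=> sm sm'; have s7 := cf_s7 C; have h3 := cf_h C.
have rU : (\rank (v i + v j)%MS < h)%N by rewrite (rank_line (cf_v0 C) (cf_inj C) ij); lia.
have [a [a0 aU az]] := exists_exact C (line_pts_l v i j) rU.
have one y z : #|[set k | ev a k + ev a1 k * y + ev a2 k * z == 0]| = 1 %[mod s].
  have -> : [set k | ev a k + ev a1 k * y + ev a2 k * z == 0] = zr (a + (y *: a1 + z *: a2)).
    by apply/setP => k; rewrite zrE !evD !evZ inE addrA mulrC [ev a2 k * z]mulrC.
  apply: (cf_one C); apply/eqP => e.
  have hz m0 : m0 \in L i j -> ev (y *: a1 + z *: a2) m0 = 0.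
    rewrite -[L i j]/(pts v _) -az zrE => /eqP am.
    by have := congr1 (fun a => ev a m0) e; rewrite evD am add0r ev0.
  have [y0 z0] := skew (hz i (line_pts_l _ _ _)) (hz j (line_pts_r _ _ _)).
  by move/eqP: e; rewrite y0 z0 !scale0r !addr0 (negPf a0).
have small : (#|I| < q + q - 1)%N.
  by have := card_points_small C; have := s_lt_q C; have := leq_mul (leq_mul s7 s7) s7; lia.
have nE : [set k | ev a k == 0] = L i j.
  by rewrite -[L i j]/(pts v _) -az; apply/setP => k; rewrite zrE inE.
have nq : (#|L i j| < q)%N by have := card_pts_lt_q C rU.
have n0 : (0 < #|L i j|)%N by apply/card_gt0P; exists i; exact: line_pts_l.
have /= := lowest_form (pchar_nat_s C) (leq_trans (isT : (1 < 7)%N) s7) small one (i := m).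
rewrite nE n0 nq => /(_ isT sm sm').
rewrite (eq_bigl (mem (L i j))); last by move=> k /=; rewrite -nE inE.
rewrite (eq_bigr (fun k => (ev a1 k)%:P * ('X - (xi k)%:P))); last first.
  move=> k kL; rewrite mulrBr mul_polyC -polyCM /slope mulrN mulrC divfK ?a1L //.
  by rewrite polyCN opprK.
rewrite big_split /= -rmorph_prod coefCM => /eqP; rewrite mulf_eq0 => /orP [|/eqP //].
by move/prodf_eq0 => [k kL]; rewrite (negPf (a1L kL)).
Qed.

Lemma line_poly_decomp : exists E1 E2 : {poly F},
  [/\ line_poly = 'X * (E1 \Po 'X^s) + (E2 \Po 'X^s),
      size E1 = (line_weight s v i j).+1, E1 \is monic & (size E2 <= (line_weight s v i j).+1)%N].
Proof.
have s7 := cf_s7 C; set n := line_weight s v i j.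
have s0 : (0 < s)%N by lia.
have szL : size line_poly = (s * n + 2)%N.
  by rewrite /line_poly -big_enum size_prod_XsubC -cardE (card_line C ij) addn2.
have mL : line_poly`_(s * n + 1) = 1.
  have : line_poly \is monic by exact: monic_prod_XsubC.
  by rewrite monicE lead_coefE szL addn2 /= addn1 => /eqP.
pose E1 := \poly_(k < n.+1) line_poly`_(s * k + 1).
pose E2 := \poly_(k < n.+1) line_poly`_(s * k).
have szE1 : size E1 = n.+1 by rewrite size_poly_eq // mL oner_neq0.
exists E1, E2; split=> //; last exact: size_poly.
  apply/polyP => m; rewrite coefD coefXM !coef_comp_poly_Xn //.
  case: m => [|m] /=; first by rewrite dvdn0 div0n add0r coef_poly /= muln0.
  case: (boolP (s %| m)%N) => [/dvdnP [k ->]|sm].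
    have -> : (s %| (k * s).+1)%N = false.
      by rewrite -addn1 dvdn_addr ?dvdn_mull // dvdn1; apply/eqP; lia.
    rewrite mulnK // addr0 coef_poly; case: ltnP => kn; first by rewrite mulnC addn1.
    have le : (size line_poly <= (k * s).+1)%N.
      have : (s * n.+1 <= k * s)%N by rewrite mulnC leq_mul2r kn orbT.
      by rewrite szL mulnS; move: s7; lia.
    exact: coef_geq le.
  case: (boolP (s %| m.+1)%N) => [/dvdnP [k kE]|sm1]; last by rewrite addr0 line_poly_coef.
  rewrite kE mulnK // add0r coef_poly; case: ltnP => kn; first by rewrite mulnC.
  have le : (size line_poly <= k * s)%N.
    have : (s * n.+1 <= k * s)%N by rewrite mulnC leq_mul2r kn orbT.
    by rewrite szL mulnS; move: s7; lia.
  exact: coef_geq le.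
by rewrite monicE lead_coefE szE1 coef_poly ltnSn mL.
Qed.

End SkewLinePolynomial.

(** * Criteria for linearity *)

Section Subfield.
Variables (F : finFieldType) (s h : nat).
Hypothesis sF : [pchar F].-nat s.
Hypothesis s1 : (1 < s)%N.
Hypothesis qE : #|F| = (s ^ h)%N.

Definition frob_fixed : {set F} := [set x | x ^+ s == x].
Local Notation Fs := frob_fixed.

Lemma FsP x : reflect (x ^+ s = x) (x \in Fs).
Proof. by rewrite inE; apply: eqP. Qed.

Let size_XsX : size ('X^s - 'X : {poly F}) = s.+1.
Proof. by rewrite size_polyDl size_polyXn // size_polyN size_polyX. Qed.

Lemma card_Fs_le : (#|Fs| <= s)%N.
Proof.
have nz : 'X^s - 'X != 0 :> {poly F} by rewrite -size_poly_eq0 size_XsX.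
have := max_poly_roots nz (_ : all (root _) (enum Fs)) (enum_uniq _).
rewrite size_XsX -cardE; apply; apply/allP => x; rewrite mem_enum inE => /eqP e.
by apply/rootP; rewrite hornerD hornerN hornerXn hornerX e subrr.
Qed.

Lemma XsX_dvd k : ('X^s - 'X : {poly F}) %| 'X^(s ^ k) - 'X.
Proof.
elim: k => [|k IH]; first by rewrite expn0 expr1 subrr dvdp0.
have -> : 'X^(s ^ k.+1) - 'X = ('X^(s ^ k) - 'X) ^+ s + ('X^s - 'X) :> {poly F}.
  have sP := pnat_pchar_poly sF.
  by rewrite (exprDn_pchar _ _ sP) (exprNn_pchar _ sP) addrA subrK -exprM -expnSr.
rewrite dvdp_add // (dvdp_trans IH) // -[s]prednK ?exprS ?dvdp_mulr //; exact: ltnW.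
Qed.

Lemma card_Fs : #|Fs| = s.
Proof.
apply/eqP; rewrite eqn_leq card_Fs_le /=.
have := XsX_dvd h; rewrite -qE finField_genPoly => /dvdp_prod_XsubC [m eqm].
set r := mask m _ in eqm.
have szr : size r = s by have := eqp_size eqm; rewrite size_prod_XsubC size_XsX => -[].
have ur : uniq r by apply: mask_uniq; exact: index_enum_uniq.
rewrite -szr -(card_uniqP ur); apply/subset_leq_card/subsetP => x xr.
have : root ('X^s - 'X) x by rewrite (eqp_root eqm) root_prod_XsubC.
by move/rootP; rewrite hornerD hornerN hornerXn hornerX inE => /eqP; rewrite subr_eq0.
Qed.

Lemma Fs0 : 0 \in Fs. Proof. by rewrite inE expr0n gtn_eqF // ltnW. Qed.
Lemma Fs1 : 1 \in Fs. Proof. by rewrite inE expr1n. Qed.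

Lemma FsD x y : x \in Fs -> y \in Fs -> x + y \in Fs.
Proof. by move=> /FsP hx /FsP hy; apply/FsP; rewrite (exprDn_pchar _ _ sF) hx hy. Qed.

Lemma FsN x : x \in Fs -> - x \in Fs.
Proof. by move=> /FsP hx; apply/FsP; rewrite (exprNn_pchar _ sF) hx. Qed.

Lemma FsM x y : x \in Fs -> y \in Fs -> x * y \in Fs.
Proof. by move=> /FsP hx /FsP hy; apply/FsP; rewrite exprMn hx hy. Qed.

Lemma FsV x : x \in Fs -> x^-1 \in Fs.
Proof. by move=> /FsP hx; apply/FsP; rewrite exprVn hx. Qed.

Lemma frob_s_inj : injective (fun x : F => x ^+ s).
Proof.
move=> x y /= e; have := exprDn_pchar (x - y) y sF; rewrite subrK e => /eqP.
rewrite -subr_eq subrr eq_sym expf_eq0 ltnW //= subr_eq0.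
by move/eqP.
Qed.

(* Translations by [Fs] permute an additively closed set that contains [Fs],
   and the fibres of x |-> x^s - x are the orbits. *)
Lemma dvd_card_Fs_module (A : {set F}) :
  {in A & Fs, forall x y, x + y \in A} -> (s %| #|A|)%N.
Proof.
move=> hA; rewrite -sum1_card (partition_big (fun x => x ^+ s - x) predT) //=.
apply: dvdn_sum => y _; case: (pickP (fun x => (x \in A) && (x ^+ s - x == y))) => [x /andP[xA xy]|no]; last first.
  by rewrite big_pred0.
suff -> : (\sum_(i in A | (i ^+ s - i)%R == y) 1 = #|Fs|)%N by rewrite card_Fs.
rewrite sum1dep_card -(card_imset Fs (addrI x)); apply: eq_card => z; rewrite !inE.
apply/andP/imsetP => [[zA zy]|[t tF ->]].
  exists (z - x); last by rewrite addrC subrK.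
  apply/FsP; rewrite (exprDn_pchar _ _ sF) (exprNn_pchar _ sF).
  have -> : z ^+ s - x ^+ s = (z ^+ s - z) - (x ^+ s - x) + (z - x) by ring.
  by rewrite (eqP zy) (eqP xy) subrr add0r.
split; first exact: hA.
rewrite (exprDn_pchar _ _ sF) (FsP _ tF) opprD addrACA subrr addr0; exact: xy.
Qed.
End Subfield.

(** On the roots, [x -> x^s] agrees with the Moebius map [x -> - (b x + c) / (x + a)], which
    preserves cross-ratios; and [l] is a cross-ratio of four roots. *)
Lemma cross_ratio_fixed (F : fieldType) s (a b c l : F) (u v w t : F) :
  [pchar F].-nat s -> (forall x, x \in [:: u; v; w; t] -> x ^+ s * (x + a) + (b * x + c) = 0) ->
  uniq [:: u; v; t] -> w != u -> l * ((w - u) * (v - t)) = (v - w) * (t - u) -> l ^+ s = l.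
Proof.
move=> sF hr un wu hl.
have s0 : (0 < s)%N by case/andP: sF.
have key x y : x \in [:: u; v; w; t] -> y \in [:: u; v; w; t] ->
    (x - y) ^+ s * ((x + a) * (y + a)) = (c - a * b) * (x - y).
  move=> /hr hx /hr hy; rewrite (exprDn_pchar _ _ sF) (exprNn_pchar _ sF).
  have -> : (x ^+ s - y ^+ s) * ((x + a) * (y + a)) =
    (x ^+ s * (x + a)) * (y + a) - (y ^+ s * (y + a)) * (x + a) by ring.
  move/eqP: hx; rewrite addr_eq0 => /eqP ->; move/eqP: hy; rewrite addr_eq0 => /eqP ->.
  by ring.
move: un; rewrite /= !inE !negb_or andbT => /andP[/andP[uv ut] vt].
have mu : u \in [:: u; v; w; t] by rewrite !inE eqxx.
have mv : v \in [:: u; v; w; t] by rewrite !inE eqxx ?orbT.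
have mw : w \in [:: u; v; w; t] by rewrite !inE eqxx ?orbT.
have mt : t \in [:: u; v; w; t] by rewrite !inE eqxx ?orbT.
(* For [c = a b] the polynomial is [(X + a) (X^s + b)], with at most two distinct roots, whereas
   [u], [v] and [t] are distinct. *)
have D0 : c - a * b != 0.
  apply/eqP => D; have z x y : x \in [:: u; v; w; t] -> y \in [:: u; v; w; t] -> x != y ->
      (x == - a) || (y == - a).
    move=> hx hy xy; have /eqP := key x y hx hy; rewrite D mul0r mulf_eq0 expf_eq0 s0 /= subr_eq0 (negPf xy) /=.
    by rewrite mulf_eq0 !addr_eq0.
  have := z _ _ mu mv uv; have := z _ _ mu mt ut; have := z _ _ mv mt vt.
  by move=> /orP[] /eqP e1 /orP[] /eqP e2 /orP[] /eqP e3; move: uv ut vt;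
    rewrite ?e1 ?e2 ?e3 ?eqxx.
have E : l ^+ s * ((w - u) ^+ s * (v - t) ^+ s) = (v - w) ^+ s * (t - u) ^+ s.
  by rewrite -!exprMn hl.
have nz : (c - a * b) ^+ 2 * ((w - u) * (v - t)) != 0.
  by rewrite mulf_neq0 ?expf_neq0 // mulf_neq0 // subr_eq0.
apply: (mulIf nz); rewrite [RHS]mulrCA hl.
have -> : (c - a * b) ^+ 2 * ((v - w) * (t - u)) =
   ((v - w) ^+ s * (t - u) ^+ s) * (((v + a) * (w + a)) * ((t + a) * (u + a))).
  have -> : (v - w) ^+ s * (t - u) ^+ s * ((v + a) * (w + a) * ((t + a) * (u + a))) =
    ((v - w) ^+ s * ((v + a) * (w + a))) * ((t - u) ^+ s * ((t + a) * (u + a))) by ring.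
  by rewrite !key //; ring.
rewrite -E.
have -> : l ^+ s * ((w - u) ^+ s * (v - t) ^+ s) * ((v + a) * (w + a) * ((t + a) * (u + a))) =
   l ^+ s * (((w - u) ^+ s * ((w + a) * (u + a))) * ((v - t) ^+ s * ((v + a) * (t + a)))) by ring.
by rewrite !key //; ring.
Qed.

Lemma row_addsP (F : fieldType) h (x u w : 'rV[F]_h) :
  (x <= u + w)%MS -> exists al be, x = al *: u + be *: w.
Proof.
move=> /sub_addsmxP [[D1 D2] /= ->]; exists (D1 0 0), (D2 0 0).
by rewrite -!mul_scalar_mx -!mx11_scalar.
Qed.

Lemma row_combS (F : fieldType) h (u w : 'rV[F]_h) al be : ((al *: u + be *: w)%R <= u + w)%MS.
Proof.
by rewrite addmx_sub // scalemx_sub // ?addsmxSl ?addsmxSr.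
Qed.

Section Linear.
Variables (F : finFieldType) (I : finType) (h p s : nat) (v : I -> 'rV[F]_h).
Hypothesis C : config p s v.
Local Notation L := (line_pts v).
Local Notation Fs := (frob_fixed F s).

Let s7 := cf_s7 C.
Let s1 : (1 < s)%N := leq_trans (isT : (1 < 7)%N) s7.
Let v0 := cf_v0 C.
Let v_inj := cf_inj C.
Let sF := pchar_nat_s C.

Lemma cardFs : #|Fs| = s.
Proof. exact: card_Fs sF s1 (cf_q C). Qed.

Definition onB (x : 'rV[F]_h) := (x != 0) && [exists i, (x <= v i)%MS].

Lemma onBP x : reflect (exists i c, c != 0 /\ x = c *: v i) (onB x).
Proof.
apply: (iffP andP) => [[x0 /existsP [i /sub_rVP [c e]]]|[i [c [c0 ->]]]].
  by exists i, c; split=> //; apply: contraNneq x0 => c0; rewrite e c0 scale0r.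
by rewrite scaler_eq0 negb_or c0 v0; split=> //; apply/existsP; exists i; rewrite scalemx_sub.
Qed.

Lemma onB_v i : onB (v i).
Proof. by apply/onBP; exists i, 1; rewrite oner_neq0 scale1r. Qed.

Lemma onBZ c x : c != 0 -> onB x -> onB (c *: x).
Proof.
move=> c0 /onBP [i [e [e0 ->]]]; apply/onBP; exists i, (c * e).
by rewrite mulf_neq0 // scalerA.
Qed.

Lemma onBZE c x : c != 0 -> onB (c *: x) = onB x.
Proof.
move=> c0; apply/idP/idP => [|]; last exact: onBZ.
by move/(onBZ (c := c^-1)); rewrite invr_eq0 scalerA mulVf // scale1r; apply.
Qed.

Definition linear_config : Prop := exists U : {set 'rV[F]_h},
  [/\ 0 \in U, forall c x y, c \in Fs -> x \in U -> y \in U -> c *: x + y \in U,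
      forall i, exists2 c, c != 0 & c *: v i \in U &
      forall x, x \in U -> x != 0 -> onB x].

Lemma exists_Fs2 : exists2 c, c \in Fs & (c != 0) && (c != 1).
Proof.
have /subsetPn [c cF] : ~~ (Fs \subset [set 0; 1]).
  by apply/negP => /subset_leq_card; rewrite cardFs cards2; move: s7; case: (_ != _) => /=; lia.
by rewrite in_set2 negb_or => c01; exists c.
Qed.

Section Core.
Variables (k : nat) (E : 'M[F]_(h, k)).

Definition Fs_row (y : 'rV[F]_k) := (y != 0) && [forall j, y 0 j \in Fs].
(* [E] is a projection onto [F^k]. *)
Definition normalized u := onB u && Fs_row (u *m E).

Hypothesis cover : forall i, v i *m E != 0 -> exists2 c, c != 0 & Fs_row ((c *: v i) *m E).
Hypothesis sum_closed : forall u w, normalized u -> normalized w -> (u + w) *m E != 0 -> normalized (u + w).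
Hypothesis off_axis : exists i, v i *m E != 0.

Lemma Fs_rowZ c y : c \in Fs -> c != 0 -> Fs_row y -> Fs_row (c *: y).
Proof.
move=> cF c0 /andP [y0 /forallP yF]; rewrite /Fs_row scaler_eq0 negb_or c0 y0 /=.
by apply/forallP => j; rewrite mxE (FsM cF).
Qed.

Lemma normalized_nz u : normalized u -> u *m E != 0.
Proof. by case/andP => _ /andP []. Qed.

Lemma normalizedZ c u : c \in Fs -> c != 0 -> normalized u -> normalized (c *: u).
Proof.
by move=> cF c0 /andP [uB uF]; rewrite /normalized onBZ //= -scalemxAl Fs_rowZ.
Qed.

Lemma normalizedN u : normalized u -> normalized (- u).
Proof.
by move=> uW; rewrite -scaleN1r normalizedZ // ?(FsN sF) ?(Fs1 F s) // oppr_eq0 oner_neq0.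
Qed.

Lemma normalized_cover i : v i *m E != 0 -> exists2 c, c != 0 & normalized (c *: v i).
Proof.
by move=> /cover [c c0 cF]; exists c => //; rewrite /normalized onBZ ?onB_v.
Qed.

Lemma normalized_ex : exists u, normalized u.
Proof. by have [i /normalized_cover [c _ cW]] := off_axis; exists (c *: v i). Qed.

(* The points killed by [E] have no normalized representatives; they are recovered
   as differences of normalized representatives with the same image. *)
Definition translation x := (x *m E == 0) && [exists u, normalized u && normalized (u + x)].

(** The property is carried from one normalized [u0] to any [u] by adding [u - u0]. If [E] kills
    this difference, a detour through [c *: u0] with [c] in [Fs] other than 0 and 1 avoids it. *)
Lemma translationP x : reflect (x *m E = 0 /\ forall u, normalized u -> normalized (u + x)) (translation x).
Proof.
apply: (iffP andP) => [[/eqP x0 /existsP [u0 /andP [u0W u0xW]]]|[x0 hx]]; last first.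
  split; first exact/eqP; have [u uW] := normalized_ex.
  by apply/existsP; exists u; rewrite uW hx.
split=> // u uW.
have shift w : normalized w -> normalized (w + x) -> (u - w) *m E != 0 -> normalized (u + x).
  move=> wW wxW nz; have uw : normalized (u - w) by apply: sum_closed => //; exact: normalizedN.
  have -> : u + x = (w + x) + (u - w) by rewrite addrAC [w + (u - w)]addrC subrK.
  apply: sum_closed => //; rewrite addrAC [w + (u - w)]addrC subrK mulmxDl x0 addr0.
  exact: normalized_nz.
have [e|] := eqVneq ((u - u0) *m E) 0; last exact: shift.
have [c cF /andP [c0 c1]] := exists_Fs2.
have u1W := normalizedZ cF c0 u0W; have nz := normalized_nz u0W.
have dif : (c *: u0 - u0) *m E != 0.
  rewrite -{2}[u0]scale1r -scalerBl -scalemxAl scaler_eq0 negb_or nz andbT.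
  by rewrite subr_eq0.
apply: (shift (c *: u0)) => //; last first.
  have -> : u - c *: u0 = (u - u0) - (c *: u0 - u0) by rewrite opprB addrA subrK.
  by rewrite mulmxBl e sub0r oppr_eq0.
have -> : c *: u0 + x = (u0 + x) + (c *: u0 - u0) by rewrite addrAC [u0 + _]addrC subrK.
apply: sum_closed => //; first by apply: sum_closed => //; exact: normalizedN.
rewrite addrAC [u0 + (_ - _)]addrC subrK mulmxDl x0 addr0; exact: normalized_nz.
Qed.

Lemma translationD x y : translation x -> translation y -> translation (x + y).
Proof.
move=> /translationP [x0 hx] /translationP [y0 hy]; apply/translationP; split; first by rewrite mulmxDl x0 y0 addr0.
by move=> u uW; rewrite addrA; apply/hy/hx.
Qed.

Lemma translationZ c x : c \in Fs -> translation x -> translation (c *: x).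
Proof.
move=> cF /translationP [x0 hx]; apply/translationP; rewrite -scalemxAl x0 scaler0; split=> // u uW.
have [->|c0] := eqVneq c 0; first by rewrite scale0r addr0.
have -> : u + c *: x = c *: (c^-1 *: u + x) by rewrite scalerDr scalerA divff // scale1r.
by apply: normalizedZ => //; apply: hx; apply: normalizedZ => //; rewrite ?FsV ?invr_eq0.
Qed.

Lemma normalized_inj_line u x i l m : normalized u -> translation x -> x != 0 ->
  ((u + l *: x)%R <= v i)%MS -> ((u + m *: x)%R <= v i)%MS -> l = m.
Proof.
move=> uW /translationP [xE _] x0 /sub_rVP [a ea] /sub_rVP [c ec].
have ux e : (u + e *: x) *m E = u *m E by rewrite mulmxDl -scalemxAl xE scaler0 addr0.
have : (a - c) *: (v i *m E) = 0.
  by rewrite scalerBl !scalemxAl -ea -ec !ux subrr.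
move/eqP; rewrite scaler_eq0 => /orP [|/eqP viE]; last first.
  by have := normalized_nz uW; rewrite -(ux l) ea -scalemxAl viE scaler0 eqxx.
rewrite subr_eq0 => /eqP ac; move: ea; rewrite ac -ec => /addrI /eqP.
by rewrite -subr_eq0 -scalerBl scaler_eq0 (negPf x0) orbF subr_eq0 => /eqP.
Qed.

(** If [E] killed no point of the line through [u] and [u + x], the points of this line would
    correspond to the scalars [l] with [u + l *: x] normalized. These are stable under adding [Fs],
    so [s] would divide a number that is [1] modulo [s]. A killed point of the line is a multiple of
    [x]. *)
Lemma translation_onB x : translation x -> x != 0 -> onB x.
Proof.
move=> xD x0; have [u uW] := normalized_ex; have [xE hx] := translationP _ xD.
have uxW := hx u uW; have nz := normalized_nz uW.
have /andP [/onBP [i [ci [ci0 uE]]] _] := uW.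
have /andP [/onBP [j [cj [cj0 uxE]]] _] := uxW.
have ui : (u <= v i)%MS by rewrite uE scalemx_sub.
have uxj : ((u + x)%R <= v j)%MS by rewrite uxE scalemx_sub.
have ij : i != j.
  apply/eqP => eij; have : 0 = 1 :> F; last by move/eqP; rewrite eq_sym oner_eq0.
  by apply: (@normalized_inj_line u x i) => //; rewrite ?scale0r ?addr0 ?scale1r // eij.
have iu : v i = ci^-1 *: u by rewrite uE scalerA mulVf // scale1r.
have ju : v j = cj^-1 *: (u + x) by rewrite uxE scalerA mulVf // scale1r.
have Lux k0 : k0 \in L i j -> exists al be, v k0 = al *: u + be *: x.
  rewrite inE => /row_addsP [a [c ->]]; exists (a * ci^-1 + c * cj^-1), (c * cj^-1).
  by rewrite iu ju scalerDr !scalerA scalerDr scalerDl !scalerA addrA.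
case: (boolP [exists (k0 | k0 \in L i j), v k0 *m E == 0]) => [/exists_inP [k0 kL /eqP kE]|].
  have [al [be ke]] := Lux k0 kL; move: kE; rewrite ke mulmxDl -!scalemxAl xE scaler0 addr0.
  move/eqP; rewrite scaler_eq0 (negPf nz) orbF => /eqP al0.
  move: ke; rewrite al0 scale0r add0r => ke; have be0 : be != 0.
    by apply: contraNneq (v0 k0) => e; rewrite ke e scale0r.
  by rewrite -(onBZE _ be0) -ke onB_v.
rewrite negb_exists_in => /forall_inP off; exfalso.
pose A := [set l | normalized (u + l *: x)].
have dvA : (s %| #|A|)%N.
  apply: (dvd_card_Fs_module sF s1 (cf_q C)) => l t; rewrite [l \in A]inE [_ + _ \in A]inE => lA tF.
  by rewrite scalerDl addrA; have /translationP [_ ht] := translationZ tF xD; apply: ht.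
pose f l := odflt i [pick k0 | ((u + l *: x)%R <= v k0)%MS].
have fP l : l \in A -> ((u + l *: x)%R <= v (f l))%MS.
  rewrite inE => /andP [/andP [_ /existsP [k0 k0P]] _]; rewrite /f.
  by case: pickP => [//|/(_ k0)]; rewrite k0P.
have finj : {in A &, injective f}.
  move=> l m lA mA e; apply: (@normalized_inj_line u x (f l)) => //; first exact: fP.
  by rewrite e; exact: fP.
have LA : L i j = f @: A.
  apply/setP => k0; apply/idP/imsetP => [kL|[l lA ->]].
    have [al [be ke]] := Lux k0 kL.
    have kEE : v k0 *m E = al *: (u *m E) by rewrite ke mulmxDl -!scalemxAl xE scaler0 addr0.
    have al0 : al != 0 by apply: contraNneq (off k0 kL) => e; rewrite kEE e scale0r.
    have ux : u + (al^-1 * be) *: x = al^-1 *: v k0.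
      by rewrite ke scalerDr !scalerA mulVf // scale1r.
    have lA : al^-1 * be \in A.
      rewrite inE /normalized ux onBZ ?invr_eq0 // ?onB_v //=.
      by rewrite -scalemxAl kEE scalerA mulVf // scale1r; case/andP: uW.
    exists (al^-1 * be) => //; apply: v_inj.
    apply: submx_trans (fP _ lA); rewrite ux.
    by rewrite -[X in (X <= _)%MS](scale1r (v k0)) -(divff al0) -scalerA scalemx_sub.
  rewrite inE; have lA' := lA; rewrite inE in lA'.
  have fle := fP l lA; have /andP [/andP [ul0 _] _] := lA'.
  have /sub_rVP [c ce] := fle.
  have c0 : c != 0 by apply: contraNneq ul0 => e; rewrite ce e scale0r.
  have -> : v (f l) = c^-1 *: (u + l *: x) by rewrite ce scalerA mulVf // scale1r.
  rewrite scalemx_sub //; apply: addmx_sub; first by apply: submx_trans ui _; exact: addsmxSl.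
  apply: scalemx_sub; have -> : x = (u + x) - u by rewrite addrC addKr.
  apply: addmx_sub; first by apply: submx_trans uxj _; exact: addsmxSr.
  by rewrite eqmx_opp; apply: submx_trans ui _; exact: addsmxSl.
have := line_1mod C ij; rewrite LA card_in_imset // => e.
by move: dvA; rewrite /dvdn e modn_small.
Qed.

Lemma core_linear : linear_config.
Proof.
exists [set x | normalized x || translation x]; split.
- rewrite inE; apply/orP; right; apply/translationP; rewrite mul0mx; split=> // u.
  by rewrite addr0.
- move=> c x y cF; rewrite !inE => hx hy.
  have hcx : normalized (c *: x) || translation (c *: x).
    have [->|c0] := eqVneq c 0.
      by apply/orP; right; rewrite scale0r; apply/translationP; rewrite mul0mx; split=> // u; rewrite addr0.
    by case/orP: hx => [/(normalizedZ cF c0) ->//|/(translationZ cF) ->]; rewrite orbT.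
  case/orP: hcx => hc; case/orP: hy => hy.
  + have [e|nz] := eqVneq ((c *: x + y) *m E) 0; last by rewrite sum_closed.
    apply/orP; right; apply/andP; split; first exact/eqP.
    by apply/existsP; exists (- (c *: x)); rewrite normalizedN //= addKr.
  + by have /translationP [_ ->] := hy.
  + by rewrite addrC; have /translationP [_ ->] := hc.
  + by rewrite translationD ?orbT.
- move=> i; have [iE|] := eqVneq (v i *m E) 0; last first.
    by move/normalized_cover => [c c0 cW]; exists c; rewrite ?inE ?cW.
  (* For a point killed by [E], join it to a point [j] that is not: a third point of this line
     exhibits a multiple of [v i] as a translation. *)
  have [j jE] := off_axis; have ij : j != i by apply: contraNneq jE => ->; rewrite iE.
  have [k0 [kL ki kj]] : exists k0, [/\ k0 \in L j i, k0 != i & k0 != j].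
    have : (0 < #|L j i :\ i :\ j|)%N.
      have := cardsD1 i (L j i); have := cardsD1 j (L j i :\ i).
      rewrite in_setD1 ij line_pts_l line_pts_r (card_line C ij) /=.
      by have := line_weight_gt0 C ij; move: s7; nia.
    by move/card_gt0P => [k0]; rewrite !in_setD1 => /and3P [kj ki kL]; exists k0.
  have [al [be ke]] : exists al be, v k0 = al *: v j + be *: v i.
    by apply: row_addsP; rewrite inE in kL.
  have be0 : be != 0.
    apply: contraNneq kj => e; apply/eqP/v_inj.
    by rewrite ke e scale0r addr0 scalemx_sub.
  have al0 : al != 0.
    apply: contraNneq ki => e; apply/eqP/v_inj.
    by rewrite ke e scale0r add0r scalemx_sub.
  have [c c0 cW] := normalized_cover jE.
  exists (c * al^-1 * be); first by rewrite !mulf_neq0 ?invr_eq0.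
  rewrite inE; apply/orP; right; apply/andP; split; first by rewrite -scalemxAl iE scaler0.
  apply/existsP; exists (c *: v j); rewrite cW /=.
  have e : c *: v j + (c * al^-1 * be) *: v i = (c * al^-1) *: v k0.
    by rewrite ke scalerDr !scalerA divfK.
  rewrite e /normalized onBZ ?mulf_neq0 ?invr_eq0 ?onB_v //= -e mulmxDl -[X in _ + X]scalemxAl iE scaler0 addr0.
  by case/andP: cW.
- by move=> x; rewrite inE => /orP [/andP [] //|]; exact: translation_onB.
Qed.

End Core.
End Linear.

Section Star.
Variables (F : finFieldType) (I : finType) (h p s : nat) (v : I -> 'rV[F]_h).
Hypothesis C : config p s v.
Local Notation L := (line_pts v).
Local Notation Fs := (frob_fixed F s).
Local Notation ev := (fval v).
Local Notation zr := (zeros v).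

Let s7 := cf_s7 C.
Let s1 : (1 < s)%N := leq_trans (isT : (1 < 7)%N) s7.
Let v0 := cf_v0 C.
Let v_inj := cf_inj C.
Let sF := pchar_nat_s C.

Definition det2 (y z : 'rV[F]_2) : F := y 0 0 * z 0 1 - y 0 1 * z 0 0.

Lemma row2P (y z : 'rV[F]_2) : y 0 0 = z 0 0 -> y 0 1 = z 0 1 -> y = z.
Proof.
move=> h0 h1; apply/rowP => j; case: j => [[|[|]]] // jlt.
  by rewrite (_ : Ordinal jlt = 0) //; apply: val_inj.
by rewrite (_ : Ordinal jlt = 1) //; apply: val_inj.
Qed.

Lemma det2_dep y z : y != 0 -> det2 y z = 0 -> exists c, z = c *: y.
Proof.
rewrite /det2 => y0 /eqP; rewrite subr_eq0 => /eqP e.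
have [y00|y00] := eqVneq (y 0 0) 0.
  have y01 : y 0 1 != 0.
    by apply: contraNneq y0 => y01; apply/eqP/row2P; rewrite mxE.
  exists (z 0 1 / y 0 1); apply: row2P; rewrite mxE; last by rewrite divfK.
  rewrite y00 mulr0; apply: (mulfI y01); rewrite mulr0 -e y00 mul0r //.
exists (z 0 0 / y 0 0); apply: row2P; rewrite mxE; first by rewrite divfK.
by apply: (mulfI y00); rewrite e; field.
Qed.

Section Pencil.
Variable E : 'M[F]_(h, 2).
Hypothesis Efree : forall w : 'cV[F]_2, w != 0 -> E *m w != 0.
Hypothesis cover : forall i, v i *m E != 0 -> exists2 c, c != 0 & Fs_row s ((c *: v i) *m E).
Local Notation normalized := (normalized s v E).

Lemma exists_det2 y : y != 0 -> exists w, normalized w /\ det2 y (w *m E) != 0.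
Proof.
move=> y0; pose w : 'cV[F]_2 := \col_j (if j == 0 then - y 0 1 else y 0 0).
have w0 : w != 0.
  apply: contraNneq y0 => e; have h0 : w 0 0 = 0 by rewrite e mxE.
  have h1 : w 1 0 = 0 by rewrite e mxE.
  apply/eqP/row2P; rewrite [RHS]mxE; first by rewrite -h1 mxE.
  by apply/eqP; rewrite -oppr_eq0 -h0 mxE.
have [i iw] := cf_span C (Efree w0).
have dE x : det2 y (x *m E) = (x *m (E *m w)) 0 0.
  rewrite mulmxA; move: (x *m E) => t; rewrite [RHS]mxE !big_ord_recl big_ord0 addr0 !mxE /=.
  by rewrite (_ : lift 0 0 = 1) /det2; [ring | apply: val_inj].
have di : det2 y (v i *m E) != 0.
  by apply: contraNneq iw => e; apply/eqP/matrixP => a c; rewrite !ord1 [RHS]mxE -dE.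
have viE : v i *m E != 0.
  by apply: contraNneq di => ->; rewrite /det2 !mxE; apply/eqP; ring.
have [c c0 cF] := cover viE; exists (c *: v i); split.
  by rewrite /normalized (onBZ C) // (onB_v C).
by rewrite dE -scalemxAl mxE mulf_neq0 // -dE.
Qed.

(** On the line through [u] and [w], the ratio [al / be] of the coordinates lies in [Fs] by [cover].
    It is injective on the points other than that of [u], of which there are at least [s], so it
    takes every value in [Fs], in particular 1. *)
Lemma sum_indep u w : normalized u -> normalized w -> det2 (u *m E) (w *m E) != 0 -> normalized (u + w).
Proof.
set y := u *m E; set z := w *m E => uW wW D0.
have /andP [/(onBP C) [i [ci [ci0 uE]]] yF] := uW.
have /andP [/(onBP C) [j [cj [cj0 wE]]] zF] := wW.
have coordF (x : 'rV[F]_2) a : Fs_row s x -> x 0 a \in Fs by case/andP => _ /forallP.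
have det2F x x' : Fs_row s x -> Fs_row s x' -> det2 x x' \in Fs.
  by move=> hx hx'; rewrite (FsD sF) // ?(FsN sF) // (FsM (coordF _ _ _)) // coordF.
have ij : i != j.
  apply: contraNneq D0 => e; rewrite /y /z uE wE e -!scalemxAl /det2 !mxE.
  by apply/eqP; ring.
have Luw l : l \in L i j -> exists al be, v l = al *: u + be *: w.
  rewrite inE => /row_addsP [a [c ->]]; exists (a * ci^-1), (c * cj^-1).
  by rewrite uE wE !scalerA !mulfVK.
pose g l := det2 (v l *m E) z / det2 y (v l *m E).
have gE l al be : v l = al *: u + be *: w -> be != 0 -> g l = al / be.
  move=> e be0; rewrite /g e !mulmxDl -!scalemxAl -/y -/z.
  have -> : det2 (al *: y + be *: z) z = al * det2 y z by rewrite /det2 !mxE; ring.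
  have -> : det2 y (al *: y + be *: z) = be * det2 y z by rewrite /det2 !mxE; ring.
  by rewrite -mulf_div divff // mulr1.
have Li l : l \in L i j :\ i -> exists al be, v l = al *: u + be *: w /\ be != 0.
  rewrite in_setD1 => /andP [li /Luw [al [be e]]]; exists al, be; split=> //.
  apply: contraNneq li => b0; apply/eqP/v_inj.
  by rewrite e b0 scale0r addr0 uE scalerA scalemx_sub.
have ginj : {in L i j :\ i &, injective g}.
  move=> l m /Li [al [be [el b0]]] /Li [al' [be' [em b0']]].
  rewrite (gE _ _ _ el b0) (gE _ _ _ em b0') => e; apply: v_inj.
  have -> : v l = (be / be') *: v m.
    rewrite el em scalerDr !scalerA divfK //; congr (_ *: _ + _).
    by rewrite mulrAC -mulrA -e mulrC divfK.
  exact: scalemx_sub.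
have gF l : l \in L i j :\ i -> g l \in Fs.
  move=> /Li [al [be [el b0]]]; rewrite (gE _ _ _ el b0).
  have vlE : v l *m E = al *: y + be *: z by rewrite el mulmxDl -!scalemxAl.
  have nz : v l *m E != 0.
    apply: contraNneq D0 => e; have : be * det2 y z = 0.
      have -> : be * det2 y z = det2 y (v l *m E) by rewrite vlE /det2 !mxE; ring.
      by rewrite e /det2 !mxE; ring.
    by move/eqP; rewrite mulf_eq0 (negPf b0).
  have [c c0 cF] := cover nz; rewrite -scalemxAl vlE in cF.
  have caF : c * al * det2 y z \in Fs.
    have -> : c * al * det2 y z = det2 (c *: (al *: y + be *: z)) z by rewrite /det2 !mxE; ring.
    exact: det2F.
  have cbF : c * be * det2 y z \in Fs.
    have -> : c * be * det2 y z = det2 y (c *: (al *: y + be *: z)) by rewrite /det2 !mxE; ring.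
    exact: det2F.
  have -> : al / be = (c * al * det2 y z) * (c * be * det2 y z)^-1 by field; rewrite ?b0 ?c0 ?D0.
  by rewrite (FsM caF) // FsV.
have : 1 \in g @: (L i j :\ i).
  suff -> : g @: (L i j :\ i) = Fs by exact: Fs1.
  apply/eqP; rewrite eqEcard; apply/andP; split.
    by apply/subsetP => _ /imsetP [l lL ->]; apply: gF.
  rewrite (cardFs C) card_in_imset //.
  have := cardsD1 i (L i j); rewrite line_pts_l (card_line C ij).
  by have := line_weight_gt0 C ij; move: s1; nia.
case/imsetP => l lL; have [al [be [el b0]]] := Li l lL.
rewrite (gE _ _ _ el b0) => e.
have ab : al = be by rewrite -[RHS]mul1r e divfK.
rewrite /normalized -(onBZE C _ b0) scalerDr -{1}ab -el (onB_v C) /=.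
have coord a : ((u + w) *m E) 0 a = y 0 a + z 0 a by rewrite mulmxDl mxE.
apply/andP; split; last by apply/forallP => a; rewrite coord (FsD sF) // coordF.
apply: contraNneq D0 => e0; have zy : z = - y.
  by apply/eqP; rewrite -addr_eq0 addrC -mulmxDl e0.
by rewrite zy /det2 !mxE; apply/eqP; ring.
Qed.

(** For dependent images write the sum as [(u + x) + (w - x)], with [x] of independent image; all
    three additions then fall under [sum_indep]. *)
Lemma sum_closed2 u w : normalized u -> normalized w -> (u + w) *m E != 0 -> normalized (u + w).
Proof.
move=> uW wW nz; set y := u *m E; set z := w *m E.
have [D|] := eqVneq (det2 y z) 0; last exact: sum_indep.
have y0 : y != 0 by case/andP: uW => _ /andP [].
have [c zE] := det2_dep y0 D.
have [x [xW Dx]] := exists_det2 y0.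
have c1 : 1 + c != 0.
  apply: contraNneq nz => e; rewrite mulmxDl -/y -/z zE -{1}[y]scale1r -scalerDl e.
  by rewrite scale0r.
have c0 : c != 0.
  have : z != 0 by case/andP: wW => _ /andP [].
  by apply: contraNneq => e; rewrite zE e scale0r.
have -> : u + w = (u + x) + (w - x) by rewrite addrACA subrr addr0.
have xN := normalizedN C xW.
apply: sum_indep; first exact: sum_indep.
  apply: sum_indep => //; rewrite mulNmx -/z zE.
  have -> : det2 (c *: y) (- (x *m E)) = - (c * det2 y (x *m E)) by rewrite /det2 !mxE; ring.
  by rewrite oppr_eq0 mulf_neq0.
rewrite !mulmxDl mulNmx -/y -/z zE.
have -> : det2 (y + x *m E) (c *: y - x *m E) = - ((1 + c) * det2 y (x *m E)).
  by rewrite /det2 !mxE; ring.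
by rewrite oppr_eq0 mulf_neq0.
Qed.

Lemma pencil_linear : linear_config s v.
Proof.
apply: (core_linear C cover sum_closed2).
have y0 : (\row_(j < 2) 1 : 'rV[F]_2) != 0.
  by apply/eqP => /rowP /(_ 0) /eqP; rewrite !mxE oner_eq0.
have [w [/andP [/(onBP C) [i [c [c0 wE]]] /andP [nz _]] _]] := exists_det2 y0.
by exists i; apply: contraNneq nz => e; rewrite wE -scalemxAl e scaler0.
Qed.

End Pencil.

Section Star.
Variables a1 a2 : 'cV[F]_h.
Hypothesis ind : forall y z, y *: a1 + z *: a2 = 0 -> y = 0 /\ z = 0.
Hypothesis zsub : zr a1 \subset zr a2.
Local Notation xi := (slope v a1 a2).
Variables a b c : F.
Hypothesis roots : forall k, k \notin zr a1 -> xi k ^+ s * (xi k + a) + (b * xi k + c) = 0.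

Lemma ev_xi x k : k \notin zr a1 -> ev (a2 + x *: a1) k = ev a1 k * (x - xi k).
Proof.
by rewrite zrE evD evZ => ka; rewrite /slope; field.
Qed.

Lemma skew_xi i j : i \notin zr a1 -> j \notin zr a1 -> xi i != xi j ->
  forall y z, ev (y *: a1 + z *: a2) i = 0 -> ev (y *: a1 + z *: a2) j = 0 -> y = 0 /\ z = 0.
Proof.
move=> ia ja xij y z; rewrite !evD !evZ.
have e2 k : k \notin zr a1 -> ev a2 k = - (xi k * ev a1 k).
  by rewrite zrE /slope => ka; field.
rewrite !e2 //; rewrite !zrE in ia ja => hi hj.
have yi : y = z * xi i.
  by apply/eqP; rewrite -subr_eq0; apply/eqP; apply: (mulIf ia); rewrite mul0r -hi; ring.
have yj : y = z * xi j.
  by apply/eqP; rewrite -subr_eq0; apply/eqP; apply: (mulIf ja); rewrite mul0r -hj; ring.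
have /eqP : z * (xi i - xi j) = 0 by rewrite mulrBr -yi -yj subrr.
rewrite mulf_eq0 subr_eq0 (negPf xij) orbF => /eqP z0.
by rewrite yi z0 mul0r.
Qed.

Lemma line_off_axis i j : i \notin zr a1 -> j \notin zr a1 -> xi i != xi j ->
  forall k, k \in L i j -> ev a1 k != 0.
Proof.
move=> ia ja xij k; rewrite inE => /row_addsP [al [be ke]]; apply/negP => ka.
have /eqP k1 : k \in zr a1 by rewrite zrE.
have k2 : ev a2 k = 0 by apply/eqP; rewrite -zrE (subsetP zsub) // zrE.
have evk (a' : 'cV_h) : ev a' k = al * ev a' i + be * ev a' j.
  by rewrite /fval ke mulmxDl -!scalemxAl !mxE.
have e2 l : l \notin zr a1 -> ev a2 l = - (xi l * ev a1 l).
  by rewrite zrE /slope => la; field.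
move/eqP: ka; rewrite evk => h1; move: k2; rewrite evk !e2 // => h2.
rewrite !zrE in ia ja.
have /eqP : be * ev a1 j * (xi i - xi j) = 0.
  by rewrite -[RHS]h2 -[RHS]addr0 -(mulr0 (xi i)) -h1; ring.
rewrite mulf_eq0 subr_eq0 (negPf xij) orbF mulf_eq0 (negPf ja) orbF => /eqP b0.
move/eqP: h1; rewrite b0 mul0r addr0 mulf_eq0 (negPf ia) orbF => /eqP a0.
by have := v0 k; rewrite ke a0 b0 !scale0r addr0 eqxx.
Qed.

(** Coordinates on the pencil are chosen so that the ratio of the two entries of [v i *m E] is a
    cross-ratio of the slope of [i] with three fixed slopes, hence in [Fs]. *)
Lemma star_linear : linear_config s v.
Proof.
have a1n0 : a1 != 0.
  apply/eqP => e; have [] := ind (_ : 1 *: a1 + 0 *: a2 = 0); first by rewrite e scaler0 scale0r addr0.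
  by move/eqP; rewrite oner_eq0.
have a2n0 x : a2 + x *: a1 != 0.
  apply/eqP => e; have [] := ind (_ : x *: a1 + 1 *: a2 = 0); first by rewrite scale1r addrC.
  by move=> _ /eqP; rewrite oner_eq0.
have zrn (a' : 'cV_h) k : v k *m a' != 0 -> k \notin zr a' by rewrite inE.
have [k /zrn kz] := cf_span C a1n0.
have [l /zrn lz'] := cf_span C (a2n0 (xi k)).
have lz : l \notin zr a1.
  apply: contra lz' => la; have := subsetP zsub _ la; move: la; rewrite !zrE evD evZ.
  by move=> /eqP -> /eqP ->; rewrite mulr0 addr0.
have xkl : xi k != xi l.
  apply: contraNneq lz' => e; rewrite zrE ev_xi // e subrr mulr0 //.
have kl : k != l by apply: contraNneq xkl => ->.
have skew := skew_xi kz lz xkl; have offL := line_off_axis kz lz xkl.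
have xinj := xi_inj_line C kl skew offL.
have [m [mL mk ml]] : exists m, [/\ m \in L k l, m != k & m != l].
  have : (0 < #|L k l :\ k :\ l|)%N.
    have := cardsD1 k (L k l); have := cardsD1 l (L k l :\ k).
    rewrite in_setD1 eq_sym kl line_pts_l line_pts_r (card_line C kl) /=.
    by have := line_weight_gt0 C kl; move: s7; nia.
  by move/card_gt0P => [m]; rewrite !in_setD1 => /and3P [ml mk mL]; exists m.
have mz : m \notin zr a1 by rewrite zrE offL.
have xkm : xi k != xi m by apply: contra mk => /eqP/xinj -> //; exact: line_pts_l.
have xlm : xi l != xi m by apply: contra ml => /eqP/xinj -> //; exact: line_pts_r.
(* These weights give the point [m] equal coordinates. *)
pose al := xi l - xi m; pose be := xi k - xi m.
have al0 : al != 0 by rewrite subr_eq0.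
have be0 : be != 0 by rewrite subr_eq0.
pose e0 := al *: (a2 + xi k *: a1); pose e1 := be *: (a2 + xi l *: a1).
pose E : 'M[F]_(h, 2) := \matrix_(i, j) (if j == 0 then e0 i 0 else e1 i 0).
have E0 i : (v i *m E) 0 0 = ev e0 i.
  by rewrite /fval !mxE; apply: eq_bigr => t _; rewrite [E _ _]mxE.
have E1 i : (v i *m E) 0 1 = ev e1 i.
  by rewrite /fval !mxE; apply: eq_bigr => t _; rewrite [E _ _]mxE.
apply: (@pencil_linear E) => [w w0|i iE].
  have -> : E *m w = w 0 0 *: e0 + w 1 0 *: e1.
    apply/matrixP => i j; rewrite ord1 !mxE !big_ord_recl big_ord0 addr0 !mxE /=.
    by rewrite (_ : lift 0 0 = 1) 1?mulrC; [rewrite [_ * w 1 0]mulrC | apply: val_inj].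
  apply/eqP => e.
  have [] := ind (_ : (w 0 0 * al * xi k + w 1 0 * be * xi l) *: a1 + (w 0 0 * al + w 1 0 * be) *: a2 = 0).
    by rewrite -[RHS]e /e0 /e1; apply/matrixP => r t; rewrite !mxE; ring.
  move=> h1 h2; have /eqP : w 0 0 * al * (xi k - xi l) = 0.
    by rewrite -[RHS]h1 -[RHS]subr0 -(mul0r (xi l)) -h2; ring.
  have kl0 : xi k - xi l != 0 by rewrite subr_eq0.
  rewrite !mulf_eq0 (negPf kl0) (negPf al0) !orbF => /eqP w00.
  move/eqP: h2; rewrite w00 mul0r add0r mulf_eq0 (negPf be0) orbF => /eqP w10.
  case/negP: w0; apply/eqP/colP => t; rewrite mxE.
  by case: t => [[|[|]]] // tlt; [rewrite -[RHS]w00 | rewrite -[RHS]w10]; congr (w _ _); apply: val_inj.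
have iz : i \notin zr a1.
  apply: contra iE => ia; have := subsetP zsub _ ia; move: ia; rewrite !zrE => /eqP ha1 /eqP ha2.
  by apply/eqP/row2P; rewrite ?E0 ?E1 [RHS]mxE /e0 /e1 evZ evD evZ ha1 ha2; ring.
have iz' := iz; rewrite zrE in iz'.
have E0' : (v i *m E) 0 0 = al * (ev a1 i * (xi k - xi i)) by rewrite E0 evZ ev_xi.
have E1' : (v i *m E) 0 1 = be * (ev a1 i * (xi l - xi i)) by rewrite E1 evZ ev_xi.
have mkF c' : c' != 0 -> (c' *: v i *m E) 0 0 \in Fs -> (c' *: v i *m E) 0 1 \in Fs -> Fs_row s (c' *: v i *m E).
  move=> c0 h0 h1; rewrite /Fs_row -scalemxAl scaler_eq0 negb_or c0 iE /= scalemxAl.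
  by apply/forallP => t; case: t => [[|[|]]] // tlt;
    [rewrite (_ : Ordinal tlt = 0) // | rewrite (_ : Ordinal tlt = 1) //]; apply: val_inj.
have sc c' t : (c' *: v i *m E) 0 t = c' * (v i *m E) 0 t by rewrite -scalemxAl mxE.
have [xil|xil] := eqVneq (xi i) (xi l).
  have nz : (v i *m E) 0 0 != 0 by rewrite E0' !mulf_neq0 // subr_eq0 xil.
  exists ((v i *m E) 0 0)^-1; first by rewrite invr_eq0.
  apply: mkF; rewrite ?invr_eq0 // sc.
    by rewrite mulVf // Fs1.
  by rewrite E1' xil subrr !mulr0 (Fs0 F s1).
have nz : (v i *m E) 0 1 != 0 by rewrite E1' !mulf_neq0 // subr_eq0 eq_sym.
exists ((v i *m E) 0 1)^-1; first by rewrite invr_eq0.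
apply: mkF; rewrite ?invr_eq0 // sc; last by rewrite mulVf // Fs1.
apply/FsP; apply: (@cross_ratio_fixed F s a b c _ (xi l) (xi k) (xi i) (xi m) sF).
- by move=> x; rewrite !inE => /or4P [] /eqP ->; apply: roots.
- by rewrite /= !inE !negb_or eq_sym xkl xlm xkm.
- exact: xil.
rewrite E0' E1' /al /be; field.
by rewrite !subr_eq0 xkm iz' eq_sym xil.
Qed.

End Star.
End Star.

Section SplitFactor.
Variable F : fieldType.
Implicit Types (f g : {poly F}) (rs : seq F).

Lemma split_poly_factor f rs : f %| split_poly rs ->
  exists c r, c != 0 /\ f = c *: split_poly r.
Proof.
move=> /dvdp_prod_XsubC [m em]; exists (lead_coef f), (mask m rs); split.
  rewrite lead_coef_eq0; apply: contraTneq em => ->.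
  rewrite eqp_sym eqp0; apply: monic_neq0; exact: monic_prod_XsubC.
have /eqpP [[a c] /= /andP [a0 c0] e] := em.
have fE : f = (a^-1 * c) *: split_poly (mask m rs).
  by rewrite -scalerA -e scalerA mulVf // scale1r.
rewrite {1}fE fE lead_coefZ (monicP (monic_prod_XsubC _ _ _)) mulr1 //.
Qed.

Lemma size_split_poly (rs : seq F) : size (split_poly rs) = (size rs).+1.
Proof. exact: size_prod_XsubC. Qed.

Lemma split_poly_cat (r1 r2 : seq F) : split_poly (r1 ++ r2) = split_poly r1 * split_poly r2.
Proof. exact: big_cat. Qed.

Lemma split_poly_exp (r : seq F) n : split_poly r ^+ n = split_poly (flatten (nseq n r)).
Proof.
elim: n => [|n IH]; first by rewrite expr0 /split_poly big_nil.
by rewrite exprS IH /= split_poly_cat.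
Qed.

Lemma count_split_eq (rs r1 r2 : seq F) n c : c *: split_poly rs = split_poly r1 * split_poly r2 ^+ n ->
  forall x, count_mem x rs = (count_mem x r1 + n * count_mem x r2)%N.
Proof.
rewrite split_poly_exp -split_poly_cat => e.
have c1 : c = 1.
  have := congr1 lead_coef e; rewrite lead_coefZ !(monicP (monic_prod_XsubC _ _ _)) mulr1.
  by [].
move: e; rewrite c1 scale1r => /prod_XsubC_eq /permP e x; rewrite e count_cat; congr (_ + _)%N.
by elim: n {e} => // n IH; rewrite /= count_cat IH mulSn.
Qed.
End SplitFactor.

Section Decomposition.
Variables (F : finFieldType) (p : nat).
Hypothesis pF : p \in [pchar F].
Let p_pr : prime p := pcharf_prime pF.

(** The polynomial is [c (X^Q f3 + g3)^P] with [P = p^j] and [Q = p^(m - j)]. As it splits, so do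
    both factors, with roots [rsc] and [rs3], and [distinct_roots_lb] applies to the second. *)
Lemma decomposition_seq m delta (f g : {poly F}) rs :
  split_poly rs = 'X^(p ^ m) * f + g -> size f = delta.+1 -> (size g <= delta.+1)%N ->
  (delta < p ^ m)%N -> (forall x, (count_mem x rs < p ^ m)%N) ->
  exists j (f3 g3 : {poly F}) d3 rsc rs3 k,
   [/\ (j < m)%N, (forall x, count_mem x rs = count_mem x rsc + p ^ j * count_mem x rs3)%N &
       (size rsc + p ^ j * d3 = delta)%N] /\
   [/\ 'X^(p ^ (m - j)) * f3 + g3 = k *: split_poly rs3, k != 0 &
       (p ^ (m - j) + 1 <= size (undup rs3) + d3)%N] /\
   [/\ wronskian f3 g3 != 0, size f3 = d3.+1, (size g3 <= d3.+1)%N & (0 < d3)%N].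
Proof.
move=> PE szf szg dm rsm.
have f0 : f != 0 by rewrite -size_poly_eq0 szf.
have gf : (size g <= size f)%N by rewrite szf.
have fm : (size f <= p ^ m)%N by rewrite szf.
have p0 := prime_gt0 p_pr; have p1 := prime_gt1 p_pr.
have [j [c [f3 [g3 [jm fE gE cop W0]]]]] := split_decomposition pF PE f0 gf fm rsm.
have c0 : c != 0 by apply: contraNneq f0 => e; rewrite fE e mul0r.
have f30 : f3 != 0.
  by apply: contraNneq W0 => ->; rewrite /wronskian deriv0 !mul0r subrr.
have pj0 : (0 < p ^ j)%N by rewrite expn_gt0 p0.
set P := (p ^ j)%N in pj0 *; set Q := (p ^ (m - j))%N.
have QP : (Q * P = p ^ m)%N by rewrite -expnD subnK // ltnW.
have Q0 : (0 < Q)%N by rewrite expn_gt0 p0.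
pose F3 := 'X^Q * f3 + g3.
have PF : split_poly rs = c * F3 ^+ P.
  rewrite PE fE gE -/P (exprDn_pchar _ _ (pnat_pchar_poly (pnat_pcharX pF j))) exprMn.
  by rewrite -exprM QP mulrDr mulrCA.
have [kc [rsc [kc0 cE]]] : exists kc r, kc != 0 /\ c = kc *: split_poly r.
  by apply: (@split_poly_factor _ _ rs); rewrite PF dvdp_mulr.
have [k [rs3 [k0 F3E]]] : exists k r, k != 0 /\ F3 = k *: split_poly r.
  by apply: (@split_poly_factor _ _ rs); rewrite PF dvdp_mull // -(prednK pj0) exprS dvdp_mulr.
have cnt x : (count_mem x rs = count_mem x rsc + P * count_mem x rs3)%N.
  apply: (@count_split_eq _ _ _ _ _ (kc * k ^+ P)^-1).
  rewrite PF cE F3E exprZn -scalerAl -scalerAr !scalerA -mulrA mulVf ?scale1r //.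
  by rewrite mulf_neq0 // expf_neq0.
have sE (h : {poly F}) : ((size (h ^+ P)%R).-1 = (size h).-1 * P)%N by rewrite size_exp.
have szc : size c = (size rsc).+1 by rewrite cE size_scale // size_split_poly.
have sf3 : (0 < size f3)%N by rewrite size_poly_gt0.
have szf3P : (size (f3 ^+ P)%R = ((size f3).-1 * P).+1)%N.
  by rewrite -sE prednK // size_poly_gt0 expf_neq0.
have sizeE : (size rsc + P * (size f3).-1 = delta)%N.
  have : (size f + 1 = size c + size (f3 ^+ P)%R)%N by rewrite fE size_mulD1 // expf_neq0.
  by rewrite szf szc szf3P mulnC; clear; lia.
have g3f3 : (size g3 <= size f3)%N.
  have [->|g30] := eqVneq g3 0; first by rewrite size_poly0.
  have szg3P : (size (g3 ^+ P)%R = ((size g3).-1 * P).+1)%N.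
    by rewrite -sE prednK // size_poly_gt0 expf_neq0.
  have : (size g + 1 = size c + size (g3 ^+ P)%R)%N by rewrite gE size_mulD1 // expf_neq0.
  rewrite szg3P => e; have : ((size g3).-1 * P <= (size f3).-1 * P)%N.
    by rewrite szc in e; move: e szg sizeE; rewrite [(P * _)%N]mulnC; clear; lia.
  rewrite leq_pmul2r //; have : (0 < size g3)%N by rewrite size_poly_gt0.
  by move: sf3; clear; lia.
have pQ : (p %| Q)%N by rewrite /Q dvdn_exp // subn_gt0.
have [d3 d3E] : exists d3, size f3 = d3.+1 by exists (size f3).-1; rewrite prednK.
have lb : (Q + 2 <= size (undup rs3) + size f3)%N.
  exact: distinct_roots_lb pF pQ k0 (esym F3E) Q0 g3f3 W0.
rewrite d3E in lb g3f3 sizeE.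
exists j, f3, g3, d3, rsc, rs3, k; split; last split.
- by [].
- by split; [exact: F3E | exact: k0 | rewrite -/Q; move: lb; clear; lia].
split=> //.
rewrite lt0n; apply: contraNneq W0 => s1; rewrite s1 in d3E g3f3.
have e1 : f3^`() = 0 by rewrite [f3]size1_polyC ?d3E // derivC.
have e2 : g3^`() = 0 by rewrite [g3]size1_polyC // derivC.
by rewrite /wronskian e1 e2 mulr0 mul0r subrr.
Qed.

End Decomposition.

Section Hom.
Variable F : fieldType.
Implicit Types (f A B : {poly F}).

(* B^d f(A/B) *)
Definition hom d f A B : {poly F} := \sum_(k < d.+1) f`_k *: (A ^+ k * B ^+ (d - k)).

Lemma horner_hom d f A B x T : (size f <= d.+1)%N -> A.[T] = x * B.[T] ->
  (hom d f A B).[T] = B.[T] ^+ d * f.[x].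
Proof.
move=> sf e; rewrite /hom horner_sum (horner_coef_wide _ sf) big_distrr /=.
apply: eq_bigr => k _; rewrite hornerZ hornerM !horner_exp e exprMn.
have kd : (k <= d)%N by rewrite -ltnS.
have -> : B.[T] ^+ d = B.[T] ^+ k * B.[T] ^+ (d - k) by rewrite -exprD subnKC.
by move: (B.[T] ^+ k) (B.[T] ^+ _) (x ^+ k) f`_k => b1 b2 xk fk; ring.
Qed.

Lemma size_hom d f A B w : (size A <= w.+1)%N -> (size B <= w.+1)%N ->
  (size (hom d f A B) <= (w * d).+1)%N.
Proof.
move=> sA sB; apply: (big_ind (fun P : {poly F} => (size P <= (w * d).+1)%N)).
- by rewrite size_poly0.
- by move=> P Q; exact: leq_size_add.
have ex (P : {poly F}) n : (size P <= w.+1)%N -> (size (P ^+ n)%R <= (w * n).+1)%N.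
  move=> sP; elim: n => [|n IH]; first by rewrite expr0 size_poly1.
  by rewrite exprS; apply: leq_trans (leq_size_mul sP IH) _; rewrite mulnS; lia.
move=> k _; apply: leq_trans (size_scale_leq _ _) _.
apply: leq_trans (leq_size_mul (ex _ _ sA) (ex _ _ sB)) _.
have kd : (k <= d)%N by rewrite -ltnS.
have : (w * k + w * (d - k) = w * d)%N by rewrite -mulnDr subnKC.
lia.
Qed.

Lemma deriv_hom_term A B c k n :
  B * (c *: (A ^+ k.+1 * B ^+ n)^`()) =
  (A^`() * B - A * B^`()) * ((c *+ k.+1) *: (A ^+ k * B ^+ n)) +
  (k + n).+1%:R * (B^`() * (c *: (A ^+ k.+1 * B ^+ n))).
Proof.
rewrite derivM !deriv_exp -!mul_polyC polyCMn -addSn natrD /=.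
rewrite -(mulr_natr c%:P) -(mulr_natr (A^`() * _)) -(mulr_natr (B^`() * _)) !exprS.
move: (k.+1%:R : {poly F}) => k1; case: n => [|n] /=; first by rewrite expr0; ring.
by rewrite exprS; move: (n.+1%:R : {poly F}) => n1; ring.
Qed.

(** Chain and product rule for [B^d f(A/B)], multiplied by [B] to clear the denominator. *)
Lemma deriv_hom d f A B : (0 < d)%N ->
  B * (hom d f A B)^`() =
  (A^`() * B - A * B^`()) * hom d.-1 f^`() A B + d%:R * (B^`() * hom d f A B).
Proof.
case: d => // d _ /=; rewrite /hom.
have -> : (\sum_(k < d.+2) f`_k *: (A ^+ k * B ^+ (d.+1 - k)))^`() =
   \sum_(k < d.+2) f`_k *: (A ^+ k * B ^+ (d.+1 - k))^`().
  by rewrite raddf_sum /=; apply: eq_bigr => k _; rewrite derivZ.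
rewrite big_ord_recl [X in _ = _ + _ * (_ * X)]big_ord_recl !mulrDr !mulr_sumr addrCA -big_split /=.
congr (_ + _).
  rewrite !expr0 !mul1r !subn0 -!scalerAr; congr (_ *: _); rewrite deriv_exp /= exprS.
  by rewrite -mulr_natr; ring.
apply: eq_bigr => k _; rewrite /bump /= add1n subSS coef_deriv.
have kd : (k <= d)%N by rewrite -ltnS.
rewrite -[in d.+1%:R](subnKC kd); exact: deriv_hom_term.
Qed.
End Hom.

(** * Skew lines and lacunary polynomials *)

Section LineCoprime.
Variables (F : finFieldType) (I : finType) (h p s : nat) (v : I -> 'rV[F]_h).
Hypothesis C : config p s v.
Local Notation L := (line_pts v).
Local Notation ev := (fval v).
Variables (a1 a2 : 'cV[F]_h) (i j : I).
Hypothesis ij : i != j.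
Hypothesis skew : forall y z, ev (y *: a1 + z *: a2) i = 0 ->
  ev (y *: a1 + z *: a2) j = 0 -> y = 0 /\ z = 0.
Hypothesis a1L : forall k, k \in L i j -> ev a1 k != 0.
Local Notation xi := (slope v a1 a2).
Local Notation lp := (line_poly v a1 a2 i j).

Let line_roots := [seq xi k | k <- enum (L i j)].

Let line_polyE : lp = split_poly line_roots.
Proof. by rewrite /split_poly big_map big_enum. Qed.

Let line_roots_uniq : uniq line_roots.
Proof.
rewrite map_inj_in_uniq ?enum_uniq // => k l; rewrite !mem_enum.
exact: (xi_inj_line C ij skew a1L).
Qed.

(** For a common factor [D], the polynomial [D(X^s)] is an [s]-th power because [F] is perfect, and
    it divides the line polynomial, whose roots are distinct. *)
Lemma line_coprime E1 E2 : lp = 'X * (E1 \Po 'X^s) + (E2 \Po 'X^s) ->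
  E1 \is monic -> coprimep E1 E2.
Proof.
move=> lpE mE; rewrite /coprimep; set D := gcdp E1 E2.
have D0 : D != 0 by rewrite gcdp_eq0 negb_and monic_neq0.
have [e e0 sE] := cf_s C; have s7 := cf_s7 C.
have sF := pchar_nat_s C.
have [rt rtK'] : exists rt : F -> F, forall x, rt x ^+ (p ^ e) = x.
  exists (invF (@frob_inj F p (cf_p C) e)) => x.
  exact: (f_invF (@frob_inj F p (cf_p C) e) x).
have rtK x : rt x ^+ s = x by rewrite sE.
have s0 : (0 < s)%N by lia.
pose D' := \poly_(k < size D) rt D`_k.
have rt0 : rt 0 = 0 by apply/eqP; have /eqP := rtK 0; rewrite expf_eq0 s0.
have cD' k : D'`_k = rt D`_k.
  by rewrite coef_poly; case: ltnP => // hk; rewrite [D`_k]coef_geq // rt0.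
have fD : frobp s D' = D by apply/polyP => k; rewrite (coef_frobp sF) cD' rtK.
have DE : D \Po 'X^s = D' ^+ s by rewrite -[in LHS]fD; exact: esym (exp_frobp sF D').
have dv : D' ^+ s %| split_poly line_roots.
  rewrite -line_polyE lpE -DE dvdp_add //.
    by rewrite dvdp_mull // dvdp_comp_poly // dvdp_gcdl.
  by rewrite dvdp_comp_poly // dvdp_gcdr.
have szD : size D' = size D.
  rewrite size_poly_eq //; have : lead_coef D != 0 by rewrite lead_coef_eq0.
  apply: contraNneq => e'; rewrite lead_coefE.
  by rewrite -(rtK D`_(size D).-1) e' expr0n gtn_eqF.
have [c [r [c0 D'E]]] : exists c r, c != 0 /\ D' = c *: split_poly r.
  apply: (@split_poly_factor _ _ line_roots); apply: dvdp_trans dv.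
  by rewrite -(prednK s0) exprS dvdp_mulr.
case: r D'E => [|x r] D'E.
  by rewrite -szD D'E /split_poly big_nil size_scale // size_poly1.
have lp0 : split_poly line_roots != 0 by apply: monic_neq0; exact: monic_prod_XsubC.
have : (2 <= mup x (split_poly line_roots))%N.
  rewrite mup_geq //; apply: dvdp_trans dv; apply: dvdp_trans (dvdp_exp2l _ (_ : 2 <= s)%N); last by lia.
  by apply: dvdp_exp2r; rewrite D'E dvdpZr // /split_poly big_cons dvdp_mulr.
by rewrite mu_prod_XsubC count_uniq_mem //; case: (_ \in _).
Qed.

Lemma line_root E1 E2 k : lp = 'X * (E1 \Po 'X^s) + (E2 \Po 'X^s) -> k \in L i j ->
  (- E2).[xi k ^+ s] = xi k * E1.[xi k ^+ s].
Proof.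
move=> lpE kL; have : lp.[xi k] = 0.
  by rewrite /line_poly horner_prod (bigD1 k) //= hornerXsubC subrr mul0r.
rewrite lpE hornerD hornerM hornerX !horner_comp hornerXn => /eqP.
by rewrite addr_eq0 => /eqP e; rewrite hornerN e.
Qed.

End LineCoprime.

Section StarTheorem.
Variables (F : finFieldType) (I : finType) (h p s : nat) (v : I -> 'rV[F]_h).
Hypothesis C : config p s v.
Local Notation q := #|F|.
Local Notation b := #|I|.
Local Notation L := (line_pts v).
Local Notation zr := (zeros v).
Local Notation ev := (fval v).

Let s7 := cf_s7 C.
Let h3 := cf_h C.
Let sF := pchar_nat_s C.

Lemma card_zr_lt_q a : a != 0 -> (#|zr a| < q)%N.
Proof.
move=> a0; have -> : zr a = pts v (kermx a).
  by apply/setP => i; rewrite !inE; apply/eqP/sub_kermxP.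
apply: (card_pts_lt_q C); rewrite mxrank_ker; have : (0 < \rank a)%N by rewrite lt0n mxrank_eq0.
by move: h3; lia.
Qed.

Lemma closed_zr a : closed_set v (zr a).
Proof.
have -> : zr a = pts v (kermx a).
  by apply/setP => i; rewrite !inE; apply/eqP/sub_kermxP.
exact: closed_pts.
Qed.

Variables a1 a2 : 'cV[F]_h.
Hypothesis ind : forall y z, y *: a1 + z *: a2 = 0 -> y = 0 /\ z = 0.
Hypothesis zsub : zr a1 \subset zr a2.
Variable i0 : I.
Hypothesis i0K : i0 \in zr a1.
Local Notation nK := #|zr a1|.
Local Notation xi := (slope v a1 a2).
Local Notation mu := (slope_mult s v a1 a2).
Local Notation hits := (slope_class v a1 a2).

Lemma pair_a1 : a1 != 0.
Proof.
apply/eqP => e; have [] := ind (_ : 1 *: a1 + 0 *: a2 = 0); first by rewrite e scaler0 scale0r addr0.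
by move/eqP; rewrite oner_eq0.
Qed.

Lemma pair_a2 x : a2 + x *: a1 != 0.
Proof.
apply/eqP => e; have [] := ind (_ : x *: a1 + 1 *: a2 = 0); first by rewrite scale1r addrC.
by move=> _ /eqP; rewrite oner_eq0.
Qed.

Let hm := hits_mu C pair_a2 pair_a1 zsub.
Let nKq : (nK < q)%N := card_zr_lt_q pair_a1.

Lemma mem_hits k : k \notin zr a1 -> k \in hits (xi k).
Proof. by move=> kz; rewrite inE kz eqxx. Qed.

Lemma mu_gt0 k : k \notin zr a1 -> (0 < mu (xi k))%N.
Proof.
move=> kz; have : (0 < #|hits (xi k)|)%N by apply/card_gt0P; exists k; apply: mem_hits.
by rewrite hm; case: mu.
Qed.

(** [growth] from the axis to the hyperplane of slope [x], less the points of the axis. *)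
Lemma mu_lb x : (0 < mu x)%N -> (1 + (s - 1) * nK <= s * mu x)%N.
Proof.
move=> mx; have /card_gt0P [k kH] : (0 < #|hits x|)%N.
  by rewrite hm muln_gt0 mx; move: s7; lia.
have kz : k \notin zr a1 by move: kH; rewrite inE => /andP [].
have sub : zr a1 \subset zr (a2 + x *: a1).
  apply/subsetP => l la; have := subsetP zsub _ la; move: la; rewrite !zrE evD evZ.
  by move=> /eqP -> /eqP ->; rewrite mulr0 addr0.
have kT : k \in zr (a2 + x *: a1) by rewrite -(hitsE _ _ kz).
have := growth C (@closed_zr a1) (@closed_zr (a2 + x *: a1)) sub kT kz.
rewrite (card_zr_hits zsub) hm mulnC mulnBl mul1n [(mu x * s)%N]mulnC.
have : (nK <= nK * s)%N by rewrite leq_pmulr //; move: s7; lia.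
lia.
Qed.

Lemma mu_ub x : (mu x < q %/ s)%N.
Proof.
have s0 : (0 < s)%N by move: s7; lia.
rewrite -(ltn_pmul2r s0) divnK ?(s_dvd_q C) // -hm.
have := card_zr_lt_q (pair_a2 x); rewrite (card_zr_hits zsub).
by apply: leq_ltn_trans; rewrite leq_addl.
Qed.

Lemma delta_eq delta : (b - nK = q + s * delta)%N -> (nK + s * delta = 1 + s * excess F I s)%N.
Proof. by have := card_points_eq C; have := nKq; lia. Qed.

(** Each of these slopes takes at least [(1 + (s - 1) nK) / s] of the at most [delta] roots of [c],
    counted with multiplicity. *)
Lemma few_c_only_roots (S : {set F}) rsc delta :
  (forall x, x \in S -> (0 < mu x)%N /\ mu x = count_mem x rsc) -> (size rsc <= delta)%N ->
  (#|S| * (1 + (s - 1) * nK) <= s * delta)%N.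
Proof.
move=> hS le; apply: leq_trans (_ : \sum_(x in S) s * mu x <= _)%N.
  by rewrite -sum_nat_const; apply: leq_sum => x /hS [m0 _]; exact: mu_lb.
rewrite -big_distrr leq_mul2l; apply/orP; right; apply: leq_trans le.
rewrite (eq_bigr (fun x => count_mem x rsc)); last by move=> x /hS [].
clear hS; elim: rsc => [|y r IH] /=; first by rewrite big1.
rewrite big_split /=; apply: (@leq_add _ _ 1%N) => //.
rewrite (eq_bigr (fun x => (y == x) : nat)) //.
case: (boolP (y \in S)) => yS.
  by rewrite (bigD1 y) //= eqxx big1 // => x /andP [_ /negPf]; rewrite eq_sym => ->.
by rewrite big1 // => x xS; case: eqP => // e; rewrite e xS in yS.
Qed.

Lemma codim2_decomposition : exists delta j (f3 g3 : {poly F}) d3 rsc rs3 k Q,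
   [/\ (b - nK = q + s * delta)%N, (Q * p ^ j = q %/ s)%N,
       (forall x, mu x = count_mem x rsc + p ^ j * count_mem x rs3)%N &
       (size rsc + p ^ j * d3 = delta)%N] /\
   [/\ 'X^Q * f3 + g3 = k *: split_poly rs3, k != 0 &
       (Q + 1 <= size (undup rs3) + d3)%N] /\
   [/\ wronskian f3 g3 != 0, size f3 = d3.+1, (size g3 <= d3.+1)%N & (0 < d3)%N].
Proof.
have [delta [f [g [NE PE mf szf szg]]]] := codim2_lacunary C pair_a2 pair_a1 zsub i0K nKq.
have [e e0 sE] := cf_s C.
have MqE : (q %/ s = p ^ (e * (h - 1)))%N.
  rewrite (cf_q C) sE -!expnM; have -> : (e * h = e + e * (h - 1))%N.
    by rewrite -mulnS; congr (_ * _)%N; move: h3; lia.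
  by rewrite expnD mulKn // expn_gt0 prime_gt0 // (pcharf_prime (cf_p C)).
(* [delta] is at most the excess, which is below [s^(h-3) (s + 2)], while [q / s = s^(h-3) s^2]. *)
have dlt : (delta < p ^ (e * (h - 1)))%N.
  have := delta_eq NE; have := excess_lt C; have : (0 < nK)%N by apply/card_gt0P; exists i0.
  rewrite -MqE => n0 dl de.
  have dd : (delta <= excess F I s)%N.
    by rewrite -(leq_pmul2l (_ : 0 < s)%N); move: s7 n0 de; lia.
  apply: leq_ltn_trans dd _; apply: leq_trans dl _.
  have -> : (q %/ s = s ^ (h - 3) * (s * s))%N.
    rewrite (card_field_eq C) !expnS expn0 muln1; have s0 : (0 < s)%N by move: s7; lia.
    by rewrite [(s * (s * s))%N]mulnA mulnA mulnK.
  by rewrite leq_mul2l; apply/orP; right; move: s7; nia.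
have rsm x : (count_mem x (mset_seq mu) < p ^ (e * (h - 1)))%N.
  by rewrite count_mset_seq -MqE mu_ub.
rewrite MqE in PE.
have [j [f3 [g3 [d3 [rsc [rs3 [k [[jm cnt szE] [[F3E k0 lb] W]]]]]]]]] :=
  decomposition_seq (cf_p C) PE szf szg dlt rsm.
exists delta, j, f3, g3, d3, rsc, rs3, k, (p ^ (e * (h - 1) - j))%N; split; last by split.
split=> //; first by rewrite MqE -expnD subnK // ltnW.
by move=> x; rewrite -cnt count_mset_seq.
Qed.

Lemma many_hyperplanes (rs3 : seq F) :
  (forall x, x \in rs3 -> (0 < mu x)%N) ->
  (size (undup rs3) * (1 + (s - 1) * nK) <= b - nK)%N.
Proof.
move=> hr; rewrite -(sum_hits v a1 a2) -(card_uniqP (undup_uniq rs3)) -sum_nat_const.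
rewrite [X in (_ <= X)%N](bigID (mem (undup rs3))) /=; apply: leq_trans (leq_addr _ _).
apply: leq_sum => x xr; rewrite hm [(mu x * s)%N]mulnC; apply: mu_lb; apply: hr.
by rewrite -mem_undup.
Qed.

Section SkewLine.
Variables (i j : I).
Hypothesis ij : i != j.
Hypothesis skew : forall y z, ev (y *: a1 + z *: a2) i = 0 ->
  ev (y *: a1 + z *: a2) j = 0 -> y = 0 /\ z = 0.
Hypothesis a1L : forall k, k \in L i j -> ev a1 k != 0.
Hypothesis p_ndvd : ~~ (p %| line_weight s v i j)%N.
Let wl := line_weight s v i j.

(* On the points of the line, x is the rational function - E2 / E1 of x^s.  If
   enough of them are roots of X^(s p^n) f + g, differentiating the resulting
   identity in x^s leaves only the derivative of - E2 / E1. *)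
Lemma line_no_pth_power n (f g : {poly F}) d (S : {set I}) :
  (0 < n)%N -> (0 < d)%N -> (size f <= d.+1)%N -> (size g <= d.+1)%N ->
  (size g <= size f)%N ->
  wronskian f g != 0 -> S \subset L i j ->
  (forall k, k \in S -> xi k ^+ (s * p ^ n) * f.[xi k] + g.[xi k] = 0) ->
  (p ^ n + wl * d < #|S|)%N -> (d.*2 <= #|S|)%N -> False.
Proof.
move=> n0 d0 szf szg gf W0 SL hS big big2.
have [E1 [E2 [lpE szE1 mE1 szE2]]] := line_poly_decomp C ij skew a1L.
have cop := line_coprime C ij skew a1L lpE mE1.
set A := - E2; set B := E1.
have szA : (size A <= wl.+1)%N by rewrite size_polyN.
have szB : (size B <= wl.+1)%N by rewrite szE1.
have rootE k : k \in S -> A.[xi k ^+ s] = xi k * B.[xi k ^+ s].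
  by move=> kS; apply: (line_root lpE); exact: (subsetP SL).
have B0 k : k \in S -> B.[xi k ^+ s] != 0.
  move=> kS; apply/negP => /eqP/rootP b0.
  have := coprimep_root cop b0; have := rootE k kS; rewrite (rootP b0) mulr0 hornerN.
  by move/eqP; rewrite oppr_eq0 => ->.
have xinj := xi_inj_line C ij skew a1L.
have s1 : (1 < s)%N by move: s7; lia.
have uS : uniq [seq xi k | k <- enum S].
  rewrite map_inj_in_uniq ?enum_uniq // => k l; rewrite !mem_enum => kS lS.
  by apply: xinj; exact: (subsetP SL).
have uT : uniq [seq xi k ^+ s | k <- enum S].
  rewrite map_inj_in_uniq ?enum_uniq // => k l; rewrite !mem_enum => kS lS.
  by move/(frob_s_inj sF s1); apply: xinj; exact: (subsetP SL).
(* At [x^s] the quotient [A / B] is [x], so [G] takes there the value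
   [B^d (x^(s p^n) f(x) + g(x)) = 0]. Its degree is at most [p^n + wl d], below the number of these
   points. *)
pose G := 'X^(p ^ n) * hom d f A B + hom d g A B.
have G0 : G = 0.
  apply: (roots_geq_poly_eq0 (rs := [seq xi k ^+ s | k <- enum S])) => //.
    apply/allP => t0 /mapP [k]; rewrite mem_enum => kS ->; apply/rootP.
    have e := rootE k kS; rewrite hornerD hornerM hornerXn !(@horner_hom F d _ _ _ (xi k)) //.
    by rewrite mulrCA -mulrDr -exprM hS // mulr0.
  rewrite size_map -cardE; apply: leq_trans big.
  apply: leq_size_add.
    apply: leq_trans (leq_size_mul (leqnn _) (size_hom _ _ szA szB)) _.
    by rewrite size_polyXn addSn addnS.
  by apply: leq_trans (size_hom _ _ szA szB) _; rewrite ltnS leq_addl.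
have pn0 : (p ^ n)%:R = 0 :> {poly F}.
  apply/eqP; rewrite -(dvdn_pcharf (rmorph_pchar (@polyC F) (cf_p C))).
  by rewrite dvdn_exp.
pose H := 'X^(p ^ n) * hom d.-1 f^`() A B + hom d.-1 g^`() A B.
have key : (A^`() * B - A * B^`()) * H = 0.
  have dG : B * G^`() = 0 by rewrite G0 deriv0 mulr0.
  rewrite derivD derivM derivXn -mulr_natr pn0 mulr0 mul0r add0r in dG.
  rewrite mulrDr mulrCA !deriv_hom // in dG.
  rewrite -[RHS]dG /H; have -> : hom d g A B = - ('X^(p ^ n) * hom d f A B).
    by apply/eqP; rewrite -addr_eq0 addrC -/G G0.
  by ring.
move/eqP: key; rewrite mulf_eq0 => /orP [/eqP Dl|/eqP H0].
  (* If [A / B] has derivative zero, coprimality makes [E1] divide [E1'], so [E1' = 0]; but its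
     coefficient at [wl - 1] is [wl], which is not zero in [F]. *)
  have dvd : E1 %| E1^`().
    rewrite -(Gauss_dvdpl _ cop); have -> : E1^`() * E2 = E1 * E2^`().
      apply/eqP; rewrite -subr_eq0 -[X in _ == X]Dl /A /B derivN; apply/eqP; ring.
    by rewrite dvdp_mulr.
  have E10 : E1 != 0 by rewrite monic_neq0.
  have dE1 : E1^`() = 0.
    apply/eqP; apply: contraT => nz; have := dvdp_leq nz dvd.
    by rewrite leqNgt (lt_size_deriv E10).
  have wl0 : (0 < wl)%N by exact: (line_weight_gt0 C ij).
  have := coef_deriv E1 wl.-1; rewrite dE1 coef0 prednK // => /esym/eqP.
  have -> : E1`_wl = 1 by have := monicP mE1; rewrite lead_coefE szE1.
  by rewrite -(dvdn_pcharf (cf_p C)) (negPf p_ndvd).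
(* Otherwise [x^(s p^n) f' + g'] vanishes on [S] together with [x^(s p^n) f + g], and the Wronskian
   has more roots than its degree allows. *)
case/negP: W0; apply/eqP.
apply: (roots_geq_poly_eq0 (rs := [seq xi k | k <- enum S])) => //; last first.
  rewrite size_map -cardE; apply: leq_trans big2; apply: leq_trans (size_wronskian gf) _.
  by rewrite leq_double; move: szf; case: (size f).
apply/allP => t0 /mapP [k]; rewrite mem_enum => kS ->; apply/rootP.
have e := rootE k kS.
have szd (f' : {poly F}) : (size f' <= d.+1)%N -> (size (f'^`())%R <= d.-1.+1)%N.
  move=> sf'; rewrite prednK //; have [->|f0] := eqVneq f' 0; first by rewrite deriv0 size_poly0.
  by have := lt_size_deriv f0; move: sf'; clear; lia.
have := congr1 (fun P : {poly F} => P.[xi k ^+ s]) H0; rewrite /H hornerD hornerM hornerXn horner0.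
rewrite !(@horner_hom F d.-1 _ _ _ (xi k)) ?szd // mulrCA -mulrDr => /eqP.
rewrite mulf_eq0 expf_eq0 (negPf (B0 k kS)) andbF /= -exprM => /eqP h1.
have h2 := hS k kS; rewrite /wronskian hornerD hornerN !hornerM.
move: h1 h2; move: (xi k ^+ _) => t /eqP; rewrite addrC addr_eq0 => /eqP -> /eqP.
by rewrite addrC addr_eq0 => /eqP ->; ring.
Qed.

End SkewLine.

(* If the extracted exponent [n] is positive, [line_no_pth_power] gives a
   contradiction; if [n = 0], [f3] and [g3] have degree at most 1. *)
Lemma main_star i j : (11 <= s)%N -> (11 <= p)%N -> (2 * s ^ (h - 3) <= nK)%N -> i != j ->
  (forall y z, ev (y *: a1 + z *: a2) i = 0 -> ev (y *: a1 + z *: a2) j = 0 -> y = 0 /\ z = 0) ->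
  (forall k, k \in L i j -> ev a1 k != 0) -> ~~ (p %| line_weight s v i j)%N -> linear_config s v.
Proof.
move=> s11 p11 n2u ij skew a1L pw.
have [delta [jj [f3 [g3 [d3 [rsc [rs3 [k3 [Q [[NE QM cnt szE] [[F3E k0 lb] [W0 szf szg d0]]]]]]]]]]]] :=
  codim2_decomposition.
set u := (s ^ (h - 3))%N in n2u.
have u0 : (0 < u)%N by rewrite expn_gt0; lia.
have qE : (q = u * (s * (s * s)))%N by rewrite (card_field_eq C) !expnS expn0 muln1.
have dlt : (excess F I s < u * (s + 2))%N by exact: excess_lt C.
have de := delta_eq NE.
have n0 : (0 < nK)%N by apply/card_gt0P; exists i0.
have dd : (delta <= excess F I s)%N.
  by rewrite -(leq_pmul2l (_ : 0 < s)%N); move: s7 n0 de; clear; lia.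
have p1 : (1 < p)%N by apply: leq_trans p11.
have P0 : (0 < p ^ jj)%N by rewrite expn_gt0 ltnW.
have QP : (Q * p ^ jj = s * s * u)%N.
  rewrite QM qE; have s0 : (0 < s)%N by move: s7; lia.
  have -> : (u * (s * (s * s)) = s * s * u * s)%N by clear; lia.
  by rewrite mulnK.
have mu3 x : x \in rs3 -> (0 < mu x)%N.
  by move=> xr; rewrite cnt addn_gt0 muln_gt0 P0 -!has_count !has_pred1 xr orbT.
have many := many_hyperplanes mu3.
have Pd : (p ^ jj * d3 <= delta)%N by rewrite -szE leq_addl.
have dlt2 : (delta < u * (s + 2))%N by apply: leq_ltn_trans dlt.
have bl : (2 * (b - nK) <= 3 * (u * (s * (s * s))) + 2)%N.
  by rewrite -qE; have := card_points_small C; clear; lia.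
have uP := arith_P_gt s11 u0 P0 QP Pd dlt2 lb many n2u bl.
have [e e0 sE] := cf_s C.
have s2 : (2 < s)%N by apply: leq_trans s11.
(* [n] is what the extracted power leaves over: [Q = s p^n]. *)
have [n [ne jn Pn dn]] := arith_exponent p1 h3 sE (erefl u) e0 uP d0 (leq_ltn_trans Pd dlt2) s2.
have pn0 : (0 < p ^ n)%N by rewrite expn_gt0 ltnW.
have QE : Q = (s * p ^ n)%N.
  have uP0 : (0 < p ^ jj)%N by [].
  apply/eqP; rewrite -(eqn_pmul2r P0) QP.
  have -> : (s * p ^ n * p ^ jj = s * (p ^ jj * p ^ n))%N by rewrite -mulnA [(p ^ n * p ^ jj)%N]mulnC.
  by rewrite Pn mulnA.
have rootE x : x \in rs3 -> x ^+ Q * f3.[x] + g3.[x] = 0.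
  move=> xr; have := congr1 (fun P : {poly F} => P.[x]) F3E.
  rewrite hornerD hornerM hornerXn hornerZ => ->.
  by have /rootP -> : root (split_poly rs3) x by [rewrite root_prod_XsubC]; rewrite mulr0.
have [n_eq0|n_gt0] := posnP n.
  have P_eq : (p ^ jj = s * u)%N by rewrite -Pn n_eq0 expn0 muln1.
  (* A slope that is a root of [c] only has multiplicity at least [(1 + (s - 1) nK) / s], more than
     the [delta - s u] roots left for [c] by [d3 >= 1]. *)
  have all3 k : k \notin zr a1 -> xi k \in rs3.
    move=> kz; apply: contraT => k3n; have m0 := mu_gt0 kz; have := mu_lb m0.
    have -> : mu (xi k) = count_mem (xi k) rsc.
      by rewrite cnt [X in (_ + _ * X)%N](count_memPn k3n) muln0 addn0.
    move=> lb2; have cs : (count_mem (xi k) rsc <= size rsc)%N by exact: count_size.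
    have : (size rsc + s * u <= delta)%N by rewrite -szE P_eq leq_add2l leq_pmulr.
    move=> h1; have h2 : (s * (count_mem (xi k) rsc + s * u) <= s * delta)%N.
      by rewrite leq_mul2l; apply/orP; right; apply: leq_trans h1; rewrite leq_add2r.
    have h4 : (1 + (s - 1) * nK + s * (s * u) <= s * delta)%N.
      by apply: leq_trans h2; rewrite mulnDr leq_add2r.
    have h5 : (s * nK = nK + (s - 1) * nK)%N by rewrite mulnBl mul1n subnKC // leq_pmull //; lia.
    have h6 : (s * (nK + s * u) <= s * excess F I s)%N by rewrite mulnDr h5; move: h4 de; clear; lia.
    rewrite leq_pmul2l in h6; last by clear -s2; lia.
    by move: h6 dlt n2u; rewrite mulnDr [(u * s)%N]mulnC; clear; lia.
  have d31 : d3 = 1%N by apply/eqP; rewrite eqn_leq d0 andbT (leq_trans dn) // n_eq0 expn0.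
  have f31 : f3`_1 != 0.
    have : lead_coef f3 != 0 by rewrite lead_coef_eq0 -size_poly_eq0 szf.
    by rewrite lead_coefE szf d31.
  apply: (@star_linear F I h p s v C a1 a2 ind zsub (f3`_0 / f3`_1) (g3`_1 / f3`_1) (g3`_0 / f3`_1)).
  move=> k kz; have := rootE _ (all3 k kz).
  rewrite QE n_eq0 expn0 muln1.
  rewrite (@horner_coef_wide _ 2) ?szf ?d31 // (@horner_coef_wide _ 2) ?(leq_trans szg) ?d31 //.
  rewrite !big_ord_recl !big_ord0 /= !addr0 !expr0 !expr1 !mulr1 => e1.
  apply: (mulfI f31); rewrite mulr0 -[RHS]e1 /bump /=; field.
  by [].
(* [N] collects the slopes of the line that are roots of [c] only; there are so few of them that [S]
   is large enough for [line_no_pth_power]. *)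
exfalso; pose S := [set k in L i j | xi k \in rs3].
pose N := [set xi k | k in L i j :\: S].
have xinj := xi_inj_line C ij skew a1L.
have cN : (#|N| * (1 + (s - 1) * nK) <= s * delta)%N.
  apply: (@few_c_only_roots N rsc); last by rewrite -szE leq_addr.
  move=> _ /imsetP [k kL ->]; move: kL; rewrite in_setD inE => /andP [+ kL].
  rewrite kL /= => k3n; have kz : k \notin zr a1 by rewrite zrE a1L.
  split; first exact: mu_gt0.
  by rewrite cnt [X in (_ + _ * X)%N](count_memPn k3n) muln0 addn0.
have cS : (#|S| + #|N| = 1 + s * line_weight s v i j)%N.
  rewrite -(card_line C ij) card_in_imset; last first.
    by move=> k l; rewrite !in_setD => /andP [_ kL] /andP [_ lL]; apply: xinj.
  by rewrite -(cardsID S (L i j)) (setIidPr _) //; apply/subsetP => k; rewrite inE => /andP [].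
have ps : (11 * p ^ n <= s)%N.
  rewrite sE; apply: leq_trans (leq_pexp2l (ltnW p1) ne); rewrite expnS leq_mul2r.
  by rewrite p11 orbT.
have w0 := line_weight_gt0 C ij.
have ar := arith_hits s11 u0 n2u dlt2 cN ps dn w0.
apply: (@line_no_pth_power i j ij skew a1L pw n f3 g3 d3 S) => //.
- by rewrite szf.
- by rewrite szf.
- by apply/subsetP => k; rewrite inE => /andP [].
- by move=> k; rewrite inE => /andP [kL kr]; rewrite -QE; apply: rootE.
- by move: ar cS; rewrite [(s * _)%N]mulnC; clear; lia.
have : (d3 <= line_weight s v i j * d3)%N by rewrite leq_pmull.
by move: ar cS dn; rewrite [(s * _)%N]mulnC -addnn; clear; lia.
Qed.

End StarTheorem.

(** * Lines of weight one, and axes grown from smaller subspaces *)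

Section SkewComplement.
Variables (F : finFieldType) (I : finType) (h p s : nat) (v : I -> 'rV[F]_h).
Hypothesis C : config p s v.
Local Notation q := #|F|.
Local Notation L := (line_pts v).
Local Notation pts := (pts v).
Local Notation zr := (zeros v).
Local Notation ev := (fval v).
Local Notation onB := (onB v).
Local Notation Fs := (frob_fixed F s).
Local Notation w := (line_weight s v).

Let s7 := cf_s7 C.
Let h3 := cf_h C.
Let v0 := cf_v0 C.
Let v_inj := cf_inj C.
Let sF := pchar_nat_s C.
Let s1 : (1 < s)%N := leq_trans (isT : (1 < 7)%N) s7.

Lemma onB_nz x : onB x -> x != 0. Proof. by case/andP. Qed.

Lemma dotD (x y : 'rV[F]_h) (a : 'cV[F]_h) :
  ((x + y) *m a) 0 0 = (x *m a) 0 0 + (y *m a) 0 0.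
Proof. by rewrite mulmxDl mxE. Qed.

Lemma dotZ c (x : 'rV[F]_h) (a : 'cV[F]_h) : ((c *: x) *m a) 0 0 = c * (x *m a) 0 0.
Proof. by rewrite -scalemxAl mxE. Qed.

Lemma separating m (U : 'M[F]_(m, h)) (x : 'rV[F]_h) :
  ~~ (x <= U)%MS -> exists a : 'cV[F]_h, U *m a = 0 /\ x *m a != 0.
Proof.
rewrite submxE => /rV0Pn [j hj].
exists (col j (cokermx U)); split; rewrite !colE mulmxA.
  by rewrite mulmx_coker mul0mx.
by rewrite -colE; apply: contra hj => /eqP/matrixP/(_ 0 0); rewrite [LHS]mxE [RHS]mxE => ->.
Qed.

(** For weight 1 the slopes are roots of a polynomial [X^s (X + a) + b X + c], so cross-ratios on
    the line lie in [Fs]. The one formed by [u], [z], [u + z] and [z + l *: u] is [l]. Besides the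
    point of [u] the line has [s] points, as many as [Fs] has elements, so every [l] in [Fs]
    occurs. *)
Lemma simple_line_Fs i j u z : i != j -> w i j = 1%N ->
  (exists2 c, c != 0 & u = c *: v i) -> (exists2 c, c != 0 & z = c *: v j) ->
  onB (u + z) -> forall l, onB (z + l *: u) = (l \in Fs).
Proof.
move=> ij wij [ci ci0 uE] [cj cj0 zE] uzB.
have iu : v i = ci^-1 *: u by rewrite uE scalerA mulVf // scale1r.
have jz : v j = cj^-1 *: z by rewrite zE scalerA mulVf // scale1r.
have Luz k : k \in L i j -> exists al be, v k = al *: u + be *: z.
  rewrite inE => /row_addsP [a [c ->]]; exists (a * ci^-1), (c * cj^-1).
  by rewrite iu jz !scalerA.
have inL al be k : ((al *: u + be *: z)%R <= v k)%MS -> onB (al *: u + be *: z) -> k \in L i j.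
  move=> /sub_rVP [c e] /onB_nz nz; have c0 : c != 0.
    by apply: contraNneq nz => c0; rewrite e c0 scale0r.
  rewrite inE; have -> : v k = c^-1 *: (al *: u + be *: z) by rewrite e scalerA mulVf // scale1r.
  by rewrite uE zE !scalerA; apply: scalemx_sub; apply: row_combS.
have rU : (\rank (v i + v j)%MS < h)%N by rewrite (rank_line v0 v_inj ij); move: h3; lia.
have [a1 a1L] := exists_nowhere_zero C (card_pts_lt_q C rU).
have ji : ~~ (v j <= v i)%MS by apply: contra ij => /v_inj ->.
have [a2 [a2i a2j]] := separating ji.
have ev2i : ev a2 i = 0 by rewrite /fval a2i mxE.
have ev2j : ev a2 j != 0.
  by apply: contra a2j => /eqP e; apply/eqP/matrixP => x y; rewrite !ord1 [RHS]mxE.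
have skew y t : ev (y *: a1 + t *: a2) i = 0 -> ev (y *: a1 + t *: a2) j = 0 -> y = 0 /\ t = 0.
  rewrite !evD !evZ ev2i mulr0 addr0 => /eqP; rewrite mulf_eq0 (negPf (a1L i (line_pts_l _ _ _))) orbF.
  by move=> /eqP ->; rewrite mul0r add0r => /eqP; rewrite mulf_eq0 (negPf ev2j) orbF => /eqP ->.
have [E1 [E2 [lpE szE1 mE1 szE2]]] := line_poly_decomp C ij skew a1L.
rewrite wij in szE1 szE2.
have E11 : E1`_1 = 1 by have := monicP mE1; rewrite lead_coefE szE1.
have roots k : k \in L i j -> slope v a1 a2 k ^+ s * (slope v a1 a2 k + E2`_1) +
    (E1`_0 * slope v a1 a2 k + E2`_0) = 0.
  move=> kL; have := line_root lpE kL; rewrite hornerN.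
  rewrite (@horner_coef_wide _ 2 E1) ?szE1 // (@horner_coef_wide _ 2 E2) //.
  rewrite !big_ord_recl !big_ord0 /= !addr0 !expr0 !expr1 !mulr1 /bump /= E11 => e.
  move: e; move: (slope v a1 a2 k) => x; move: (x ^+ s) => t e.
  have -> : t * (x + E2`_1) + (E1`_0 * x + E2`_0) =
     x * (E1`_0 + 1 * t) - (- (E2`_0 + E2`_1 * t)) by ring.
  by rewrite e subrr.
pose al := ci * ev a1 i; pose be := cj * ev a1 j; pose t := cj * ev a2 j.
have al0 : al != 0 by rewrite mulf_neq0 // a1L ?line_pts_l.
have be0 : be != 0 by rewrite mulf_neq0 // a1L ?line_pts_r.
have t0 : t != 0 by rewrite mulf_neq0.
have xiE k x y : k \in L i j -> ((x *: u + y *: z)%R <= v k)%MS -> onB (x *: u + y *: z) ->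
    x * al + y * be != 0 /\ slope v a1 a2 k = - (y * t / (x * al + y * be)).
  move=> kL /sub_rVP [c e] /onB_nz nz; have c0 : c != 0.
    by apply: contraNneq nz => c0; rewrite e c0 scale0r.
  have evk a : c * ev a k = x * ci * ev a i + y * cj * ev a j.
    have := congr1 (fun r : 'rV_h => (r *m a) 0 0) e.
    by rewrite uE zE !scalerA dotD !dotZ => <-.
  have d0 : c * ev a1 k = x * al + y * be by rewrite evk /al /be !mulrA.
  have nd : x * al + y * be != 0 by rewrite -d0 mulf_neq0 // a1L.
  have n2 : c * ev a2 k = y * t by rewrite evk ev2i mulr0 add0r /t mulrA.
  by split=> //; rewrite /slope -d0 -n2; field; rewrite c0 a1L.
have toFs l : onB (z + l *: u) -> l \in Fs.
  move=> lB; have [->|l0] := eqVneq l 0; first exact: Fs0.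
  have [->|l1] := eqVneq l 1; first exact: Fs1.
  have pt x y : onB (x *: u + y *: z) -> exists k, [/\ k \in L i j, x * al + y * be != 0 &
     slope v a1 a2 k = - (y * t / (x * al + y * be))].
    move=> xyB; have /andP [_ /existsP [k kP]] := xyB.
    have kL := inL _ _ _ kP xyB; have [nd e] := xiE _ _ _ kL kP xyB.
    by exists k.
  have uB : onB (1 *: u + 0 *: z).
    by rewrite scale1r scale0r addr0 uE; apply: (onBZ C) => //; exact: onB_v C i.
  have zB : onB (0 *: u + 1 *: z).
    by rewrite scale1r scale0r add0r zE; apply: (onBZ C) => //; exact: onB_v C j.
  have uz1 : onB (1 *: u + 1 *: z) by rewrite !scale1r.
  have lB' : onB (l *: u + 1 *: z) by rewrite scale1r addrC.
  have [ku [kuL nu xu]] := pt _ _ uB; have [kz [kzL nz xz]] := pt _ _ zB.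
  have [k1 [k1L n1 x1]] := pt _ _ uz1; have [kl [klL nl xl]] := pt _ _ lB'.
  move: xu xz x1 xl n1 nl; rewrite !(mul0r, mul1r, oppr0, add0r) => xu xz x1 xl n1 nl.
  apply/FsP; apply: (@cross_ratio_fixed F s E2`_1 E1`_0 E2`_0 _ (slope v a1 a2 ku) (slope v a1 a2 kz)
     (slope v a1 a2 kl) (slope v a1 a2 k1) sF).
  - by move=> x; rewrite !inE => /or4P [] /eqP ->; apply: roots.
  - rewrite xu xz x1 /= !inE !negb_or andbT; apply/andP; split; last first.
      rewrite eqr_opp; apply: contraNneq al0 => /(mulfI t0) /invr_inj /eqP.
      by rewrite -subr_eq0 opprD addrCA subrr addr0 oppr_eq0.
    by rewrite ![0 == _]eq_sym !oppr_eq0 !mulf_neq0 ?invr_eq0.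
  - by rewrite xl xu oppr_eq0 mulf_neq0 // invr_eq0.
  by rewrite xu xz x1 xl; field; rewrite be0 n1 nl.
pose S := [set l | onB (z + l *: u)].
suff -> : Fs = S by move=> l; rewrite inE.
apply/esym/eqP; rewrite eqEcard; apply/andP; split.
  by apply/subsetP => l; rewrite inE; exact: toFs.
rewrite (cardFs C); pose f l := odflt i [pick k | ((z + l *: u)%R <= v k)%MS].
have cL : #|L i j :\ i| = s.
  by have := cardsD1 i (L i j); rewrite line_pts_l (card_line C ij) wij muln1 => /eqP; rewrite eqn_add2l => /eqP.
rewrite -cL; apply: leq_trans (leq_imset_card f S).
apply: subset_leq_card; apply/subsetP => k; rewrite in_setD1 => /andP [ki kL].
have [a [c ke]] := Luz k kL; have c0 : c != 0.
  apply: contraNneq ki => c0; apply/eqP/v_inj.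
  by rewrite ke c0 scale0r addr0 uE scalerA scalemx_sub.
have e : z + (c^-1 * a) *: u = c^-1 *: v k.
  by rewrite ke scalerDr !scalerA mulVf // scale1r addrC.
apply/imsetP; exists (c^-1 * a); first by rewrite inE e (onBZ C) ?invr_eq0 // (onB_v C).
rewrite /f e; case: pickP => [k' /sub_rVP [x ex]|/(_ k)]; last by rewrite scalemx_sub.
apply: v_inj; rewrite -[v k]scale1r -(divff c0) -scalerA ex scalerA; exact: scalemx_sub.
Qed.

Lemma exists_pencil_pair m (K : 'M[F]_(m, h)) i0 : i0 \in pts K -> \rank K = (h - 2)%N ->
  exists a1 a2, [/\ zr a1 = pts K, a1 \in ann K, a2 \in ann K &
    forall y z, y *: a1 + z *: a2 = 0 -> y = 0 /\ z = 0].
Proof.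
move=> iK rK.
have rKh : (\rank K < h)%N by rewrite rK; move: h3; lia.
have [a1 [a10 a1K zE]] := exists_exact C iK rKh.
have q1 := q_gt1 C.
have [a2 a2K a2n] : exists2 a2, a2 \in ann K & forall x, a2 != x *: a1.
  have : ~~ (ann K \subset [set x *: a1 | x : F]).
    apply/negP => /subset_leq_card; rewrite card_ann rK subKn; last by move: h3; lia.
    move/leq_trans => /(_ q (leq_imset_card _ _)); rewrite leqNgt -{1}[q]expn1 ltn_exp2l //.
  case/subsetPn => a2 a2K a2n; exists a2 => // x; apply: contraNneq a2n => ->.
  by apply/imsetP; exists x.
exists a1, a2; split=> // y z e; have z0 : z = 0.
  apply/eqP; apply: contraT => zn; case/negP: (a2n (- (z^-1 * y))).
  rewrite scaleNr -addr_eq0 -scalerA -[X in X + _]scale1r -(mulVf zn) -scalerA -scalerDr.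
  by rewrite addrC e scaler0.
split=> //; move: e; rewrite z0 scale0r addr0 => /eqP.
by rewrite scaler_eq0 (negPf a10) orbF => /eqP.
Qed.

Lemma main_star_sub m (K : 'M[F]_(m, h)) i0 i j : (11 <= s)%N -> (11 <= p)%N ->
  i0 \in pts K -> \rank K = (h - 2)%N -> (2 * s ^ (h - 3) <= #|pts K|)%N -> i != j ->
  \rank (K + (v i + v j))%MS = h -> ~~ (p %| w i j)%N -> linear_config s v.
Proof.
move=> s11 p11 iK rK nK ij rKl pw.
have [a1 [a2 [zE a1K a2K ind]]] := exists_pencil_pair iK rK.
have zsub : zr a1 \subset zr a2 by rewrite zE; apply: pts_sub_zr.
have cap0 : (K :&: (v i + v j) = 0)%MS.
  have := mxrank_sum_cap K (v i + v j)%MS; rewrite rKl rK (rank_line v0 v_inj ij).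
  by move=> e; apply/eqP; rewrite -mxrank_eq0; apply/eqP; move: e h3; lia.
apply: (@main_star F I h p s v C a1 a2 ind zsub i0 _ i j s11 p11 _ ij _ _ pw).
- by rewrite zE.
- by rewrite zE.
- move=> y z hi hj; apply: ind; set a := _ + _ in hi hj *.
  have hz k : ev a k = 0 -> v k *m a = 0.
    by move=> e; apply/matrixP => x' y'; rewrite !ord1 [RHS]mxE.
  have aK : K *m a = 0.
    move: a1K a2K; rewrite !mem_ann => /eqP e1 /eqP e2.
    by rewrite mulmxDr -!scalemxAr e1 e2 !scaler0 addr0.
  have: ((K + (v i + v j))%MS *m a == 0) by rewrite !ann_adds aK !hz // !eqxx.
  move/eqP => e; have /row_fullP [D De] : row_full (K + (v i + v j))%MS by rewrite /row_full rKl.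
  by rewrite -[a]mul1mx -De -mulmxA e mulmx0.
move=> k kL; apply/negP => ke; have : k \in zr a1 by rewrite zrE.
rewrite zE inE => kK; have : (v k <= K :&: (v i + v j))%MS.
  by rewrite sub_capmx kK /=; move: kL; rewrite inE.
by rewrite cap0 submx0 (negPf (v0 k)).
Qed.

(** Adding a point outside the join of [K0] and [l] keeps the two skew and, by [growth], multiplies
    the number of points by at least [s]. *)
Lemma extend_complement r (K0 : 'M[F]_h) i0 (l : 'M[F]_h) :
  \rank l = 2%N -> \rank K0 = r -> (r <= h - 2)%N -> \rank (K0 + l)%MS = (r + 2)%N ->
  i0 \in pts K0 ->
  exists K : 'M[F]_h, [/\ i0 \in pts K, \rank K = (h - 2)%N, \rank (K + l)%MS = h &
    (#|pts K0| * s ^ (h - 2 - r) <= #|pts K|)%N].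
Proof.
move=> rl; have [n] := ubnP (h - 2 - r); elim: n r K0 => // n IH r K0 ltn rK rh rKl iK.
have [e|lt] := eqVneq r (h - 2)%N.
  exists K0; rewrite e subnn muln1; split=> //; first by rewrite rK.
  by rewrite rKl e; move: h3; lia.
have rlt : (r < h - 2)%N by rewrite ltn_neqAle lt.
have [k kn _] : exists2 k, k \notin pts (K0 + l)%MS & true.
  by apply: (rank_lt_neq0 C); rewrite rKl; move: rlt; clear; lia.
have kK : ~~ (v k <= K0)%MS.
  by apply: contra kn => hk; rewrite inE (submx_trans hk) // addsmxSl.
have rK' : \rank (K0 + v k)%MS = r.+1 by rewrite rank_adds1 // rK.
have rKl' : \rank (K0 + v k + l)%MS = (r.+1 + 2)%N.
  have -> : \rank (K0 + v k + l)%MS = \rank (K0 + l + v k)%MS.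
    by apply/eqmx_rank; rewrite -addsmxA (addsmxC (v k)) addsmxA; apply/eqmxP.
  by rewrite rank_adds1 ?rKl //; move: kn; rewrite inE.
have iK' : i0 \in pts (K0 + v k)%MS by apply: (subsetP (ptsS v (addsmxSl _ _))).
have [|K [iK2 rK2 rKl2 nK]] := IH r.+1 (K0 + v k)%MS _ rK' rlt rKl' iK'.
  by move: ltn rlt; clear; lia.
exists K; split=> //; apply: leq_trans nK.
have -> : (h - 2 - r = (h - 2 - r.+1).+1)%N by move: rlt; clear; lia.
rewrite expnS mulnA leq_mul2r; apply/orP; right; rewrite mulnC.
apply: leq_trans (_ : 1 + s * #|pts K0| <= _)%N; first by rewrite leq_addl.
apply: (growth C (k := k)); [exact: closed_pts | exact: closed_pts | | | ].
- by apply: ptsS; exact: addsmxSl.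
- by rewrite inE addsmxSr.
- by rewrite inE.
Qed.

(** Growing from rank [r] to rank [h - 2] turns [2 s^(r-1)] points into the required [2 s^(h-3)]. *)
Lemma main_star_skew r (K0 : 'M[F]_h) i0 i j : (11 <= s)%N -> (11 <= p)%N ->
  i0 \in pts K0 -> \rank K0 = r -> (0 < r <= h - 2)%N -> (2 * s ^ (r - 1) <= #|pts K0|)%N ->
  i != j -> \rank (K0 + (v i + v j))%MS = (r + 2)%N -> ~~ (p %| w i j)%N -> linear_config s v.
Proof.
move=> s11 p11 iK rK /andP [r0 rh] nK ij rKl pw.
have [K [iK2 rK2 rKl2 nK2]] := extend_complement (rank_line v0 v_inj ij) rK rh rKl iK.
apply: (main_star_sub s11 p11 iK2 rK2 _ ij rKl2 pw); apply: leq_trans nK2.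
have -> : (h - 3 = r - 1 + (h - 2 - r))%N by move: r0 rh h3; clear; lia.
by rewrite expnD mulnA leq_mul2r nK orbT.
Qed.

End SkewComplement.

(** * A line of weight at least two, for [h >= 4] *)

Section LongLines.
Variables (F : finFieldType) (I : finType) (h p s : nat) (v : I -> 'rV[F]_h).
Hypothesis C : config p s v.
Local Notation L := (line_pts v).
Local Notation pts := (pts v).
Local Notation w := (line_weight s v).

Let s7 := cf_s7 C.
Let h3 := cf_h C.
Let v0 := cf_v0 C.
Let v_inj := cf_inj C.

Lemma card_block i j : i != j -> #|L i j :\ i| = (s * w i j)%N.
Proof.
move=> ij; have := cardsD1 i (L i j); rewrite line_pts_l (card_line C ij) => /eqP.
by rewrite eqn_add2l => /eqP.
Qed.

Lemma row_exchange m (U : 'M[F]_(m, h)) (x y : 'rV[F]_h) :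
  ~~ (x <= U)%MS -> (x <= U + y)%MS -> (y <= U + x)%MS.
Proof.
move=> xU xUy; have yU : ~~ (y <= U)%MS.
  apply: contra xU => yU; apply: submx_trans xUy _.
  by rewrite addsmx_sub submx_refl.
apply: submx_trans (addsmxSr U y) _; apply: rank_eq_sub.
  by rewrite addsmx_sub addsmxSl xUy.
by rewrite !rank_adds1.
Qed.

Lemma line_pts_of_common i j k (z : 'rV[F]_h) : i != j -> i != k -> ~~ (z <= v i)%MS ->
  (z <= v i + v j)%MS -> (z <= v i + v k)%MS -> L i j = L i k.
Proof.
move=> ij ik zi zj zk; apply: (line_pts_eq v0 v_inj) => //; first exact: line_pts_l.
rewrite inE; apply: submx_trans (row_exchange zi zj) _.
by rewrite addsmx_sub addsmxSl.
Qed.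

Lemma line_weight_eq i j k l : i != j -> k \in L i j -> l \in L i j -> k != l -> w k l = w i j.
Proof. by move=> ij kL lL kl; rewrite /line_weight (line_pts_eq v0 v_inj ij kL lL kl). Qed.

Lemma not_both i j (z : 'rV[F]_h) : i != j -> z != 0 ->
  ~~ (z <= v i)%MS || ~~ (z <= v j)%MS.
Proof.
move=> ij z0; rewrite -negb_and; apply: contra ij => /andP [zi zj].
apply/eqP/v_inj; apply: submx_trans zj.
by apply: rank_eq_sub zi _; rewrite !rank_rV z0 v0.
Qed.

(** Count the plane modulo [s p] by the lines through a point. If all weights at [X] were divisible
    by [p], the result would be [1]. But a point [Q] of [L i j] other than [z] lies on just one line
    of weight prime to [p], since such lines pass through [z], and the result is not [1]. *)
Lemma lambda_through i j X (z : 'rV[F]_h) : i != j -> ~~ (p %| w i j)%N ->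
  X \notin L i j -> z != 0 -> (z <= v i + v j)%MS ->
  (forall a c, a \in pts (v i + v j + v X)%MS -> c \in pts (v i + v j + v X)%MS ->
     a != c -> ~~ (p %| w a c)%N -> (z <= v a + v c)%MS) ->
  exists Y, [/\ Y \in pts (v i + v j + v X)%MS, Y != X & ~~ (p %| w X Y)%N].
Proof.
move=> ij pw XL z0 zl; set S := pts _ => hL.
have cS : closed_set v S by exact: closed_pts.
have XS : X \in S by rewrite inE addsmxSr.
have [Q [Q' [QL QL' QQ zQ]]] : exists Q Q', [/\ Q \in L i j, Q' \in L i j, Q != Q' & ~~ (z <= v Q)%MS].
  case/orP: (not_both ij z0) => hz; first by exists i, j; rewrite line_pts_l line_pts_r.
  by exists j, i; rewrite line_pts_l line_pts_r eq_sym.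
have LS : L i j \subset S by apply: ptsS; exact: addsmxSl.
have QS := subsetP LS _ QL; have QS' := subsetP LS _ QL'.
case: (boolP [exists Y, [&& Y \in S, Y != X & ~~ (p %| w X Y)%N]]) => [/existsP [Y /and3P [h1 h2 h3']]|].
  by exists Y.
rewrite negb_exists => /forallP none; exfalso.
have dX : (s * p %| #|S|.-1)%N.
  rewrite (card_pencil v0 v_inj XS cS) /=; apply: dvdn_sum => A /imsetP [Y].
  rewrite in_setD1 => /andP [YX YS] ->; have XY : X != Y by rewrite eq_sym.
  rewrite card_block // dvdn_pmul2l; last by move: s7; clear; lia.
  by have := none Y; rewrite YS YX /= negbK.
have LQ : L Q Q' = L i j by exact: (line_pts_eq v0 v_inj).
have s0 : (0 < s)%N by move: s7; clear; lia.
move: dX; rewrite (card_pencil v0 v_inj QS cS) /=.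
have BQ : L Q Q' :\ Q \in pencil v Q S.
  by apply/imsetP; exists Q' => //; rewrite in_setD1 eq_sym QQ.
rewrite (bigD1 _ BQ) /= card_block // dvdn_addl.
  by rewrite dvdn_pmul2l // (line_weight_eq ij QL QL' QQ) (negPf pw).
apply: dvdn_sum => A /andP [/imsetP [Y]]; rewrite in_setD1 => /andP [YQ YS] -> ne.
have QY : Q != Y by rewrite eq_sym.
rewrite card_block // dvdn_pmul2l //; apply: contraR ne => pn.
have zQY := hL Q Y QS YS QY pn.
have zQQ : (z <= v Q + v Q')%MS.
  apply: submx_trans zl _; apply: (line_sub v0 v_inj) => //.
by rewrite (line_pts_of_common QY QQ zQ zQY zQQ).
Qed.

Hypothesis s11 : (11 <= s)%N.
Hypothesis p11 : (11 <= p)%N.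
Hypothesis h4 : (4 <= h)%N.

Lemma not_lambda_long i j : i != j -> (p %| w i j)%N -> (2 <= w i j)%N.
Proof.
move=> ij /dvdn_leq; have := line_weight_gt0 C ij => w0 /(_ w0); move: p11; clear; lia.
Qed.

(** Weight 2 gives at least [2 s + 1] points, above the threshold [2 s] for rank 2. *)
Lemma long_lambda_skew k l i j : k != l -> i != j -> (2 <= w k l)%N ->
  ~~ (p %| w i j)%N -> \rank (v k + v l + (v i + v j))%MS = 4%N -> linear_config s v.
Proof.
move=> kl ij wkl pw r4.
apply: (@main_star_skew F I h p s v C 2 (v k + v l)%MS k i j) => //.
- exact: line_pts_l.
- exact: rank_line.
- by move: h4; clear; lia.
rewrite -[#|_|]/(#|L k l|) (card_line C kl) expn1.
by have := leq_mul (leqnn s) wkl; clear; lia.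
Qed.

(** Suppose that every line of weight at least 2 meets every line of weight prime to [p]. Let [z] be
    the common point of the two given lines and [X] a point off their plane. In the plane of [L i j]
    and [X], all lines of weight prime to [p] pass through [z]. So a line from [X] to a point [Q] of
    [L i j] other than [z] has weight divisible by [p], hence at least 2; yet there is a line of
    weight prime to [p] skew to it. *)
Lemma long_lambda_distinct k l i j : k != l -> i != j -> (2 <= w k l)%N ->
  ~~ (p %| w i j)%N -> L i j != L k l -> linear_config s v.
Proof.
move=> kl ij wkl pw LL.
case: (boolP [exists a, exists c, exists x, exists y, [&& a != c, x != y, (2 <= w a c)%N,
   ~~ (p %| w x y)%N & \rank (v a + v c + (v x + v y))%MS == 4%N]]).
  move=> /existsP [a /existsP [c /existsP [x /existsP [y /and5P [ac xy wac pxy /eqP r4]]]]].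
  exact: long_lambda_skew ac xy wac pxy r4.
move=> none; exfalso.
have H a c x y : a != c -> x != y -> (2 <= w a c)%N -> ~~ (p %| w x y)%N ->
    \rank (v a + v c + (v x + v y))%MS != 4%N.
  move=> ac xy wac pxy; apply: contra none => r4.
  by apply/existsP; exists a; apply/existsP; exists c; apply/existsP; exists x; apply/existsP;
     exists y; rewrite ac xy wac pxy.
have meet a c x y : a != c -> x != y -> (2 <= w a c)%N -> ~~ (p %| w x y)%N ->
    exists t : 'rV[F]_h, [/\ t != 0, (t <= v a + v c)%MS & (t <= v x + v y)%MS].
  move=> ac xy wac pxy; have := mxrank_sum_cap (v a + v c)%MS (v x + v y)%MS.
  rewrite !(rank_line v0 v_inj) // => e.
  pose K := ((v a + v c) :&: (v x + v y))%MS; have K0 : K != 0.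
    rewrite -mxrank_eq0; apply: contra (H a c x y ac xy wac pxy) => /eqP K0.
    by move: e; rewrite -/K K0 addn0 => ->.
  exists (nz_row K); rewrite nz_row_eq0; split=> //.
    exact: submx_trans (nz_row_sub _) (capmxSl _ _).
  exact: submx_trans (nz_row_sub _) (capmxSr _ _).
have [z [z0 zk zi]] := meet k l i j kl ij wkl pw.
pose P0 := (v i + v j + (v k + v l))%MS.
have rP0 : \rank P0 = 3%N.
  have r3 : (\rank P0 <= 3)%N.
    have := mxrank_sum_cap (v i + v j)%MS (v k + v l)%MS; rewrite !(rank_line v0 v_inj) //.
    have : (0 < \rank ((v i + v j) :&: (v k + v l)))%N.
      rewrite lt0n mxrank_eq0; apply: contra z0 => /eqP K0.
      by rewrite -submx0 -K0 sub_capmx zi.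
    by rewrite -/P0; clear; lia.
  apply/eqP; rewrite eqn_leq r3 /= ltnNge; apply: contra LL => r2.
  have sub : (P0 <= v i + v j)%MS.
    by apply: rank_eq_sub; rewrite ?addsmxSl // (rank_line v0 v_inj).
  have kL : k \in L i j by rewrite inE (submx_trans _ sub) // (submx_trans (addsmxSl (v k) (v l))) // addsmxSr.
  have lL : l \in L i j by rewrite inE (submx_trans _ sub) // (submx_trans (addsmxSr (v k) (v l))) // addsmxSr.
  by rewrite (line_pts_eq v0 v_inj ij kL lL kl).
have key X : X \notin pts P0 ->
    [/\ \rank (v i + v j + v X)%MS = 3%N,
        (forall y : 'rV[F]_h, y != 0 -> (y <= v k + v l)%MS -> (y <= v i + v j + v X)%MS -> (z <= y)%MS),
        (forall a c, a \in pts (v i + v j + v X)%MS -> c \in pts (v i + v j + v X)%MS ->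
           a != c -> ~~ (p %| w a c)%N -> (z <= v a + v c)%MS) &
        exists Y, [/\ Y \in pts (v i + v j + v X)%MS, Y != X, ~~ (p %| w X Y)%N & (z <= v X + v Y)%MS]].
  move=> XP; set S := (v i + v j + v X)%MS.
  have Xij : ~~ (v X <= v i + v j)%MS.
    by apply: contra XP => hX; rewrite inE (submx_trans hX) // addsmxSl.
  have rS : \rank S = 3%N by rewrite rank_adds1 // (rank_line v0 v_inj).
  have rSk : \rank (S + (v k + v l))%MS = 4%N.
    have -> : \rank (S + (v k + v l))%MS = \rank (P0 + v X)%MS.
      by rewrite /S /P0 -!(addsmxA (v i + v j)%MS) (addsmxC (v X)).
    by rewrite rank_adds1 ?rP0 //; move: XP; rewrite inE.
  have capz (y : 'rV[F]_h) : y != 0 -> (y <= v k + v l)%MS -> (y <= S)%MS -> (z <= y)%MS.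
    move=> y0 yk yS; have := mxrank_sum_cap S (v k + v l)%MS; rewrite rSk rS (rank_line v0 v_inj kl) => e.
    have r1 : \rank (S :&: (v k + v l))%MS = 1%N by move: e; clear; lia.
    have ycap : (y <= S :&: (v k + v l))%MS by rewrite sub_capmx yS.
    have zcap : (z <= S :&: (v k + v l))%MS.
      by rewrite sub_capmx zk andbT (submx_trans zi) // addsmxSl.
    by apply: submx_trans zcap _; apply: rank_eq_sub ycap _; rewrite r1 rank_rV y0.
  have hL a c : a \in pts S -> c \in pts S -> a != c -> ~~ (p %| w a c)%N -> (z <= v a + v c)%MS.
    rewrite !inE => aS cS' ac pac; have [y [y0 yk yac]] := meet k l a c kl ac wkl pac.
    apply: submx_trans (capz y y0 yk _) (yac); apply: submx_trans (yac) _.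
    by rewrite addsmx_sub aS.
  split=> //; have XL : X \notin L i j by rewrite inE.
  have [Y [YS YX pY]] := lambda_through ij pw XL z0 zi hL.
  exists Y; split=> //; apply: hL => //; rewrite 1?eq_sym //.
  by rewrite inE addsmxSr.
have [X XP _] : exists2 X, X \notin pts P0 & true.
  by apply: (rank_lt_neq0 C); rewrite rP0.
have [rS capS hS _] := key X XP.
have [Q [QL zQ]] : exists Q, Q \in L i j /\ ~~ (z <= v Q)%MS.
  by case/orP: (not_both ij z0) => hz; [exists i; rewrite line_pts_l | exists j; rewrite line_pts_r].
have [R [RL zR]] : exists R, R \in L k l /\ ~~ (z <= v R)%MS.
  by case/orP: (not_both kl z0) => hz; [exists k; rewrite line_pts_l | exists l; rewrite line_pts_r].
have QP : (v Q <= v i + v j)%MS by rewrite inE in QL.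
have RK : (v R <= v k + v l)%MS by rewrite inE in RL.
have RP : R \in pts P0 by rewrite inE (submx_trans RK) // addsmxSr.
have Xij : ~~ (v X <= v i + v j)%MS.
  by apply: contra XP => hX; rewrite inE (submx_trans hX) // addsmxSl.
have XQ : X != Q by apply: contraNneq Xij => ->.
have XR : X != R by apply: contraNneq XP => ->.
have zXQ : ~~ (z <= v X + v Q)%MS.
  apply: contra Xij => hz; rewrite addsmxC in hz.
  by apply: submx_trans (row_exchange zQ hz) _; rewrite addsmx_sub QP.
have QS : Q \in pts (v i + v j + v X)%MS by rewrite inE (submx_trans QP) // addsmxSl.
have XS : X \in pts (v i + v j + v X)%MS by rewrite inE addsmxSr.
have wXQ : (2 <= w X Q)%N.
  by apply: not_lambda_long => //; apply: contraR zXQ; exact: hS.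
(* [X'] is a third point of the line from [X] to a point [R] of [L k l] other than [z]. It lies off
   the plane of [L i j] and [X], so the line from [X'] through [z] is skew to [L X Q]. *)
have [X' [X'L X'X X'R]] : exists X', [/\ X' \in L X R, X' != X & X' != R].
  have : (0 < #|L X R :\ X :\ R|)%N.
    have := cardsD1 R (L X R :\ X); rewrite in_setD1 eq_sym XR line_pts_r card_block //=.
    by have := leq_mul (leqnn s) (line_weight_gt0 C XR); move: s7; clear; lia.
  by move/card_gt0P => [X']; rewrite !in_setD1 => /and3P [h1 h2 h3']; exists X'.
have XX'R : (v X <= v X' + v R)%MS.
  by have := line_pts_l v X R; rewrite -(line_pts_eq v0 v_inj XR X'L (line_pts_r _ _ _) X'R) inE.
have X'P : X' \notin pts P0.
  apply: contra XP => hX'; move: hX' RP; rewrite !inE => hX' hR.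
  by apply: submx_trans XX'R _; rewrite addsmx_sub hX'.
have [_ _ _ [Y [_ YX' pY zY]]] := key X' X'P.
have zX' : ~~ (z <= v X')%MS.
  apply: contra X'P => hz; rewrite inE; apply: submx_trans (_ : (z <= P0)%MS).
    by apply: rank_eq_sub hz _; rewrite !rank_rV z0 v0.
  by rewrite (submx_trans zi) // addsmxSl.
have X'S : ~~ (v X' <= v i + v j + v X)%MS.
  apply/negP => hX'; case/negP: zR; apply: capS => //; rewrite ?v0 //.
  have : R \in L X X' by rewrite (line_pts_eq v0 v_inj XR (line_pts_l _ _ _) X'L) ?line_pts_r // eq_sym.
  rewrite inE => hR; apply: submx_trans hR _; rewrite addsmx_sub hX' andbT addsmxSr //.
have X'Y : X' != Y by rewrite eq_sym.
have : \rank (v X + v Q + (v X' + v Y))%MS == 4%N.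
  have -> : \rank (v X + v Q + (v X' + v Y))%MS = \rank (v X + v Q + z + v X')%MS.
    apply/eqP; rewrite eqn_leq; apply/andP; split; apply: mxrankS.
      rewrite addsmx_sub; apply/andP; split.
        by rewrite (submx_trans _ (addsmxSl _ _)) // addsmxSl.
      rewrite addsmx_sub addsmxSr /=; apply: submx_trans (row_exchange zX' zY) _.
      by rewrite addsmx_sub addsmxSr (submx_trans _ (addsmxSl _ _)) // addsmxSr.
    rewrite addsmx_sub; apply/andP; split.
      rewrite addsmx_sub addsmxSl /=; apply: submx_trans zY _; exact: addsmxSr.
    by rewrite (submx_trans _ (addsmxSr _ _)) // addsmxSl.
  rewrite rank_adds1; first by rewrite rank_adds1 // (rank_line v0 v_inj).
  apply: contra X'S => hX'; apply: submx_trans hX' _.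
  rewrite !addsmx_sub addsmxSr /= (submx_trans QP) ?addsmxSl //= (submx_trans zi) // addsmxSl //.
by apply/negP; exact: H.
Qed.

(** If the two lines coincide, a line joining [i] to a point off them replaces the long one when its
    weight is at least 2, and the other one when its weight is 1. *)
Lemma long_lambda k l i j : k != l -> i != j -> (2 <= w k l)%N ->
  ~~ (p %| w i j)%N -> linear_config s v.
Proof.
move=> kl ij wkl pw; have [e|] := eqVneq (L i j) (L k l); last exact: long_lambda_distinct.
have [X XL _] : exists2 X, X \notin pts (v i + v j)%MS & true.
  by apply: (rank_lt_neq0 C); rewrite (rank_line v0 v_inj ij); move: h3; clear; lia.
have iX : i != X by apply: contraNneq XL => <-; exact: line_pts_l.
have LX : L i X != L i j by apply: contraNneq XL => e'; rewrite -[pts _]/(L i j) -e' line_pts_r.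
have [w2|w1] := ltnP 1 (w i X).
  by apply: (long_lambda_distinct iX ij w2 pw); rewrite eq_sym.
have w1' : w i X = 1%N by have := line_weight_gt0 C iX; move: w1; clear; lia.
apply: (long_lambda_distinct kl iX wkl); last by rewrite -e.
by rewrite w1' dvdn1; apply: contraTneq p11 => ->.
Qed.

End LongLines.

(** * All lines of weight one *)

Section SimpleLines.
Variables (F : finFieldType) (I : finType) (h p s : nat) (v : I -> 'rV[F]_h).
Hypothesis C : config p s v.
Local Notation L := (line_pts v).
Local Notation pts := (pts v).
Local Notation w := (line_weight s v).
Local Notation onB := (onB v).
Local Notation Fs := (frob_fixed F s).

Let s7 := cf_s7 C.
Let v0 := cf_v0 C.
Let v_inj := cf_inj C.
Let sF := pchar_nat_s C.
Let s1 : (1 < s)%N := leq_trans (isT : (1 < 7)%N) s7.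

Hypothesis simple : forall i j, i != j -> w i j = 1%N.

Lemma line_sum u z : onB u -> onB z -> ~~ (u <= z)%MS -> onB (u + z) ->
  forall l, onB (z + l *: u) = (l \in Fs).
Proof.
move=> /(onBP C) [i [ci [ci0 uE]]] /(onBP C) [j [cj [cj0 zE]]] uz.
have ij : i != j.
  apply: contra uz => /eqP ij; rewrite uE zE ij scalemx_sub //.
  by rewrite eqmx_scale.
by apply: (simple_line_Fs C ij (simple ij)); [exists ci | exists cj].
Qed.

Section Base.
Variable P : I.
Local Notation pv := (v P).

(* [hat x] means that the line joining [x] to the point [P] of [B] consists, apart
   from [P], of the points represented by [x + l *: v P] with [l] in [Fs]. *)
Definition hat x := ~~ (x <= pv)%MS && [forall (l | l \in Fs), onB (x + l *: pv)].

Lemma hatP x : reflect (~~ (x <= pv)%MS /\ forall l, l \in Fs -> onB (x + l *: pv)) (hat x).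
Proof. by apply: (iffP andP) => -[h1 h2]; split=> //; apply/forall_inP. Qed.

Lemma hat_onB x : hat x -> onB x.
Proof. by case/hatP => _ /(_ 0 (Fs0 F s1)); rewrite scale0r addr0. Qed.

Lemma hat_lineE x : hat x -> forall l, onB (x + l *: pv) = (l \in Fs).
Proof.
move=> hx; have /hatP [xp hl] := hx; apply: line_sum => //.
- exact: onB_v C P.
- exact: hat_onB.
- apply: contra xp => px; apply: rank_eq_sub px _.
  by rewrite !rank_rV v0 (onB_nz (hat_onB hx)).
by have := hl 1 (Fs1 F s); rewrite scale1r addrC.
Qed.

Lemma hat_rep Q : Q != P -> exists c, c != 0 /\ hat (c *: v Q).
Proof.
move=> QP; have [R [RL RQ RP]] : exists R, [/\ R \in L Q P, R != Q & R != P].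
  have : (0 < #|L Q P :\ Q :\ P|)%N.
    have := cardsD1 P (L Q P :\ Q); rewrite in_setD1 eq_sym QP line_pts_r (card_block C) // simple //=.
    by move: s7; clear; lia.
  by move/card_gt0P => [R]; rewrite !in_setD1 => /and3P [h1 h2 h3']; exists R.
have [al [be ke]] : exists al be, v R = al *: v Q + be *: pv.
  by apply: row_addsP; rewrite inE in RL.
have al0 : al != 0.
  apply: contraNneq RP => e; apply/eqP/v_inj.
  by rewrite ke e scale0r add0r scalemx_sub.
have be0 : be != 0.
  apply: contraNneq RQ => e; apply/eqP/v_inj.
  by rewrite ke e scale0r addr0 scalemx_sub.
have c0 : be^-1 * al != 0 by rewrite mulf_neq0 ?invr_eq0.
exists (be^-1 * al); split=> //; apply/hatP.
have nl : ~~ ((be^-1 * al) *: v Q <= pv)%MS.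
  by apply: contra QP => hs; apply/eqP/v_inj; rewrite (eqmx_scale _ c0) in hs.
split=> // l lF; rewrite (@line_sum pv) //.
- exact: onB_v C P.
- by apply: (onBZ C) => //; exact: onB_v C Q.
- apply: contra nl => px; apply: rank_eq_sub px _.
  by rewrite !rank_rV v0 leq_b1.
have -> : pv + (be^-1 * al) *: v Q = be^-1 *: v R.
  by rewrite ke scalerDr !scalerA mulVf // scale1r addrC.
by apply: (onBZ C); rewrite ?invr_eq0 //; exact: onB_v C R.
Qed.

Lemma hatZ c x : c \in Fs -> c != 0 -> hat x -> hat (c *: x).
Proof.
move=> cF c0 /hatP [xp hx]; apply/hatP; split; first by rewrite (eqmx_scale _ c0).
move=> l lF; have -> : c *: x + l *: pv = c *: (x + (c^-1 * l) *: pv).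
  by rewrite scalerDr scalerA mulrA divff // mul1r.
by apply: (onBZ C) => //; apply: hx; rewrite (FsM _ lF) // FsV.
Qed.

Lemma hatN x : hat x -> hat (- x).
Proof.
by move=> hx; rewrite -scaleN1r hatZ // ?(FsN sF) ?(Fs1 F s) // oppr_eq0 oner_neq0.
Qed.

Lemma hat_shift m x : m \in Fs -> hat x -> hat (x + m *: pv).
Proof.
move=> mF /hatP [xp hx]; apply/hatP; split.
  apply: contra xp => hs; rewrite -[x](addrK (m *: pv)) addmx_sub //.
  by rewrite eqmx_opp scalemx_sub.
by move=> l lF; rewrite -addrA -scalerDl hx // (FsD sF).
Qed.

(** The map [l -> c^-1 (e + l)] carries [Fs] into itself; its values at 0 and 1 determine [c] and
    [e]. *)
Lemma hat_ratio x c e : hat x -> c != 0 -> hat (c *: x + e *: pv) -> c \in Fs /\ e \in Fs.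
Proof.
move=> hx c0 /hatP [_ hc].
have key l : l \in Fs -> c^-1 * (e + l) \in Fs.
  move=> lF; rewrite -(hat_lineE hx) -(onBZE C _ c0) scalerDr scalerA mulrA divff // mul1r.
  by rewrite scalerDl addrA hc.
have cF : c \in Fs.
  have := FsD sF (key 1 (Fs1 F s)) (FsN sF (key 0 (Fs0 F s1))).
  by rewrite -mulrBr addr0 addrAC subrr add0r mulr1 => /(FsV); rewrite invrK.
by split=> //; have := FsM cF (key 0 (Fs0 F s1)); rewrite addr0 mulrA divff // mul1r.
Qed.

Lemma indep_row (X1 X2 : 'rV[F]_h) a1 a2 c1 c2 : ~~ (X1 <= pv)%MS -> ~~ (X2 <= pv + X1)%MS ->
  c2 != 0 -> ~~ ((a1 *: X1 + c2 *: X2 + a2 *: pv)%R <= (X1 + c1 *: pv)%R)%MS.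
Proof.
move=> _ X2n c20; apply: contra X2n => /sub_rVP [t e].
have -> : X2 = (c2^-1 * (t * c1 - a2)) *: pv + (c2^-1 * (t - a1)) *: X1.
  apply: (scalerI c20); rewrite scalerDr !scalerA !mulrA divff // !mul1r.
  have -> : c2 *: X2 = (a1 *: X1 + c2 *: X2 + a2 *: pv) - a1 *: X1 - a2 *: pv.
    by apply/rowP => x; rewrite !mxE; ring.
  by rewrite e; apply/rowP => x; rewrite !mxE; ring.
exact: row_combS.
Qed.

(** Passing to [X1 + nu *: v P] and [X2 - nu *: v P] keeps the sum [X1 + X2], and [line_sum] then
    yields the coefficient [th = nu (1 - sg)] of [v P]. For [sg = 1] the same is done starting from
    another coefficient [c] of [X2]. *)
Lemma spread X1 X2 : hat X1 -> hat X2 -> ~~ (X2 <= pv + X1)%MS -> onB (X1 + X2) ->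
  forall sg th, sg \in Fs -> th \in Fs -> onB (X1 + sg *: X2 + th *: pv).
Proof.
move=> h1 h2 ind hB; have /hatP [n1 l1] := h1; have /hatP [n2 l2] := h2.
have neq1 sg th : sg \in Fs -> sg != 1 -> th \in Fs -> onB (X1 + sg *: X2 + th *: pv).
  move=> sF' sn tF; have d0 : 1 - sg != 0 by rewrite subr_eq0 eq_sym.
  pose nu := th / (1 - sg).
  have nF : nu \in Fs by rewrite (FsM tF) // FsV // (FsD sF) ?(Fs1 F s) // (FsN sF).
  have uB : onB (X2 - nu *: pv) by rewrite -scaleNr l2 // (FsN sF).
  have zB : onB (X1 + nu *: pv) by exact: l1.
  have nuz : ~~ ((X2 - nu *: pv)%R <= (X1 + nu *: pv)%R)%MS.
    have := @indep_row X1 X2 0 (- nu) nu 1 n1 ind (oner_neq0 _).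
    by rewrite scale0r add0r scale1r scaleNr.
  have sB : onB ((X2 - nu *: pv) + (X1 + nu *: pv)).
    by have -> : (X2 - nu *: pv) + (X1 + nu *: pv) = X1 + X2 by rewrite addrC addrACA subrr addr0.
  have := line_sum uB zB nuz sB sg; rewrite sF' => e.
  have -> : X1 + sg *: X2 + th *: pv = X1 + nu *: pv + sg *: (X2 - nu *: pv).
    have -> : th = nu - sg * nu by rewrite /nu; field.
    by apply/rowP => x; rewrite !mxE; ring.
  by rewrite e.
move=> sg th sF' tF; have [sg1|sn] := eqVneq sg 1; last exact: neq1.
have [c cF /andP [c0 c1]] := exists_Fs2 C.
have {}neq1 := neq1 c th cF c1 tF.
have uB : onB (c *: X2) by apply: (onBZ C) => //; exact: hat_onB.
have nuz : ~~ ((c *: X2)%R <= (X1 + th *: pv)%R)%MS.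
  by have := @indep_row X1 X2 0 0 th c n1 ind c0; rewrite !scale0r add0r addr0.
have sB : onB (c *: X2 + (X1 + th *: pv)).
  have -> : c *: X2 + (X1 + th *: pv) = X1 + c *: X2 + th *: pv by rewrite addrCA addrA.
  exact: neq1.
have := line_sum uB (l1 th tF) nuz sB c^-1; rewrite FsV // scalerA mulVf // scale1r => e.
by rewrite sg1 scale1r addrAC e.
Qed.

(* Two lines of [s + 1] points through [P] leave [s^2] pairs of points, one on each,
   and every pair spans a line with [s - 1] further points.  If a plane has at most
   [Nbig] points, these lines cannot all be disjoint off the two given ones. *)
Definition Nbig := (s * s * (s - 1) + 2 * s)%N.

(** Two different pairs whose lines share a point [Y] give two expressions of [v Y]. Comparing them
    puts the ratio [rho] of its coefficients into [Fs], and [spread], applied to one of the pairs,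
    then reaches every [x1 + x2 + l *: v P] with [l] in [Fs]. *)
Lemma hat_sum x1 x2 : hat x1 -> hat x2 -> ~~ (x2 <= pv + x1)%MS ->
  (#|pts (pv + x1 + x2)%MS| <= Nbig)%N -> hat (x1 + x2).
Proof.
move=> h1 h2 ind small; have /hatP [n1 l1] := h1; have /hatP [n2 l2] := h2.
set T := (pv + x1 + x2)%MS in small.
have x1_0 := onB_nz (hat_onB h1); have x2_0 := onB_nz (hat_onB h2).
have comb0 a c e : a *: x1 + c *: x2 + e *: pv = 0 -> [/\ a = 0, c = 0 & e = 0].
  move=> E; have c0 : c = 0.
    apply/eqP; apply: contraT => cn; case/negP: (@indep_row x1 x2 a e 0 c n1 ind cn).
    by rewrite E sub0mx.
  move: E; rewrite c0 scale0r addr0 => E; have a0 : a = 0.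
    apply/eqP; apply: contraT => an; case/negP: n1; apply/sub_rVP; exists (- (a^-1 * e)).
    apply: (scalerI an); rewrite scalerA mulrN mulrA divff // mul1r scaleNr.
    by apply/eqP; rewrite -addr_eq0 E.
  move: E; rewrite a0 scale0r add0r => /eqP; rewrite scaler_eq0 (negPf (v0 P)) orbF => /eqP ->.
  by split.
pose ix (x : 'rV[F]_h) := odflt P [pick k | (x <= v k)%MS].
have ixP x : onB x -> exists c, c != 0 /\ v (ix x) = c *: x.
  move=> /andP [x0 /existsP [k kP]]; rewrite /ix; case: pickP => [k' k'P|/(_ k)]; last by rewrite kP.
  have /sub_rVP [c e] := k'P; have c0 : c != 0 by apply: contraNneq x0 => c0; rewrite e c0 scale0r.
  by exists c^-1; rewrite invr_eq0; split=> //=; rewrite e scalerA mulVf // scale1r.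
pose A l := ix (x1 + l *: pv); pose B m := ix (x2 + m *: pv).
pose D lm : {set I} := if (lm.1 \in Fs) && (lm.2 \in Fs)
  then L (A lm.1) (B lm.2) :\ A lm.1 :\ B lm.2 else set0.
have DP lm Y : Y \in D lm -> exists a c, [/\ lm.1 \in Fs, lm.2 \in Fs, a != 0, c != 0 &
    v Y = a *: (x1 + lm.1 *: pv) + c *: (x2 + lm.2 *: pv)].
  rewrite /D; case: ifP => [/andP [lF mF]|]; last by move=> _; rewrite inE.
  rewrite !in_setD1 => /and3P [YB YA]; rewrite inE => /row_addsP [a [c e]].
  have [ca [ca0 eA]] := ixP _ (l1 _ lF); have [cb [cb0 eB]] := ixP _ (l2 _ mF).
  exists (a * ca), (c * cb); split=> //.
  - rewrite mulf_neq0 //; apply: contraNneq YB => a0; apply/eqP/v_inj.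
    by rewrite e a0 scale0r add0r scalemx_sub.
  - rewrite mulf_neq0 //; apply: contraNneq YA => c0; apply/eqP/v_inj.
    by rewrite e c0 scale0r addr0 scalemx_sub.
  by rewrite e -!scalerA -eA -eB.
have AB l m : l \in Fs -> m \in Fs -> A l != B m.
  move=> lF mF; apply/eqP => e.
  have [ca [ca0 eA]] := ixP _ (l1 _ lF); have [cb [cb0 eB]] := ixP _ (l2 _ mF).
  have := comb0 (- ca) cb (cb * m - ca * l); case=> [|_ cb' _]; last by rewrite cb' eqxx in cb0.
  have : v (B m) - v (A l) = 0 by rewrite e subrr.
  by rewrite eA eB => <-; apply/rowP => x; rewrite !mxE; ring.
have cD lm : lm.1 \in Fs -> lm.2 \in Fs -> #|D lm| = (s - 1)%N.
  move=> lF mF; rewrite /D lF mF /=; have ab := AB _ _ lF mF.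
  have := cardsD1 (B lm.2) (L (A lm.1) (B lm.2) :\ A lm.1).
  by rewrite in_setD1 eq_sym ab line_pts_r (card_block C) // simple // muln1 /=; clear; lia.
have [Q1 [c1 [c10 x1E]]] := onBP C _ (hat_onB h1).
have [Q2 [c2 [c20 x2E]]] := onBP C _ (hat_onB h2).
pose N := pts T :\: (L P Q1 :|: L P Q2).
have Q1x : v Q1 = c1^-1 *: x1 by rewrite x1E scalerA mulVf // scale1r.
have Q2x : v Q2 = c2^-1 *: x2 by rewrite x2E scalerA mulVf // scale1r.
have pT : (pv <= T)%MS by rewrite /T -addsmxA addsmxSl.
have x1T : (x1 <= T)%MS by rewrite (submx_trans _ (addsmxSl _ _)) // addsmxSr.
have x2T : (x2 <= T)%MS by rewrite addsmxSr.
have PQ1 : P != Q1.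
  by apply: contra n1 => /eqP e; rewrite x1E -e scalemx_sub.
have PQ2 : P != Q2.
  by apply: contra n2 => /eqP e; rewrite x2E -e scalemx_sub.
have LT1 : L P Q1 \subset pts T.
  by apply: ptsS; rewrite addsmx_sub pT /= Q1x scalemx_sub.
have LT2 : L P Q2 \subset pts T.
  by apply: ptsS; rewrite addsmx_sub pT /= Q2x scalemx_sub.
have LI : L P Q1 :&: L P Q2 = [set P].
  apply/eqP; rewrite eqEsubset; apply/andP; split; last by rewrite sub1set inE !line_pts_l.
  apply/subsetP => Y; rewrite in_setI in_set1 => /andP []; rewrite !inE.
  move=> /row_addsP [a [c e]] /row_addsP [a' [c' e']]; apply/eqP/v_inj.
  have := comb0 (c * c1^-1) (- (c' * c2^-1)) (a - a'); case=> [|cc _ _].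
    have : v Y - v Y = 0 by rewrite subrr.
    by rewrite {1}e e' Q1x Q2x => <-; apply/rowP => x; rewrite !mxE; ring.
  move/eqP: cc; rewrite e mulf_eq0 invr_eq0 (negPf c10) orbF => /eqP ->.
  by rewrite scale0r addr0 scalemx_sub.
have cN : (#|N| + (2 * s + 1) = #|pts T|)%N.
  have cU : #|L P Q1 :|: L P Q2| = (2 * s + 1)%N.
    have := cardsUI (L P Q1) (L P Q2); rewrite LI cards1 !(card_line C) // !simple // muln1.
    by clear; lia.
  rewrite -cU addnC -(cardsID (L P Q1 :|: L P Q2) (pts T)) (setIidPr _) //.
  by rewrite subUset LT1.
have DN lm : D lm \subset N.
  apply/subsetP => Y YD; have [a [c [lF mF a0 c0 e]]] := DP _ _ YD.
  rewrite in_setD in_setU negb_or; apply/andP; split; last first.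
    rewrite inE e; apply: addmx_sub; apply: scalemx_sub; apply: addmx_sub; rewrite ?scalemx_sub //.
  apply/andP; split; apply/negP; rewrite inE => /row_addsP [a' [c' e']].
    have := comb0 (a - c' * c1^-1) c (a * lm.1 + c * lm.2 - a'); case=> [|_ c_0 _]; last by rewrite c_0 eqxx in c0.
    have : v Y - v Y = 0 by rewrite subrr.
    by rewrite {1}e e' Q1x => <-; apply/rowP => x; rewrite !mxE; ring.
  have := comb0 a (c - c' * c2^-1) (a * lm.1 + c * lm.2 - a'); case=> [|a_0 _ _]; last by rewrite a_0 eqxx in a0.
  have : v Y - v Y = 0 by rewrite subrr.
  by rewrite {1}e e' Q2x => <-; apply/rowP => x; rewrite !mxE; ring.
have [Y [lm [lm' [YD YD' ne]]]] : exists Y lm lm', [/\ Y \in D lm, Y \in D lm' & lm != lm'].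
  case: (boolP [exists Y, (1 < #|[set lm | Y \in D lm]|)%N]) => [/existsP [Y /card_gt1P [lm [lm' []]]]|].
    by rewrite !inE => h1' h2' h3'; exists Y, lm, lm'.
  rewrite negb_exists => /forallP none; exfalso.
  have : (\sum_lm #|D lm| <= #|N|)%N.
    rewrite (eq_bigr (fun lm => \sum_Y (Y \in D lm))%N); last first.
      by move=> lm _; rewrite -sum1_card big_mkcond /=; apply: eq_bigr => Y _; case: (_ \in _).
    rewrite exchange_big /= -sum1_card big_mkcond [X in (_ <= X)%N]big_mkcond /=; apply: leq_sum => Y _.
    have e : (\sum_lm (Y \in D lm) = #|[set lm | Y \in D lm]|)%N.
      by rewrite -sum1_card [RHS]big_mkcond /=; apply: eq_bigr => lm _; rewrite inE; case: (_ \in _).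
    rewrite e; case: (boolP (Y \in N)) => YN; first by have := none Y; rewrite -leqNgt.
    rewrite leqn0 cards_eq0; apply/eqP/setP => lm; rewrite !inE; apply/negP => YD.
    by case/negP: YN; exact: (subsetP (DN lm)).
  apply/negP; rewrite -ltnNge.
  have : (\sum_(lm in setX Fs Fs) #|D lm| <= \sum_lm #|D lm|)%N.
    by rewrite [X in (_ <= X)%N](bigID (mem (setX Fs Fs))) /=; exact: leq_addr.
  apply: leq_trans; rewrite (eq_bigr (fun=> s - 1)%N); last first.
    by move=> [l m]; rewrite in_setX /= => /andP [lF mF]; apply: cD.
  rewrite sum_nat_const cardsX (cardFs C).
  by move: cN small; rewrite /Nbig; clear; lia.
have [a [c [lF mF a0 c0 e]]] := DP _ _ YD; have [a' [c' [lF' mF' a0' c0' e']]] := DP _ _ YD'.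
have [ea ec E3] : [/\ a - a' = 0, c - c' = 0 & (a * lm.1 + c * lm.2) - (a' * lm'.1 + c' * lm'.2) = 0].
  apply: comb0; have : v Y - v Y = 0 by rewrite subrr.
  by rewrite {1}e e' => <-; apply/rowP => x; rewrite !mxE; ring.
move/eqP: ea; rewrite subr_eq0 => /eqP ea; move/eqP: ec; rewrite subr_eq0 => /eqP ec.
have E4 : a * (lm.1 - lm'.1) = - (c * (lm.2 - lm'.2)).
  by apply/eqP; rewrite -addr_eq0 -[X in _ == X]E3 -ea -ec; apply/eqP; ring.
have mn : lm.2 - lm'.2 != 0.
  apply: contra ne => /eqP m0; move: E4; rewrite m0 mulr0 oppr0 => /eqP.
  rewrite mulf_eq0 (negPf a0) /= subr_eq0 => /eqP l0; move/eqP: m0; rewrite subr_eq0 => /eqP m0.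
  by rewrite [lm]surjective_pairing [lm']surjective_pairing l0 m0.
set rho := c / a.
have rhoE : rho = - ((lm.1 - lm'.1) / (lm.2 - lm'.2)).
  apply: (mulfI a0); apply: (mulIf mn); rewrite mulrN mulNr -!mulrA mulVf // mulr1 /rho.
  by rewrite E4 opprK; field.
have rF : rho \in Fs.
  rewrite rhoE (FsN sF) // (FsM _ (FsV _)) // ?(FsD sF) // ?(FsN sF) //.
have r0 : rho != 0 by rewrite mulf_neq0 // invr_eq0.
pose X1 := x1 + lm.1 *: pv; pose X2 := rho *: (x2 + lm.2 *: pv).
have hX1 : hat X1 by exact: hat_shift.
have hX2 : hat X2 by apply: hatZ => //; exact: hat_shift.
have XB : onB (X1 + X2).
  have -> : X1 + X2 = a^-1 *: v Y.
    by rewrite e scalerDr !scalerA mulVf // scale1r [a^-1 * c]mulrC.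
  by apply: (onBZ C); rewrite ?invr_eq0 //; exact: onB_v C Y.
have indX : ~~ (X2 <= pv + X1)%MS.
  apply/negP => /row_addsP [a3 [c3 e3]].
  have := comb0 (- c3) rho (rho * lm.2 - a3 - c3 * lm.1); case=> [|_ r_0 _].
    have : X2 - X2 = 0 by rewrite subrr.
    by rewrite {2}e3 => <-; apply/rowP => x; rewrite !mxE; ring.
  by rewrite r_0 eqxx in r0.
apply/hatP; split.
  apply/negP => /sub_rVP [t et]; have := comb0 1 1 (- t); case=> [|/eqP].
    by rewrite !scale1r scaleNr et subrr.
  by rewrite oner_eq0.
move=> l lF2.
have := spread hX1 hX2 indX XB (FsV rF) (FsD sF (FsD sF lF2 (FsN sF lF)) (FsN sF mF)).
rewrite /X1 /X2 scalerA mulVf // scale1r.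
congr (onB _); apply/rowP => x; rewrite !mxE; ring.
Qed.

End Base.
End SimpleLines.

(** After subtracting the overlaps the four families still have more than [s^3 + 2 s^2 - 4 s]
    members, while [d < s^2 + 2 s] and [s >= 7]. *)
Lemma arith_three_big s d nJ a1 a2 a3 u1 u2 u3 i1 i2 i3 nsg : (7 <= s)%N ->
  (u3 <= s * s * s + d)%N -> (d < s * (s + 2))%N ->
  (u1 + i1 = nJ + a1)%N -> (u2 + i2 = u1 + a2)%N -> (u3 + i3 = u2 + a3)%N ->
  (i1 <= s + 1)%N -> (i2 <= s + 2)%N -> (i3 <= s + 3)%N ->
  (s * s - s + 2 <= a1)%N -> (s * s - s + 2 <= a2)%N -> (s * s - s + 2 <= a3)%N ->
  (s * s * (s - 1) + 2 * s < nsg)%N -> nJ = nsg -> False.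
Proof.
move=> s7 tot dl e1 e2 e3 j1 j2 j3 c1 c2 c3 bsg cJ.
have ss : (s <= s * s)%N by rewrite leq_pmulr //; move: s7; clear; lia.
have sss : (7 * (s * s) <= s * s * s)%N by rewrite -[(s * s * s)%N]mulnA leq_mul2r s7 orbT.
have s7s : (7 * s <= s * s)%N by rewrite leq_mul2r s7 orbT.
have f1 : (s * s * (s - 1) = s * s * s - s * s)%N by rewrite mulnBr muln1.
have f2 : (s * (s + 2) = s * s + 2 * s)%N by rewrite mulnDr [(s * 2)%N]mulnC.
rewrite f1 in bsg; rewrite f2 in dl.
lia.
Qed.

Section AllSimple.
Variables (F : finFieldType) (I : finType) (h p s : nat) (v : I -> 'rV[F]_h).
Hypothesis C : config p s v.
Local Notation q := #|F|.
Local Notation b := #|I|.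
Local Notation L := (line_pts v).
Local Notation pts := (pts v).
Local Notation w := (line_weight s v).
Local Notation Fs := (frob_fixed F s).
Local Notation hat := (hat s v).

Let s7 := cf_s7 C.
Let v0 := cf_v0 C.
Let v_inj := cf_inj C.
Let sF := pchar_nat_s C.
Let s1 : (1 < s)%N := leq_trans (isT : (1 < 7)%N) s7.

Hypothesis simple : forall i j, i != j -> w i j = 1%N.

(** The linear set consists of the vectors satisfying [hat] and the [Fs]-multiples of [v P]. Sums of
    vectors dependent modulo [v P] are settled by [hat_ratio]. *)
Lemma hat_closed_linear P :
  (forall x1 x2, hat P x1 -> hat P x2 -> ~~ (x2 <= v P + x1)%MS -> hat P (x1 + x2)) ->
  linear_config s v.
Proof.
move=> cl; exists [set x | hat P x || [exists l, (l \in Fs) && (x == l *: v P)]]; split.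
- by rewrite inE; apply/orP; right; apply/existsP; exists 0; rewrite Fs0 // scale0r eqxx.
- move=> c x y cF; rewrite !inE.
  have [->|c0] := eqVneq c 0; first by rewrite scale0r add0r.
  case/orP=> [hx|/existsP [l /andP [lF /eqP ->]]]; last first.
    rewrite scalerA; case/orP=> [hy|/existsP [m /andP [mF /eqP ->]]].
      by rewrite addrC (hat_shift C) // (FsM cF).
    by rewrite -scalerDl; apply/orP; right; apply/existsP; exists (c * l + m);
      rewrite eqxx andbT (FsD sF) // (FsM cF).
  have := hatZ C cF c0 hx; move: (c *: x) => {hx} z hz.
  case/orP=> [hy|/existsP [m /andP [mF /eqP ->]]]; last by rewrite (hat_shift C).
  case: (boolP (y <= v P + z)%MS) => [|yz]; last by rewrite cl.
  move=> /row_addsP [a [e ye]]; have e0 : e != 0.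
    by apply: contraTneq hy => e0; apply/negP => /hatP [+ _]; rewrite ye e0 scale0r addr0 scalemx_sub.
  have [eF aF] : e \in Fs /\ a \in Fs.
    by apply: (hat_ratio C simple hz e0); rewrite addrC -ye.
  have -> : z + y = (1 + e) *: z + a *: v P by rewrite ye scalerDl scale1r addrA addrAC.
  have [->|n0] := eqVneq (1 + e) 0.
    by rewrite scale0r add0r; apply/orP; right; apply/existsP; exists a; rewrite aF eqxx.
  by rewrite (hat_shift C) // (hatZ C) // (FsD sF) // Fs1.
- move=> i; have [->|iP] := eqVneq i P.
    exists 1; first exact: oner_neq0.
    rewrite inE scale1r; apply/orP; right; apply/existsP; exists 1.
    by rewrite Fs1 scale1r eqxx.
  by have [c [c0 hc]] := hat_rep C simple iP; exists c => //; rewrite inE hc.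
move=> x; rewrite inE => /orP [hx _|/existsP [l /andP [_ /eqP ->]]]; first exact: (hat_onB C hx).
by rewrite scaler_eq0 negb_or => /andP [l0 _]; apply: (onBZ C) => //; exact: onB_v C P.
Qed.

(** For [h >= 5] there is room for a line skew to the plane; its weight is 1, which is prime to
    [p]. *)
Lemma big_plane_ge5 P (T : 'M[F]_h) : (11 <= s)%N -> (11 <= p)%N -> (5 <= h)%N ->
  P \in pts T -> \rank T = 3%N -> (2 * s ^ 2 <= #|pts T|)%N -> linear_config s v.
Proof.
move=> s11 p11 h5 PT rT nT.
have [a aT _] : exists2 k, k \notin pts T & true by apply: (rank_lt_neq0 C); rewrite rT; move: h5; clear; lia.
have aT' : ~~ (v a <= T)%MS by rewrite inE in aT.
have rTa : \rank (T + v a)%MS = 4%N by rewrite rank_adds1 // rT.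
have [c cT _] : exists2 k, k \notin pts (T + v a)%MS & true.
  by apply: (rank_lt_neq0 C); rewrite rTa; move: h5; clear; lia.
have cT' : ~~ (v c <= T + v a)%MS by rewrite inE in cT.
have ac : a != c by apply: contraNneq cT' => <-; exact: addsmxSr.
apply: (main_star_skew C s11 p11 PT rT _ nT ac).
- by move: h5; clear; lia.
- by rewrite addsmxA rank_adds1 // rTa.
- by rewrite (simple ac) dvdn1; apply/eqP => p1; move: p11; rewrite p1.
Qed.

Lemma card_rank2 (U : 'M[F]_h) : (\rank U <= 2)%N -> (#|pts U| <= s + 1)%N.
Proof.
move=> rU; case: (leqP #|pts U| 1) => [h1|]; first by apply: leq_trans h1 _; rewrite addn1.
move/card_gt1P => [i [j [iU jU ij]]].
have LU : (v i + v j <= U)%MS by rewrite addsmx_sub; rewrite !inE in iU jU; rewrite iU.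
have UL : (U <= v i + v j)%MS by apply: rank_eq_sub => //; rewrite (rank_line v0 v_inj ij).
apply: leq_trans (subset_leq_card (ptsS v UL)) _.
by rewrite -[pts (v i + v j)%MS]/(L i j) (card_line C) // simple // muln1 addnC.
Qed.

Lemma rank_capmx_proper (U V : 'M[F]_h) : ~~ (U <= V)%MS -> (\rank (U :&: V) < \rank U)%N.
Proof.
move=> UV; rewrite ltn_neqAle mxrankS ?capmxSl // andbT; apply: contra UV => /eqP e.
by apply: submx_trans (capmxSr U V); apply: rank_eq_sub; rewrite ?capmxSl // e.
Qed.

Lemma pts_cap (U V : 'M[F]_h) : pts U :&: pts V = pts (U :&: V)%MS.
Proof. by apply/setP => i; rewrite !inE sub_capmx. Qed.

Lemma card_pencil_simple P (S : {set I}) : P \in S -> closed_set v S ->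
  (#|S| = s * #|pencil v P S| + 1)%N.
Proof.
move=> PS cS; rewrite (card_pencil v0 v_inj PS cS) (eq_bigr (fun=> s)).
  by rewrite sum_nat_const mulnC addn1.
move=> A /imsetP [j]; rewrite in_setD1 => /andP [jP _] ->.
by rewrite (card_block C) 1?eq_sym // simple 1?eq_sym // muln1.
Qed.

Lemma block_in_pts P j m (T : 'M[F]_(m, h)) : P \in pts T -> j != P ->
  L P j :\ P \in pencil v P (pts T) -> j \in pts T.
Proof.
move=> PT jP /imsetP [k]; rewrite in_setD1 => /andP [kP kT] e.
have : j \in L P j :\ P by rewrite in_setD1 jP line_pts_r.
rewrite e in_setD1 => /andP [_]; apply: subsetP; apply: (closed_pts (U := T)) => //.
by rewrite eq_sym.
Qed.

Lemma pencil_inter P (T1 T2 : 'M[F]_h) : P \in pts T1 -> P \in pts T2 ->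
  \rank T1 = 3%N -> ~~ (T1 <= T2)%MS ->
  (#|pencil v P (pts T1) :&: pencil v P (pts T2)| <= 1)%N.
Proof.
move=> P1 P2 r1 T12; apply/card_le1_eqP => A B; rewrite !in_setI.
case/andP=> /imsetP [i]; rewrite in_setD1 => /andP [iP iT1] ->{A} iT2.
case/andP=> /imsetP [j]; rewrite in_setD1 => /andP [jP jT1] ->{B} jT2.
have {}iT2 := block_in_pts P2 iP iT2; have {}jT2 := block_in_pts P2 jP jT2.
have r2 : (\rank (T1 :&: T2)%MS <= 2)%N.
  by have := rank_capmx_proper T12; rewrite r1.
have sub : (v P + v i <= T1 :&: T2)%MS.
  by rewrite addsmx_sub !sub_capmx; rewrite !inE in P1 P2 iT1 iT2; rewrite P1 P2 iT1 iT2.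
have sup : (T1 :&: T2 <= v P + v i)%MS.
  by apply: rank_eq_sub sub _; rewrite (rank_line v0 v_inj) // eq_sym.
have jL : j \in L P i.
  by rewrite inE; apply: submx_trans sup; rewrite !inE in jT1 jT2; rewrite sub_capmx jT1 jT2.
congr (_ :\ _); apply: (line_pts_eq v0 v_inj) => //; first by rewrite eq_sym.
  exact: line_pts_l.
by rewrite eq_sym.
Qed.

(* The lines joining [P] to the points of [sg], together with those through [P] in
   the three planes, would be more than the lines through [P]. *)
Lemma three_big (sg T1 T2 T3 : 'M[F]_h) P : h = 4%N -> P \notin pts sg ->
  P \in pts T1 -> P \in pts T2 -> P \in pts T3 ->
  \rank sg = 3%N -> \rank T1 = 3%N -> \rank T2 = 3%N -> \rank T3 = 3%N ->
  (Nbig s < #|pts sg|)%N -> (Nbig s < #|pts T1|)%N -> (Nbig s < #|pts T2|)%N ->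
  (Nbig s < #|pts T3|)%N ->
  ~~ (T1 <= T2)%MS -> ~~ (T1 <= T3)%MS -> ~~ (T2 <= T3)%MS -> False.
Proof.
move=> h4 Psg P1 P2 P3 rsg r1 r2 r3 bsg b1 b2 b3 n12 n13 n23.
pose J := [set L P j :\ P | j in pts sg].
pose A (T : 'M[F]_h) := pencil v P (pts T).
have neP j : j \in pts sg -> j != P by move=> js; apply: contraNneq Psg => <-.
have cJ : #|J| = #|pts sg|.
  rewrite /J card_in_imset // => i j is_ js e; apply/eqP; apply: contraNT Psg => ij.
  have jL : j \in L P i.
    have : j \in L P j :\ P by rewrite in_setD1 neP // line_pts_r.
    by rewrite -e in_setD1 => /andP [].
  have Pi : P != i by rewrite eq_sym neP.
  have e2 := line_pts_eq v0 v_inj Pi (line_pts_r v P i) jL ij.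
  have : P \in L i j by rewrite e2 line_pts_l.
  by apply: subsetP; exact: (closed_pts (U := sg)).
have cA T : P \in pts T -> (Nbig s < #|pts T|)%N -> (s * s - s + 2 <= #|A T|)%N.
  move=> PT; rewrite (card_pencil_simple PT (closed_pts (U := T) (v := v))) -/(A T) /Nbig => hb.
  rewrite leqNgt; apply/negP => lt.
  have : (s * #|A T| <= s * (s * s - s + 1))%N by rewrite leq_mul2l; apply/orP; right; move: lt; clear; lia.
  move: hb s7; clear; nia.
have cAJ T : P \in pts T -> \rank T = 3%N -> (#|A T :&: J| <= s + 1)%N.
  move=> PT rT; have Tsg : ~~ (T <= sg)%MS.
    by apply: contra Psg => /(ptsS v) /subsetP; apply.
  have sub : A T :&: J \subset [set L P j :\ P | j in pts (T :&: sg)%MS].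
    apply/subsetP => X; rewrite in_setI => /andP [XT /imsetP [j js Xe]].
    rewrite Xe; apply: imset_f; rewrite -pts_cap in_setI js andbT.
    by apply: (block_in_pts PT (neP _ js)); rewrite -Xe.
  apply: leq_trans (subset_leq_card sub) _; apply: leq_trans (leq_imset_card _ _) _.
  by apply: card_rank2; have := rank_capmx_proper Tsg; rewrite rT.
have cAA T T' : P \in pts T -> P \in pts T' -> \rank T = 3%N -> ~~ (T <= T')%MS ->
    (#|A T :&: A T'| <= 1)%N by exact: pencil_inter.
have tot : (#|J :|: A T1 :|: A T2 :|: A T3| <= s * s * s + excess F I s)%N.
  have sub : J :|: A T1 :|: A T2 :|: A T3 \subset pencil v P setT.
    have subA T : A T \subset pencil v P setT by apply: imsetS; rewrite setSD // subsetT.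
    rewrite !subUset !subA /= !andbT; apply/subsetP => X /imsetP [j js ->].
    by apply: imset_f; rewrite in_setD1 neP ?in_setT.
  apply: leq_trans (subset_leq_card sub) _.
  have := card_pencil_simple (in_setT P) (@closed_setT _ _ _ v).
  have qE : q = (s * (s * (s * s)))%N by rewrite (cf_q C) h4 !expnS expn0 muln1.
  rewrite cardsT (card_points_eq C) qE => e.
  rewrite -(@leq_pmul2l s); last by move: s7; clear; lia.
  by rewrite -(leq_add2r 1) -e mulnDr !mulnA addnAC.
have dl : (excess F I s < s * (s + 2))%N by have := excess_lt C; rewrite h4 expn1.
have i1 := cardsUI J (A T1); have i2 := cardsUI (J :|: A T1) (A T2).
have i3 := cardsUI (J :|: A T1 :|: A T2) (A T3).
have j1 : (#|J :&: A T1| <= s + 1)%N by rewrite setIC cAJ.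
have j2 : (#|(J :|: A T1) :&: A T2| <= s + 2)%N.
  rewrite setIUl; apply: leq_trans (leq_card_setU _ _) _.
  have k2 := cAJ _ P2 r2; rewrite setIC in k2.
  by apply: leq_trans (leq_add k2 (cAA _ _ P1 P2 r1 n12)) _; rewrite -addnA.
have j3 : (#|(J :|: A T1 :|: A T2) :&: A T3| <= s + 3)%N.
  rewrite !setIUl; apply: leq_trans (leq_card_setU _ _) _.
  have k3 := cAJ _ P3 r3; rewrite setIC in k3.
  have k4 := leq_trans (leq_card_setU _ _) (leq_add k3 (cAA _ _ P1 P3 r1 n13)).
  by apply: leq_trans (leq_add k4 (cAA _ _ P2 P3 r2 n23)) _; rewrite -!addnA.
have c1 := cA _ P1 b1; have c2 := cA _ P2 b2; have c3 := cA _ P3 b3.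
move: bsg cJ; rewrite /Nbig => bsg cJ.
exact: (arith_three_big s7 tot dl i1 i2 i3 j1 j2 j3 c1 c2 c3 bsg cJ).
Qed.

(* When the plane of [x] and [y] is big, write [x + y = (x + z) + (y - z)] with [z]
   outside the at most two big planes through [P]. *)
Lemma closed_off_big (sg : 'M[F]_h) P : h = 4%N -> P \notin pts sg -> \rank sg = 3%N ->
  (Nbig s < #|pts sg|)%N ->
  forall x y, hat P x -> hat P y -> ~~ (y <= v P + x)%MS -> hat P (x + y).
Proof.
move=> h4 Psg rsg bsg x y hx hy ind.
have rank3 (x1 x2 : 'rV[F]_h) : ~~ (x1 <= v P)%MS -> ~~ (x2 <= v P + x1)%MS ->
    \rank (v P + x1 + x2)%MS = 3%N.
  by move=> n1 n2; rewrite !rank_adds1 // rank_rV v0.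
have xP : ~~ (x <= v P)%MS by case/hatP: hx.
have yP : ~~ (y <= v P)%MS by case/hatP: hy.
set T1 := (v P + x + y)%MS.
have [small|big1] := leqP #|pts T1| (Nbig s); first exact: (hat_sum C simple).
have r1 : \rank T1 = 3%N by exact: rank3.
have P1 : P \in pts T1 by rewrite inE /T1 -addsmxA addsmxSl.
(* By [three_big] at most one other big plane passes through [P]; if there is none, [T1] itself
   serves as [T2]. *)
have [T2 [r2 P2 only]] : exists T2 : 'M[F]_h, [/\ \rank T2 = 3%N, P \in pts T2 &
    forall T : 'M[F]_h, \rank T = 3%N -> P \in pts T -> (Nbig s < #|pts T|)%N ->
      (T <= T1)%MS || (T <= T2)%MS].
  case: (boolP [exists T : 'M[F]_h, [&& \rank T == 3%N, P \in pts T, (Nbig s < #|pts T|)%N &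
      ~~ (T <= T1)%MS]]).
    move=> /existsP [T2 /and4P [/eqP r2 P2 b2 n21]]; exists T2; split=> // T rT PT bT.
    apply: contraT; rewrite negb_or => /andP [n1 n2].
    by case: (three_big h4 Psg PT P2 P1 rsg rT r2 r1 bsg bT b2 big1 n2 n1 n21).
  rewrite negb_exists => /forallP none; exists T1; split=> // T rT PT bT.
  by have := none T; rewrite rT eqxx PT bT /= negbK => ->.
have [i i1 i2] : exists2 i, i \notin pts T1 & i \notin pts T2.
  have : ~~ ([set: I] \subset pts T1 :|: pts T2).
    apply/negP => /subset_leq_card; rewrite cardsT.
    have := (leq_card_setU (pts T1) (pts T2)).1.
    have c1 := card_pts_small C (_ : (\rank T1 < h)%N); have c2 := card_pts_small C (_ : (\rank T2 < h)%N).
    have {}c1 : (1 + s * #|pts T1| <= b)%N by apply: c1; rewrite r1 {1}h4.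
    have {}c2 : (1 + s * #|pts T2| <= b)%N by apply: c2; rewrite r2 {1}h4.
    have m2 : (2 * #|pts T2| <= s * #|pts T2|)%N by rewrite leq_mul2r s1 orbT.
    have m1 : (2 * #|pts T1| <= s * #|pts T1|)%N by rewrite leq_mul2r s1 orbT.
    by move: c1 c2 m1 m2; clear; lia.
  case/subsetPn => i _; rewrite in_setU negb_or => /andP [i1 i2].
  by exists i.
have iP : i != P by apply: contraNneq i1 => ->.
have [c [c0 hz]] := hat_rep C simple iP.
have [e eF /andP [e0 e1]] := exists_Fs2 C.
have nzT (T : 'M[F]_h) a : i \notin pts T -> a != 0 -> ~~ (a *: v i <= T)%MS.
  by rewrite inE => iT a0; rewrite (eqmx_scale _ a0).
have xT1 : (x <= T1)%MS by rewrite /T1 (submx_trans _ (addsmxSl _ _)) // addsmxSr.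
have yT1 : (y <= T1)%MS by exact: addsmxSr.
have pT1 : (v P <= T1)%MS by rewrite inE in P1.
(* At most one of [c *: v i] and [e *: (c *: v i)] has its sum with [x] in [T2], because their
   difference is not in [T2]. *)
have [z [hz' z1 z2 xz2]] : exists z, [/\ hat P z, ~~ (z <= T1)%MS, ~~ (z <= T2)%MS & ~~ ((x + z)%R <= T2)%MS].
  case: (boolP ((x + c *: v i)%R <= T2)%MS) => [xz|xz]; last first.
    by exists (c *: v i); split=> //; apply: nzT.
  exists (e *: (c *: v i)); split.
  - exact: (hatZ C).
  - by rewrite scalerA; apply: nzT => //; rewrite mulf_neq0.
  - by rewrite scalerA; apply: nzT => //; rewrite mulf_neq0.
  apply/negP => xz'; have := nzT _ ((e - 1) * c) i2; rewrite mulf_neq0 ?subr_eq0 // => /(_ isT)/negP; apply.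
  have -> : ((e - 1) * c) *: v i = (x + e *: (c *: v i)) - (x + c *: v i).
    by apply/rowP => l; rewrite !mxE; ring.
  by rewrite addmx_sub // eqmx_opp.
have big_out (x1 x2 : 'rV[F]_h) : hat P x1 -> hat P x2 -> ~~ (x2 <= v P + x1)%MS ->
    ~~ (v P + x1 + x2 <= T1)%MS -> ~~ (v P + x1 + x2 <= T2)%MS -> hat P (x1 + x2).
  move=> h1 h2 i12 n1 n2; apply: (hat_sum C simple) => //; rewrite leqNgt; apply/negP => bT.
  have [n1' _] := hatP _ _ _ _ h1.
  have := only _ (rank3 _ _ n1' i12) _ bT; rewrite (negPf n1) (negPf n2); apply/implyP.
  by rewrite inE -addsmxA addsmxSl.
have pxT1 : (v P + x <= T1)%MS by exact: addsmxSl.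
have pyT1 : (v P + y <= T1)%MS by rewrite addsmx_sub pT1.
have hxz : hat P (x + z).
  apply: big_out => //.
  - by apply: contra z1 => zx; apply: submx_trans zx pxT1.
  - by apply: contra z1 => zx; apply: submx_trans zx; exact: addsmxSr.
  - by apply: contra z2 => zx; apply: submx_trans zx; exact: addsmxSr.
have hyz : hat P (y - z).
  apply: big_out => //; first exact: (hatN C).
  - by apply: contra z1 => zx; rewrite eqmx_opp in zx; apply: submx_trans zx pyT1.
  - by apply: contra z1 => zx; rewrite -eqmx_opp; apply: submx_trans zx; exact: addsmxSr.
  - by apply: contra z2 => zx; rewrite -eqmx_opp; apply: submx_trans zx; exact: addsmxSr.
have -> : x + y = (x + z) + (y - z) by rewrite addrA -[x + z + y]addrA [z + y]addrC addrA addrK.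
apply: big_out => //.
- apply/negP => /row_addsP [a [k e2]].
  have ez : (1 + k) *: z = y - a *: v P - k *: x.
    have -> : y = (y - z) + z by rewrite addrNK.
    by rewrite e2; apply/rowP => l; rewrite !mxE; ring.
  have [k1|k1] := eqVneq (1 + k) 0.
    case/negP: ind; have -> : y = a *: v P + k *: x; last exact: row_combS.
    by apply/eqP; rewrite -subr_eq0 opprD addrA -ez k1 scale0r.
  case/negP: z1; rewrite -(eqmx_scale _ k1) ez.
  by rewrite addmx_sub ?addmx_sub // eqmx_opp scalemx_sub.
- apply: contra z1 => sub; have xz1 : ((x + z)%R <= T1)%MS.
    by apply: submx_trans sub; rewrite (submx_trans _ (addsmxSl _ _)) // addsmxSr.
  by rewrite -[z](addKr x) addmx_sub // eqmx_opp.
- apply: contra xz2 => sub; apply: submx_trans sub.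
  by rewrite (submx_trans _ (addsmxSl _ _)) // addsmxSr.
Qed.

Lemma all_simple_linear : (11 <= s)%N -> (11 <= p)%N -> (4 <= h)%N -> linear_config s v.
Proof.
move=> s11 p11 h4.
have [P _] : exists P : I, true.
  by have := card_points_lb C; rewrite addn1 => /(leq_ltn_trans (leq0n _)) /card_gt0P [i _]; exists i.
case: (boolP [forall x1, forall x2, [&& hat P x1, hat P x2 & ~~ (x2 <= v P + x1)%MS] ==> hat P (x1 + x2)]).
  move=> /forallP cl; apply: (@hat_closed_linear P) => x1 x2 h1 h2 ind.
  by have /forallP/(_ x2) := cl x1; rewrite h1 h2 ind.
rewrite negb_forall => /existsP [x1]; rewrite negb_forall => /existsP [x2].
rewrite negb_imply => /andP [/and3P [h1 h2 ind] nh].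
set T := (v P + x1 + x2)%MS.
have bT : (Nbig s < #|pts T|)%N.
  by rewrite ltnNge; apply: contra nh; exact: (hat_sum C simple).
have rT : \rank T = 3%N by have [n1 _] := hatP _ _ _ _ h1; rewrite !rank_adds1 // rank_rV v0.
have PT : P \in pts T by rewrite inE /T -addsmxA addsmxSl.
have [e4|h5] := eqVneq h 4%N; last first.
  apply: (big_plane_ge5 s11 p11 _ PT rT); first by move: h4 h5; clear; lia.
  apply: leq_trans (ltnW bT); rewrite /Nbig -mulnn.
  have m : (2 * (s * s) <= (s - 1) * (s * s))%N by rewrite leq_mul2r; apply/orP; right; move: s7; clear; lia.
  by rewrite [(s * s * (s - 1))%N]mulnC; move: m; clear; lia.
(* Closure may fail at [P] because of the big plane [T] through it; a base point off [T] is what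
   [closed_off_big] asks for. *)
have [P' P'T _] : exists2 k, k \notin pts T & true by apply: (rank_lt_neq0 C); rewrite rT e4.
exact: (hat_closed_linear (closed_off_big e4 P'T rT bT)).
Qed.

End AllSimple.

Section FrobeniusCoprime.
Variables (F : fieldType) (r : nat).
Hypothesis rF : [pchar F].-nat r.
Local Notation frobp := (@frobp F r).
Implicit Types A B : {poly F}.

Lemma comp_Xn_inj : injective (fun A : {poly F} => A \Po 'X^r).
Proof.
move=> A B /= e; have r0 : (0 < r)%N by case/andP: rF.
apply/polyP => i; have := congr1 (fun P : {poly F} => P`_(i * r)) e.
by rewrite !coef_comp_poly_Xn // dvdn_mull // mulnK.
Qed.

Lemma frobpM A B : frobp (A * B) = frobp A * frobp B.
Proof. by apply: comp_Xn_inj; rewrite /= rmorphM /= -!(exp_frobp rF) exprMn. Qed.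

Lemma frobpD A B : frobp (A + B) = frobp A + frobp B.
Proof.
apply: comp_Xn_inj; rewrite /= rmorphD /= -!(exp_frobp rF).
by apply: exprDn_pchar; exact: (pnat_pchar_poly rF).
Qed.

Lemma frobp1 : frobp 1 = 1.
Proof. by apply: comp_Xn_inj; rewrite /= -(exp_frobp rF) expr1n rmorph1. Qed.

Lemma frobp_coprime A B : coprimep A B -> coprimep (frobp A) (frobp B).
Proof.
move=> /Bezout_eq1_coprimepP [[u1 u2] /= e]; apply/Bezout_eq1_coprimepP.
by exists (frobp u1, frobp u2); rewrite /= -!frobpM -frobpD e frobp1.
Qed.

Lemma horner_frobp A x : (frobp A).[x ^+ r] = A.[x] ^+ r.
Proof. by rewrite -horner_exp (exp_frobp rF) horner_comp hornerXn. Qed.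

Lemma size_frobp A : size (frobp A) = size A.
Proof.
have [->|A0] := eqVneq A 0; first by rewrite /frobp size_poly0 poly_def big_ord0 size_poly0.
apply: size_poly_eq; rewrite -lead_coefE expf_neq0 // lead_coef_eq0 //.
Qed.

Lemma monic_frobp A : A \is monic -> frobp A \is monic.
Proof.
rewrite !monicE !lead_coefE size_frobp (coef_frobp rF) => /eqP ->.
by rewrite expr1n.
Qed.

End FrobeniusCoprime.

(** * The plane *)

Section Plane.
Variables (F : finFieldType) (I : finType) (p s : nat) (v : I -> 'rV[F]_3).
Hypothesis C : config p s v.
Local Notation q := #|F|.
Local Notation L := (line_pts v).
Local Notation zr := (zeros v).
Local Notation ev := (fval v).
Local Notation pts := (pts v).
Local Notation w := (line_weight s v).
Local Notation d := (excess F I s).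

Let s7 := cf_s7 C.
Let v0 := cf_v0 C.
Let v_inj := cf_inj C.
Let sF := pchar_nat_s C.
Let pF := cf_p C.
Let s0 : (0 < s)%N := leq_trans (isT : (0 < 7)%N) s7.

Lemma plane_q : q = (s * s ^ 2)%N. Proof. by rewrite (cf_q C) expnS. Qed.

Lemma plane_qs : (q %/ s = s ^ 2)%N. Proof. by rewrite plane_q mulKn. Qed.

Lemma plane_d : (d <= s + 1)%N.
Proof. by have := excess_lt C; rewrite subnn expn0 mul1n addn2 addn1. Qed.

Lemma zr_line a i j : a != 0 -> i != j -> i \in zr a -> j \in zr a -> zr a = L i j.
Proof.
move=> a0 ij ia ja.
have zE : zr a = pts (kermx a) by apply/setP => k; rewrite !inE; apply/eqP/sub_kermxP.
have sub : (v i + v j <= kermx a)%MS by move: ia ja; rewrite zE !inE addsmx_sub => -> ->.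
have sup : (kermx a <= v i + v j)%MS.
  apply: rank_eq_sub sub _; rewrite (rank_line v0 v_inj ij) mxrank_ker.
  by have : (0 < \rank a)%N; [rewrite lt0n mxrank_eq0 | clear; lia].
by apply/eqP; rewrite zE eqEsubset !ptsS.
Qed.

Lemma exists_point_pair P : exists a1 a2, [/\ zr a1 = [set P], P \in zr a2 &
  forall y z, y *: a1 + z *: a2 = 0 -> y = 0 /\ z = 0].
Proof.
have PP : P \in pts (v P) by rewrite inE.
have [a1 [a2 [zE _ a2K ind]]] := exists_pencil_pair C PP (rank_v v0 P).
exists a1, a2; split=> //; last by rewrite (subsetP (pts_sub_zr v a2K)).
by rewrite zE; apply/setP => k; rewrite !inE; apply/idP/eqP => [/v_inj|->].
Qed.

Section AtPoint.
Variables (P : I) (a1 a2 : 'cV[F]_3).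
Hypothesis z1 : zr a1 = [set P].
Hypothesis z2 : P \in zr a2.
Hypothesis ind : forall y z, y *: a1 + z *: a2 = 0 -> y = 0 /\ z = 0.
Local Notation xi := (slope v a1 a2).
Local Notation mu := (slope_mult s v a1 a2).
Local Notation hits := (slope_class v a1 a2).

Let zsub : zr a1 \subset zr a2. Proof. by rewrite z1 sub1set. Qed.
Let PK : P \in zr a1. Proof. by rewrite z1 set11. Qed.
Let nKq : (#|zr a1| < q)%N. Proof. by rewrite z1 cards1; exact: (q_gt1 C). Qed.
Let mem_z1 k : (k \in zr a1) = (k == P). Proof. by rewrite z1 in_set1. Qed.

(** The axis is the single point [P], so [delta = d]. *)
Lemma point_lacunary : exists f g, [/\ split_poly (mset_seq mu) = 'X^(s ^ 2) * f + g,
  f \is monic, size f = d.+1 & (size g <= d.+1)%N].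
Proof.
have [delta [f [g [NE PE mf szf szg]]]] := codim2_lacunary C (pair_a2 ind) (pair_a1 ind) zsub PK nKq.
have := delta_eq C ind PK NE; rewrite z1 cards1 => /eqP; rewrite eqn_add2l eqn_pmul2l // => /eqP de.
by exists f, g; rewrite -plane_qs -de.
Qed.

Lemma hits_xi k : k != P -> hits (xi k) = L P k :\ P.
Proof.
move=> kP; have kz : k \notin zr a1 by rewrite mem_z1.
have kH : k \in zr (a2 + xi k *: a1) by rewrite -hitsE //; exact: mem_hits.
have PH : P \in zr (a2 + xi k *: a1).
  by move: z2 PK; rewrite !zrE evD evZ => /eqP -> /eqP ->; rewrite mulr0 addr0.
have Pk : P != k by rewrite eq_sym.
have zE := zr_line (pair_a2 ind (xi k)) Pk PH kH.
apply/setP => l; rewrite in_setD1; have [->|lP] := eqVneq l P; first by rewrite inE mem_z1 eqxx.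
by rewrite hitsE ?mem_z1 // zE.
Qed.

Lemma mu_xi k : k != P -> mu (xi k) = w P k.
Proof.
move=> kP; apply/eqP; rewrite -(eqn_pmul2r s0).
rewrite -(hits_mu C (pair_a2 ind) (pair_a1 ind) zsub) hits_xi // (card_block C) 1?eq_sym //.
by rewrite mulnC.
Qed.

Lemma xi_eqE k l : k != P -> l != P -> (xi l == xi k) = (l \in L P k).
Proof.
move=> kP lP; have := in_setD1 l (L P k) P.
by rewrite -hits_xi // inE mem_z1 lP.
Qed.

Lemma mu_witness x : (0 < mu x)%N -> exists2 k, k != P & xi k = x.
Proof.
move=> m0; have /card_gt0P [k] : (0 < #|hits x|)%N.
  by rewrite (hits_mu C (pair_a2 ind) (pair_a1 ind) zsub) muln_gt0 m0.
by rewrite inE mem_z1 => /andP [kP /eqP kx]; exists k.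
Qed.

Lemma sum_mu_point : (\sum_x mu x = s ^ 2 + d)%N.
Proof.
apply/eqP; rewrite -(eqn_pmul2r s0) big_distrl /=.
rewrite -(eq_bigr _ (fun x _ => hits_mu C (pair_a2 ind) (pair_a1 ind) zsub x)).
rewrite (sum_hits v a1 a2) z1 cards1 (card_points_eq C) plane_q.
by apply/eqP; clear; lia.
Qed.

Section Line.
Variables i j : I.
Hypothesis ij : i != j.
Hypothesis PL : P \notin L i j.
Let wl := w i j.
Hypothesis dw : (d + wl <= s * wl)%N.

Let a1L k : k \in L i j -> ev a1 k != 0.
Proof. by move=> kL; rewrite -zrE mem_z1; apply: contraNneq PL => <-. Qed.

Let skew y z : ev (y *: a1 + z *: a2) i = 0 -> ev (y *: a1 + z *: a2) j = 0 -> y = 0 /\ z = 0.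
Proof.
move=> hi hj; apply: ind; apply/eqP; apply: contraT => nz; case/negP: PL.
rewrite -(zr_line nz ij) ?zrE ?hi ?hj //.
by move: z2 PK; rewrite !zrE evD !evZ => /eqP -> /eqP ->; rewrite !mulr0 addr0.
Qed.

Let xinj := xi_inj_line C ij skew a1L.

(* Raising [X E1(X^s) + E2(X^s)] to the power [s^2] gives [X^(s^2) A + B] on [F]. *)
Lemma line_factor : exists c A B : {poly F},
  [/\ split_poly (mset_seq mu) = c * ('X^(s ^ 2) * A + B), c != 0 & (size c + wl = d.+1)%N] /\
  [/\ A \is monic, size A = wl.+1, (size B <= wl.+1)%N & coprimep A B] /\
  (forall x, root ('X^(s ^ 2) * A + B) x = (x \in [set xi k | k in L i j])).
Proof.
have r2F : [pchar F].-nat (s ^ 2)%N by rewrite pnatX sF.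
have [f [g [PE mf szf szg]]] := point_lacunary.
have [E1 [E2 [lpE szE1 mE1 szE2]]] := line_poly_decomp C ij skew a1L.
have cop := line_coprime C ij skew a1L lpE mE1.
pose A := frobp (s ^ 2) E1; pose B := frobp (s ^ 2) E2.
have rootG x : ('X^(s ^ 2) * A + B).[x] = (line_poly v a1 a2 i j).[x] ^+ (s ^ 2).
  have xq : x = (x ^+ s) ^+ (s ^ 2) by rewrite -exprM -plane_q expf_card.
  rewrite lpE !hornerE !horner_comp hornerXn.
  rewrite {2 3}xq !(horner_frobp r2F) exprDn_pchar ?exprMn //.
have rootE x : root ('X^(s ^ 2) * A + B) x = (x \in [set xi k | k in L i j]).
  rewrite rootE rootG expf_eq0 expn_gt0 s0 /=.
  have -> : line_poly v a1 a2 i j = split_poly [seq xi k | k <- enum (L i j)].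
    by rewrite /split_poly big_map big_enum.
  by rewrite -rootE root_prod_XsubC; apply/mapP/imsetP => [] [k kL ->]; exists k; rewrite ?mem_enum // in kL *.
have copAB : coprimep A B by exact: frobp_coprime.
have mA : A \is monic by exact: monic_frobp.
have szA : size A = wl.+1 by rewrite size_frobp.
have szB : (size B <= wl.+1)%N by rewrite size_frobp.
(* Both [X^(s^2) f + g] and [X^(s^2) A + B] vanish at the [1 + s wl] slopes of the line, hence so
   does [f B - g A], whose degree is at most [d + wl]; here [dw] is needed. *)
have Z0 : f * B = g * A.
  apply/eqP; rewrite -subr_eq0; apply/eqP.
  apply: (@roots_geq_poly_eq0 _ _ [seq xi k | k <- enum (L i j)]).
  - apply/allP => y /mapP [k]; rewrite mem_enum => kL ->{y}.
    have kP : k != P by apply: contraNneq PL => <-.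
    have /rootP r1 : root ('X^(s ^ 2) * A + B) (xi k) by rewrite rootE; apply: imset_f.
    have /rootP r2 : root ('X^(s ^ 2) * f + g) (xi k).
      rewrite -PE root_prod_XsubC mem_mset_seq mu_xi //.
      by apply: (line_weight_gt0 C); rewrite eq_sym.
    move: r1 r2; rewrite !hornerE => /eqP; rewrite addrC addr_eq0 => /eqP hB /eqP.
    rewrite addrC addr_eq0 => /eqP hg; apply/rootP; rewrite !hornerE hB hg; ring.
  - by rewrite map_inj_in_uniq ?enum_uniq // => k l; rewrite !mem_enum; exact: xinj.
  rewrite size_map -cardE (card_line C ij) -/wl.
  apply: leq_trans (_ : d + wl + 1 <= _)%N; last by move: dw; clear; lia.
  have szgA : (size A <= wl.+1)%N by rewrite szA.
  have szf' : (size f <= d.+1)%N by rewrite szf.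
  have m1 := leq_size_mul szf' szB; have m2 := leq_size_mul szg szgA.
  have -> : (d + wl + 1 = (d.+1 + wl.+1).-1)%N by clear; lia.
  exact: leq_size_sub.
have Af : A %| f by rewrite -(Gauss_dvdpl _ copAB) Z0 dvdp_mull.
have [c fE] := dvdpP _ _ Af.
have A0 : A != 0 by exact: monic_neq0.
have gE : g = c * B by apply: (mulIf A0); rewrite -Z0 fE; ring.
have c0 : c != 0 by apply/eqP => c0; move: szf; rewrite fE c0 mul0r size_poly0.
exists c, A, B; split; last by split.
split=> //; first by rewrite PE fE gE; ring.
have := size_mulD1 c0 A0; rewrite -fE szf szA addn1 addnS => /eqP.
by rewrite eqSS => /eqP ->.
Qed.

(** If the Wronskian of [A] and [B] is not zero, the bound on distinct roots reads
    [s^2 <= (s + 1) wl], whence [wl >= s]. If it is zero, then [A], [B] and the factor itself are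
    [p]-th powers, so [p] divides [wl] and every slope of the line has multiplicity at least [p]. *)
Lemma line_dichotomy : (s <= wl <= d)%N \/
  ((p %| wl)%N /\ forall k, k \in L i j -> (p <= w P k)%N).
Proof.
have [c [A [B [[PE c0 szc] [[mA szA szB copAB] rootE]]]]] := line_factor.
have A0 : A != 0 by exact: monic_neq0.
have p_pr := pcharf_prime pF; have p0 := prime_gt0 p_pr.
have [e e0 sE] := cf_s C.
have ps : (p %| s ^ 2)%N by rewrite sE -expnM dvdn_exp // muln_gt0 e0.
have dG : ('X^(s ^ 2) * A + B) %| split_poly (mset_seq mu) by rewrite PE dvdp_mull.
have [W0|W0] := eqVneq (wronskian A B) 0; [right|left].
  have AB : A * B^`() = A^`() * B by apply/eqP; rewrite -subr_eq0; apply/eqP.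
  have A'0 : A^`() = 0.
    apply/eqP; apply: contraT => nz; have : A %| A^`().
      by rewrite -(Gauss_dvdpl _ copAB) -AB dvdp_mulr.
    by move/(dvdp_leq nz); rewrite leqNgt lt_size_deriv.
  have B'0 : B^`() = 0.
    by apply: (mulfI A0); rewrite AB A'0 mul0r mulr0.
  have [A3 AE] := deriv0_pth_power pF A'0; have [B3 BE] := deriv0_pth_power pF B'0.
  have A30 : A3 != 0 by apply: contraNneq A0 => e3; rewrite AE e3 expr0n gtn_eqF.
  have wE : wl = ((size A3).-1 * p)%N.
    by have := size_exp A3 p; rewrite -AE szA.
  split; first by rewrite wE dvdn_mull.
  move=> k kL; have kP : k != P by apply: contraNneq PL => <-.
  pose G3 := 'X^(s ^ 2 %/ p) * A3 + B3.
  have GE : 'X^(s ^ 2) * A + B = G3 ^+ p.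
    rewrite /G3 exprDn_pchar; last by rewrite (pnat_pchar_poly _) //; exact: (pnat_pcharX pF 1).
    by rewrite exprMn -exprM divnK // -AE -BE.
  have r3 : root G3 (xi k).
    have : root ('X^(s ^ 2) * A + B) (xi k) by rewrite rootE; apply: imset_f.
    by rewrite GE => /rootP; rewrite horner_exp => /eqP; rewrite expf_eq0 p0.
  have sp0 : split_poly (mset_seq mu) != 0 by apply: monic_neq0; exact: monic_prod_XsubC.
  have : (p <= mup (xi k) (split_poly (mset_seq mu)))%N.
    rewrite mup_geq //; apply: dvdp_trans dG; rewrite GE; apply: dvdp_exp2r.
    by rewrite dvdp_XsubCl.
  by rewrite mu_prod_XsubC count_mset_seq mu_xi.
have [k [r [k0 GE]]] := split_poly_factor dG.
have BA : (size B <= size A)%N by rewrite szA.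
have := distinct_roots_lb pF ps k0 (esym GE) _ BA W0; rewrite szA expn_gt0 s0 => /(_ isT) lb.
have ub : (size (undup r) <= 1 + s * wl)%N.
  rewrite -(card_line C ij) -(card_in_imset xinj) -(card_uniqP (undup_uniq r)).
  apply: subset_leq_card; apply/subsetP => x; rewrite mem_undup -rootE => xr.
  by rewrite GE rootZ // root_prod_XsubC.
have cs : (0 < size c)%N by rewrite size_poly_gt0.
apply/andP; split; last by move: szc cs; clear; lia.
rewrite leqNgt; apply/negP => lt; move: lb ub; rewrite -mulnn.
have m : (s * wl <= s * (s - 1))%N by rewrite leq_mul2l; apply/orP; right; move: lt; clear; lia.
have ss : (s <= s * s)%N by rewrite leq_pmulr.
by move: m lt ss; rewrite mulnBr muln1; move: (s * s)%N (s * wl)%N (size _) => x y z; clear; lia.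
Qed.

End Line.
End AtPoint.
End Plane.

(** * Counting the lines of the plane by weight *)

(** [(x - 1) (x - (s + 1)) = s^2 t (t - 1)] for [x = 1 + s t]: the exact form of
    [arith_second_moment]. *)
Lemma arith_moment_term s t : ((1 + s * t) ^ 2 + (s + 1) =
  s ^ 2 * (t * (t - 1)) + (s + 2) * (1 + s * t))%N.
Proof.
case: t => [|t]; first by rewrite sub0n !muln0 addn0 exp1n muln1; lia.
rewrite subSS subn0 -!mulnn; lia.
Qed.

Lemma arith_moment s q b d T S1 S2 X : (0 < s)%N -> (q = s * s ^ 2)%N -> (b = q + 1 + s * d)%N ->
  (S1 + b = b * q ^ 2)%N -> (S2 + b ^ 2 = b * q ^ 2 + b * (b - 1) * q)%N ->
  (S2 + (q ^ 3 - 1) * (s + 1) = s ^ 2 * T + (s + 2) * S1)%N ->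
  (s ^ 2 * (q * X) + (s + 2) * (b * q ^ 2) + b ^ 2 + s + 1 =
   b * q ^ 2 + b * (q + s * d) * q + (s + 1) * q ^ 3 + (s + 2) * b + s ^ 2 * X)%N ->
  (T = (q - 1) * X)%N.
Proof.
move=> s0 qE bE e1 e2 e3 e4.
have q0 : (0 < q)%N by rewrite qE muln_gt0 s0 expn_gt0 s0.
have b1 : (b - 1 = q + s * d)%N by move: bE; clear; lia.
have q3 : ((q ^ 3 - 1) * (s + 1) + (s + 1) = (s + 1) * q ^ 3)%N.
  have : (0 < q ^ 3)%N by rewrite expn_gt0 q0.
  case: (q ^ 3)%N => // n _; rewrite subn1 /=; clear; lia.
have qX : (s ^ 2 * (q * X) = s ^ 2 * ((q - 1) * X) + s ^ 2 * X)%N.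
  by rewrite -mulnDr -{1}[q](subnK q0) mulnDl mul1n.
apply/eqP; rewrite -(@eqn_pmul2l (s ^ 2)) ?expn_gt0 ?s0 //; apply/eqP.
rewrite b1 in e2; rewrite qX in e4.
have f1 : ((s + 2) * S1 + (s + 2) * b = (s + 2) * (b * q ^ 2))%N by rewrite -mulnDr e1.
move: e2 e3 e4 f1 q3; clear.
move: (s ^ 2 * T)%N ((s + 2) * S1)%N ((s + 2) * b)%N (s ^ 2 * ((q - 1) * X))%N (s ^ 2 * X)%N.
move: ((q ^ 3 - 1) * (s + 1))%N ((s + 1) * q ^ 3)%N (b * (q + s * d) * q)%N ((s + 2) * (b * q ^ 2))%N.
move: (b * q ^ 2)%N (b ^ 2)%N; lia.
Qed.

Section Plane.
Variables (F : finFieldType) (I : finType) (p s : nat) (v : I -> 'rV[F]_3).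
Hypothesis C : config p s v.
Local Notation q := #|F|.
Local Notation b := #|I|.
Local Notation L := (line_pts v).
Local Notation zr := (zeros v).
Local Notation pts := (pts v).
Local Notation w := (line_weight s v).
Local Notation d := (excess F I s).

Let s7 := cf_s7 C.
Let v0 := cf_v0 C.
Let v_inj := cf_inj C.
Let pF := cf_p C.
Let s0 : (0 < s)%N := leq_trans (isT : (0 < 7)%N) s7.

Definition tw (a : 'cV[F]_3) := ((#|zr a| - 1) %/ s)%N.
(* The sum of [w (w - 1)] over all lines, each counted [q - 1] times. *)
Definition moment := (\sum_(a : 'cV[F]_3 | a != 0%R) tw a * (tw a - 1))%N.

Lemma zr_tw a : a != 0 -> #|zr a| = (1 + s * tw a)%N.
Proof. by move=> a0; apply: (mod1P C); apply: (cf_one C). Qed.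

Lemma tw_line a i j : a != 0 -> i != j -> i \in zr a -> j \in zr a -> tw a = w i j.
Proof. by move=> a0 ij ia ja; rewrite /tw (zr_line C a0 ij ia ja). Qed.

(** The first two moments of the line sizes determine [moment]; the hypothesis is the resulting
    equation for [X], arranged without subtraction. *)
Lemma moment_eq X :
  (s ^ 2 * (q * X) + (s + 2) * (b * q ^ 2) + b ^ 2 + s + 1 =
   b * q ^ 2 + b * (q + s * d) * q + (s + 1) * q ^ 3 + (s + 2) * b + s ^ 2 * X)%N ->
  moment = ((q - 1) * X)%N.
Proof.
have := sum_card_zr C; rewrite (bigD1 0%R) //= => e1.
have := sum_card_zr2 C; rewrite (bigD1 0%R) //= => e2; move: e1 e2; rewrite zr0 cardsT.
set S2 := (\sum_(a | _) _ ^ 2)%N; set S1 := (\sum_(a | _) #|zr a|)%N => e1 e2.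
apply: (arith_moment s0 (plane_q C) (card_points_eq C) (S1 := S1) (S2 := S2)).
- by rewrite addnC e1.
- by rewrite addnC e2 expn1.
rewrite /S1 /S2 /moment -(sum_neq0_const F) !big_distrr /= -!big_split /=.
by apply: eq_bigr => a a0; rewrite (zr_tw a0) arith_moment_term.
Qed.

(** The value for one line of weight [s + 1], all others having weight at most 1. *)
Lemma moment_top : d = (s + 1)%N -> moment = ((q - 1) * (s * (s + 1)))%N.
Proof.
move=> dE; apply: moment_eq; rewrite (card_points_eq C) dE (plane_q C) -!mulnn !expnS !expn0.
by clear; lia.
Qed.

(** The value for [s + 1] lines of weight [s], all others having weight at most 1. *)
Lemma moment_s : d = s -> moment = ((q - 1) * (s * (s - 1) * (s + 1)))%N.
Proof.
move=> dE; apply: moment_eq; rewrite (card_points_eq C) dE (plane_q C) -!mulnn !expnS !expn0.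
have [t st] : exists t, s = t.+1 by case: s s0 => // t _; exists t.
by rewrite st subSS subn0; clear; lia.
Qed.

Lemma card_ann_line i j : i != j -> #|ann (v i + v j)%MS :\ 0| = (q - 1)%N.
Proof.
move=> ij; have := cardsD1 0 (ann (v i + v j)%MS).
rewrite mem_ann0 card_ann (rank_line v0 v_inj ij) expn1 => ->.
by rewrite add1n subn1.
Qed.

Lemma ann_lineP i j a : i != j -> a \in ann (v i + v j)%MS :\ 0 -> a != 0 /\ zr a = L i j.
Proof.
move=> ij; rewrite in_setD1 mem_ann ann_adds => /andP [a0 /andP [ia ja]]; split=> //.
by apply: (zr_line C) => //; rewrite inE.
Qed.

Lemma moment_two_lines i j k l : i != j -> k != l -> L i j != L k l ->
  ((q - 1) * (w i j * (w i j - 1) + w k l * (w k l - 1)) <= moment)%N.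
Proof.
move=> ij kl ne; set A1 := ann (v i + v j)%MS :\ 0; set A2 := ann (v k + v l)%MS :\ 0.
have dis a : a \in A1 -> a \in A2 -> false.
  by move=> /(ann_lineP ij) [_ e1] /(ann_lineP kl) [_ e2]; case/negP: ne; rewrite -e1 e2.
have t12 x y (xy : x != y) a : a \in ann (v x + v y)%MS :\ 0 -> tw a = w x y.
  by move=> /(ann_lineP xy) [a0 zE]; rewrite /tw zE.
rewrite mulnDr -{1}(card_ann_line ij) -(card_ann_line kl) -!sum_nat_const.
rewrite -(eq_bigr _ (fun a h => congr1 (fun t => t * (t - 1))%N (t12 _ _ ij a h))).
rewrite -[X in (_ + X)%N](eq_bigr _ (fun a h => congr1 (fun t => t * (t - 1))%N (t12 _ _ kl a h))).
rewrite /moment [X in (_ <= X)%N](bigID (mem A1)) /=; apply: leq_add.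
  rewrite [X in (_ <= X)%N](bigID (mem A1)) /=; apply: leq_trans (leq_addr _ _).
  rewrite [X in (_ <= X)%N]big_mkcond [X in (X <= _)%N]big_mkcond; apply: leq_sum => a _.
  rewrite -/A1; case: (boolP (a \in A1)) => [h|_ //].
  by rewrite (ann_lineP ij h).1.
rewrite [X in (_ <= X)%N]big_mkcond [X in (X <= _)%N]big_mkcond; apply: leq_sum => a _.
rewrite -/A2; case: (boolP (a \in A2)) => [h|_ //].
rewrite (ann_lineP kl h).1 /=; case: (boolP (a \in A1)) => // h1.
by have := dis _ h1 h.
Qed.

(** Count the pairs of a point off the line and a point on it. A line of weight [t >= p] meeting
    [L i j] in one point carries [s t] such pairs, and [(p - 1) t <= t (t - 1)]. *)
Lemma moment_bad_line i j : i != j ->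
  (forall P k, P \notin L i j -> k \in L i j -> (p <= w P k)%N) ->
  ((p - 1) * ((q - 1) * ((b - #|L i j|) * #|L i j|)) <= s * moment)%N.
Proof.
move=> ij bad; set l := L i j.
pose pr (a : 'cV[F]_3) := (#|zr a :\: l| * #|zr a :&: l|)%N.
have sum_pr : (\sum_(a : 'cV[F]_3 | a != 0%R) pr a = (q - 1) * ((b - #|l|) * #|l|))%N.
  have prE (a : 'cV[F]_3) : pr a = (\sum_(P in ~: l) \sum_(k in l) ((P \in zr a) && (k \in zr a)))%N.
    rewrite /pr -!sum1_card big_distrl /= [LHS]big_mkcond [RHS]big_mkcond /=; apply: eq_bigr => P _.
    rewrite in_setD in_setC; case: (P \in l) => //=; case: (P \in zr a) => /=; last by rewrite big1.
    rewrite mul1n [LHS]big_mkcond [RHS]big_mkcond; apply: eq_bigr => k _.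
    by rewrite in_setI; case: (k \in l); rewrite ?andbT ?andbF //; case: (_ \in _).
  rewrite (eq_bigr _ (fun a _ => prE a)) exchange_big /= (eq_bigr (fun=> #|l| * (q - 1))%N); last first.
    move=> P; rewrite in_setC => Pl; rewrite exchange_big /= -sum_nat_const; apply: eq_bigr => k kl.
    have Pk : P != k by apply: contraNneq Pl => ->.
    rewrite -(card_ann_line Pk) -sum1_card [LHS]big_mkcond [RHS]big_mkcond /=; apply: eq_bigr => a _.
    by rewrite in_setD1 mem_ann ann_adds !inE; case: (a != 0) => //=; case: (_ && _).
  rewrite sum_nat_const cardsCs setCK [RHS]mulnC -mulnA; congr (_ * _)%N.
rewrite -sum_pr /moment !big_distrr /=; apply: leq_sum => a a0.
case: (posnP #|zr a :&: l|) => [e0|]; first by rewrite /pr e0 !muln0.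
move/card_gt0P => [k]; rewrite in_setI => /andP [ka kl].
case: (posnP #|zr a :\: l|) => [e0|]; first by rewrite /pr e0 muln0.
move/card_gt0P => [P]; rewrite in_setD => /andP [Pl Pa].
have Pk : P != k by apply: contraNneq Pl => ->.
have tE := tw_line a0 Pk Pa ka; have tp := bad _ _ Pl kl; rewrite -tE in tp.
have one : zr a :&: l = [set k].
  apply/setP => m; rewrite in_setI in_set1; apply/andP/eqP => [[ma ml]|-> //].
  apply/eqP; apply: contraT => mk; case/negP: Pl.
  rewrite -(_ : zr a = l) //; rewrite (zr_line C a0 mk ma ka).
  exact: (line_pts_eq v0 v_inj ij).
have c2 : (#|zr a :\: l| = s * tw a)%N.
  by have := cardsID l (zr a); rewrite one cards1 (zr_tw a0) => /eqP; rewrite eqn_add2l => /eqP.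
rewrite /pr one cards1 c2 muln1 mulnC -mulnA leq_mul2l; apply/orP; right.
by rewrite leq_mul2l leq_sub2r ?orbT.
Qed.

(** For [d < s] the first alternative of [line_dichotomy] is impossible, and the second makes [p]
    divide the weight. *)
Lemma plane_d_ge i j : i != j -> ~~ (p %| w i j)%N -> (s <= d)%N.
Proof.
move=> ij pw; rewrite leqNgt; apply/negP => ds.
have [P PL _] : exists2 P, P \notin pts (v i + v j)%MS & true.
  by apply: (rank_lt_neq0 C); rewrite (rank_line v0 v_inj ij).
have [a1 [a2 [z1 z2 ind]]] := exists_point_pair C P.
have w0 := line_weight_gt0 C ij.
have dw : (d + w i j <= s * w i j)%N.
  have := leq_mul (leqnn (s - 1)) w0; rewrite muln1 mulnBl mul1n.
  by have := leq_pmull (w i j) s0; move: ds; clear; lia.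
case: (line_dichotomy C z1 z2 ind ij PL dw) => [/andP [h1 h2]|[h _]].
  by move: ds h1 h2; clear; lia.
by rewrite h in pw.
Qed.

Hypothesis sd : (s <= d)%N.

Lemma d_cases : d = s \/ d = (s + 1)%N.
Proof. by have := plane_d C; move: sd; clear; lia. Qed.

Lemma moment_ub : (moment <= (q - 1) * (s * (s - 1) * (s + 1)))%N.
Proof.
case: d_cases => [/moment_s -> //|/moment_top ->].
rewrite leq_mul2l; apply/orP; right; rewrite -mulnA leq_mul2l; apply/orP; right.
by rewrite leq_pmull //; move: s7; clear; lia.
Qed.

Lemma long_dw i j : (2 <= w i j)%N -> (d + w i j <= s * w i j)%N.
Proof.
move=> w2; have := leq_mul (leqnn (s - 1)) w2; rewrite mulnBl mul1n.
have := leq_pmull (w i j) s0; have := plane_d C.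
by move: s7; clear; lia.
Qed.

(** Otherwise the second alternative of [line_dichotomy] holds at every point off the line. As there
    are at least [s (s - 1) (s + 1)] such points and more than [s] points on the line,
    [moment_bad_line] contradicts [moment_ub]. *)
Lemma long_line_weight i j : i != j -> (2 <= w i j)%N -> (s <= w i j <= d)%N.
Proof.
move=> ij w2; apply: contraT => bad; exfalso.
have dw := long_dw w2.
have alt P : P \notin L i j -> (p %| w i j)%N /\ forall k, k \in L i j -> (p <= w P k)%N.
  move=> PL; have [a1 [a2 [z1 z2 ind]]] := exists_point_pair C P.
  by case: (line_dichotomy C z1 z2 ind ij PL dw) => // h; rewrite h in bad.
have pw : (p <= w i j)%N.
  have [P PL _] : exists2 P, P \notin pts (v i + v j)%MS & true.
    by apply: (rank_lt_neq0 C); rewrite (rank_line v0 v_inj ij).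
  by have [/dvdn_leq -> //] := alt P PL; exact: (line_weight_gt0 C).
have := moment_bad_line ij (fun P k PL => (alt P PL).2 k).
apply/negP; rewrite -ltnNge; apply: leq_ltn_trans (leq_mul (leqnn s) moment_ub) _.
have p1 := prime_gt1 (pcharf_prime pF).
have nL : (1 + s * p <= #|L i j|)%N by rewrite (card_line C ij) leq_add2l leq_mul2l pw orbT.
have bL : (s * (s - 1) * (s + 1) <= b - #|L i j|)%N.
  have := card_pts_small C (_ : (\rank (v i + v j)%MS < 3)%N).
  rewrite (rank_line v0 v_inj ij) => /(_ isT); rewrite -[pts _]/(L i j).
  rewrite {1}(card_points_eq C) (plane_q C) => h1; have nu : (#|L i j| <= s ^ 2 + d)%N.
    by rewrite -(leq_pmul2l s0) mulnDr; move: h1; clear; lia.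
  rewrite (card_points_eq C) (plane_q C); have sdd : (s * s <= s * d)%N by rewrite leq_mul2l sd orbT.
  have -> : (s * (s - 1) * (s + 1) = s * s ^ 2 - s)%N.
    by rewrite -mulnA -subn_sqr exp1n mulnBr muln1.
  by have := plane_d C; move: nu sdd; rewrite -mulnn; clear; lia.
have q1 : (0 < q - 1)%N by have := q_gt1 C; clear; lia.
have p10 : (0 < p - 1)%N by move: p1; clear; lia.
rewrite mulnCA; apply: leq_trans (leq_pmull _ p10); rewrite ltn_pmul2l //.
apply: leq_trans (leq_mul bL nL); rewrite mulnC ltn_pmul2l.
  have : (s * 1 <= s * p)%N by rewrite leq_mul2l (ltnW p1) orbT.
  by rewrite muln1; clear; lia.
by rewrite !muln_gt0 s0 !addn1 /= andbT; move: s7; clear; lia.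
Qed.

Lemma exists_long_line : exists i j, i != j /\ (2 <= w i j)%N.
Proof.
have m0 : (0 < moment)%N.
  have q1 := q_gt1 C.
  case: d_cases => [/moment_s ->|/moment_top ->]; rewrite !muln_gt0 !subn_gt0 q1 s0 !addn1 //=.
  by move: s7; clear; lia.
have [a a0 ta] : exists2 a : 'cV[F]_3, a != 0 & (2 <= tw a)%N.
  case: (pickP (fun a : 'cV[F]_3 => (a != 0) && (2 <= tw a)%N)) => [a /andP [h1 h2]|none]; first by exists a.
  move: m0; rewrite /moment big1 // => a a0; have := none a; rewrite a0 /=.
  by case: (tw a) => [|[|]].
have : (1 < #|zr a|)%N.
  by rewrite (zr_tw a0) add1n ltnS muln_gt0 s0; move: ta; clear; lia.
move/card_gt1P => [i [j [ia ja ij]]]; exists i, j; split=> //.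
by rewrite -(tw_line a0 ij ia ja).
Qed.

End Plane.

(** * The two extremal configurations in the plane *)

Section Plane.
Variables (F : finFieldType) (I : finType) (p s : nat) (v : I -> 'rV[F]_3).
Hypothesis C : config p s v.
Local Notation L := (line_pts v).
Local Notation zr := (zeros v).
Local Notation ev := (fval v).
Local Notation pts := (pts v).
Local Notation w := (line_weight s v).
Local Notation d := (excess F I s).
Local Notation onB := (onB v).
Local Notation Fs := (frob_fixed F s).

Let s7 := cf_s7 C.
Let v0 := cf_v0 C.
Let v_inj := cf_inj C.
Let sF := pchar_nat_s C.
Let s0 : (0 < s)%N := leq_trans (isT : (0 < 7)%N) s7.
Let s1 : (1 < s)%N := leq_trans (isT : (1 < 7)%N) s7.
Hypothesis sd : (s <= d)%N.

Lemma point_off_line i j : i != j -> exists P, P \notin L i j.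
Proof.
move=> ij; have [P PL _] : exists2 P, P \notin pts (v i + v j)%MS & true; last by exists P.
by apply: (rank_lt_neq0 C); rewrite (rank_line v0 v_inj ij).
Qed.

Section OffLongLine.
Variables (i j P : I) (a1 a2 : 'cV[F]_3).
Hypothesis ij : i != j.
Hypothesis w2 : (2 <= w i j)%N.
Hypothesis PL : P \notin L i j.
Hypothesis z1 : zr a1 = [set P].
Hypothesis z2 : P \in zr a2.
Hypothesis ind : forall y z, y *: a1 + z *: a2 = 0 -> y = 0 /\ z = 0.
Local Notation xi := (slope v a1 a2).
Local Notation mu := (slope_mult s v a1 a2).
Let V := [set xi k | k in L i j].

Let off k : k \in L i j -> k != P.
Proof. by move=> kL; apply: contraNneq PL => <-. Qed.

Lemma card_line_slopes : #|V| = (1 + s * w i j)%N.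
Proof.
rewrite -(card_line C ij) card_in_imset // => k l kL lL /eqP e; apply/eqP.
apply: contraT => kl; case/negP: PL; rewrite eq_sym (xi_eqE C z1 z2 ind (off kL) (off lL)) in e.
have Pk : P != k by rewrite eq_sym off.
rewrite -(line_pts_eq v0 v_inj ij kL lL kl); have := line_pts_eq v0 v_inj Pk (line_pts_r v P k) e kl.
by move=> ->; exact: line_pts_l.
Qed.

Lemma slope_mu_gt0 x : x \in V -> (0 < mu x)%N.
Proof.
case/imsetP => k kL ->; rewrite (mu_xi C z1 z2 ind (off kL)).
by apply: (line_weight_gt0 C); rewrite eq_sym off.
Qed.

Lemma card_support_le : (#|[set x | 0 < mu x]| + w i j <= (1 + s * w i j) + d)%N.
Proof.
have [c [A [B [[PE c0 szc] [_ rE]]]]] := line_factor C z1 z2 ind ij PL (long_dw C w2).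
pose R := [set x | root c x].
have cR : (#|R| < size c)%N.
  have := max_poly_roots c0 (_ : all (root c) (enum R)) (enum_uniq _); rewrite -cardE; apply.
  by apply/allP => x; rewrite mem_enum inE.
have sub : [set x | 0 < mu x]%N \subset R :|: V.
  apply/subsetP => x; rewrite !in_setU inE => mx.
  have : root (split_poly (mset_seq mu)) x by rewrite root_prod_XsubC mem_mset_seq.
  by rewrite PE rootM rE inE.
have := leq_trans (subset_leq_card sub) (leq_card_setU _ _); rewrite card_line_slopes.
by move: cR szc; clear; lia.
Qed.

Lemma sum_mu_support : (\sum_(x | 0 < mu x) (mu x - 1) + #|[set x | 0 < mu x]| = s ^ 2 + d)%N.
Proof.
rewrite -(sum_mu_point C z1 z2 ind) -sum1_card [in RHS](bigID (fun x => 0 < mu x)%N) /=.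
rewrite [X in (_ = _ + X)%N]big1; last by move=> x; rewrite -eqn0Ngt => /eqP.
rewrite addn0 [X in (_ + X)%N](eq_bigl (fun x => 0 < mu x)%N); last by move=> x; rewrite inE.
by rewrite -big_split /=; apply: eq_bigr => x; case: (mu x) => // m _; rewrite subn1 addn1.
Qed.

(** If all lines through [P] had weight 1, there would be [s^2 + d] slopes; but the roots of [c] and
    the slopes of the line are at most [1 + s^2 + d - s] together. *)
Lemma exists_long_through : w i j = s -> exists2 k, k != P & (2 <= w P k)%N.
Proof.
move=> wE; have [x x2] : exists x, (2 <= mu x)%N.
  case: (pickP (fun x => 2 <= mu x)%N) => [x hx|none]; first by exists x.
  have := sum_mu_support; rewrite big1 => [|x mx]; last by have := none x; case: (mu x) mx => [|[|]].
  by have := card_support_le; rewrite wE -mulnn; move: s1; clear; lia.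
have [k kP kx] := mu_witness C z1 z2 ind (ltnW x2); exists k => //.
by rewrite -(mu_xi C z1 z2 ind kP) kx.
Qed.

(** The [s^2 + 1] slopes of the line leave at most [s - 1] for the sum of the [mu - 1], and each
    long line through [P] takes at least [s - 1]. *)
Lemma long_through_unique k l : w i j = s -> d = s -> k != P -> l != P ->
  (2 <= w P k)%N -> (2 <= w P l)%N -> l \in L P k.
Proof.
move=> wE dE kP lP wk wl; rewrite -(xi_eqE C z1 z2 ind kP lP); apply: contraT => ne; exfalso.
have Pk : P != k by rewrite eq_sym.
have Pl : P != l by rewrite eq_sym.
have /andP [sk _] := long_line_weight C sd Pk wk; have /andP [sl _] := long_line_weight C sd Pl wl.
have mk := mu_xi C z1 z2 ind kP; have ml := mu_xi C z1 z2 ind lP.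
have VS : V \subset [set x | 0 < mu x]%N by apply/subsetP => x /slope_mu_gt0; rewrite inE.
have := subset_leq_card VS; rewrite card_line_slopes wE.
have := sum_mu_support; rewrite (bigD1 (xi k)) ?mk //=; last by move: wk; clear; lia.
rewrite (bigD1 (xi l)) /= ?ml ?ne ?andbT //; last by move: wl; clear; lia.
by rewrite dE -mulnn; move: sk sl s7; clear; lia.
Qed.

(** The line has [s^2 + s + 1] slopes, which is all of the sum [s^2 + d]; so there are no other
    slopes at [P], and each has multiplicity 1. *)
Lemma top_line_meets Q : w i j = (s + 1)%N -> d = (s + 1)%N -> Q != P ->
  w P Q = 1%N /\ exists2 k, k \in L i j & k \in L P Q.
Proof.
move=> wE dE QP.
have VS : V \subset [set x | 0 < mu x]%N by apply/subsetP => x /slope_mu_gt0; rewrite inE.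
have cS := sum_mu_support; have cV := card_line_slopes; have le := subset_leq_card VS.
have e : (s * w i j = s ^ 2 + s)%N by rewrite wE mulnDr muln1 -mulnn.
have SV : [set x | 0 < mu x]%N = V.
  apply/esym/eqP; rewrite eqEcard VS /=; apply: leq_trans (_ : s ^ 2 + d <= _)%N.
    by rewrite -cS leq_addl.
  by rewrite cV e dE; clear; lia.
have z : (\sum_(x | 0 < mu x) (mu x - 1) = 0)%N.
  by move: cS; rewrite SV cV e dE; set X := (\sum_(x | _) _)%N; clear; lia.
have mQ := mu_xi C z1 z2 ind QP; have PQ : P != Q by rewrite eq_sym.
have wQ := line_weight_gt0 C PQ; split.
  have /eqP := z; rewrite sum_nat_eq0 => /forallP /(_ (xi Q)); rewrite mQ wQ /=.
  by move: wQ; case: (w P Q) => [|[|]].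
have : xi Q \in V by rewrite -SV inE mQ.
case/imsetP => k kL /esym/eqP; rewrite (xi_eqE C z1 z2 ind QP (off kL)) => kQ.
by exists k.
Qed.

End OffLongLine.

(** As [E] take a functional whose zeros in [B] are the points of the line of weight [s + 1]. A line
    through two different points off it has weight 1 and meets it in a point of [B], so
    [simple_line_Fs] yields closure under addition. *)
Lemma plane_linear_top : d = (s + 1)%N -> linear_config s v.
Proof.
move=> dE; have [i [j [ij w2]]] := exists_long_line C sd.
have /andP [ws wd] := long_line_weight C sd ij w2.
have wE : w i j = (s + 1)%N.
  (* If the weight were [s], there would be a second line of weight at least [s], and [2 s (s - 1)]
     exceeds [s (s + 1)]. *)
  apply/eqP; apply: contraT => ne; have {}wE : w i j = s by move: ws wd ne; rewrite dE; clear; lia.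
  have [P PL] := point_off_line ij; have [a1 [a2 [z1 z2 ind]]] := exists_point_pair C P.
  have [k kP wk] := exists_long_through ij w2 PL z1 z2 ind wE.
  have Pk : P != k by rewrite eq_sym.
  have /andP [sk _] := long_line_weight C sd Pk wk.
  have LL : L i j != L P k by apply: contraNneq PL => ->; exact: line_pts_l.
  have := moment_two_lines C ij Pk LL; rewrite (moment_top C dE) wE.
  rewrite leq_pmul2l; last by have := q_gt1 C; clear; lia.
  have : (s * (s - 1) <= w P k * (w P k - 1))%N by apply: leq_mul; rewrite ?leq_sub2r.
  rewrite mulnBr muln1 mulnDr muln1.
  have : (7 * s <= s * s)%N by rewrite leq_mul2r s7 orbT.
  by move: (w P k * _)%N (s * s)%N s7 => x y; clear; lia.
have hit P Q : P \notin L i j -> Q != P -> w P Q = 1%N /\ exists2 k, k \in L i j & k \in L P Q.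
  move=> PL QP; have [a1 [a2 [z1 z2 ind]]] := exists_point_pair C P.
  exact: (top_line_meets ij PL z1 z2 ind wE dE QP).
have rU : (\rank (v i + v j)%MS < 3)%N by rewrite (rank_line v0 v_inj ij).
have [a0 [a0n _ zE]] := exists_exact C (line_pts_l v i j) rU.
have zE' k : (k \in L i j) = (ev a0 k == 0) by rewrite -[L i j]zE zrE.
have row1 (y : 'rV[F]_1) : Fs_row s y = (y 0 0 != 0) && (y 0 0 \in Fs).
  rewrite /Fs_row; congr (_ && _).
    by apply/idP/idP; apply: contra => /eqP e; apply/eqP; [apply/rowP => t; rewrite ord1 e mxE|rewrite e mxE].
  by apply/forallP/idP => [/(_ 0) //|h t]; rewrite ord1.
have nzE (x : 'rV[F]_3) : (x *m a0 != 0) = ((x *m a0) 0 0 != 0).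
  by congr (~~ _); apply/eqP/eqP => [->|e]; [rewrite mxE|apply/rowP => t; rewrite ord1 e mxE].
apply: (@core_linear F I 3 p s v C 1 a0).
- move=> k nz; exists ((v k *m a0) 0 0)^-1; first by rewrite invr_eq0 -nzE.
  by rewrite row1 -scalemxAl mxE mulVf -?nzE // oner_neq0 (Fs1 F s).
- move=> u z /andP [uB uF] /andP [zB zF] nz; rewrite row1 in uF; rewrite row1 in zF.
  case/andP: uF => u0 uF; case/andP: zF => zn zF.
  apply/andP; split; last by rewrite row1 -nzE nz mulmxDl mxE (FsD sF).
  have /(onBP C) [k [ck [ck0 uE]]] := uB; have /(onBP C) [l [cl [cl0 zE2]]] := zB.
  have [e|kl] := eqVneq l k.
    have uz0 : u + z != 0 by apply: contraNneq nz => ->; rewrite mul0mx.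
    rewrite /onB uz0 /=; apply/existsP; exists k; rewrite uE zE2 e.
    by rewrite addmx_sub // scalemx_sub.
  have evs c m x : x = c *: v m -> c != 0 -> (x *m a0) 0 0 != 0 -> m \notin L i j.
    by move=> -> c0; rewrite zE' -scalemxAl mxE mulf_eq0 negb_or => /andP [].
  have kL := evs _ _ _ uE ck0 u0.
  have [wkl [m mL]] := hit k l kL kl; rewrite inE => /row_addsP [al [be mE]].
  have kE : v k = ck^-1 *: u by rewrite uE scalerA mulVf // scale1r.
  have lE : v l = cl^-1 *: z by rewrite zE2 scalerA mulVf // scale1r.
  pose al' := al * ck^-1; pose be' := be * cl^-1.
  have mE' : v m = al' *: u + be' *: z by rewrite mE kE lE !scalerA.
  have rel : al' * (u *m a0) 0 0 + be' * (z *m a0) 0 0 = 0.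
    by have := mL; rewrite zE' /fval mE' dotD !dotZ => /eqP.
  have al0 : al' != 0.
    apply/eqP => e; move: rel; rewrite e mul0r add0r => /eqP; rewrite mulf_eq0 (negPf zn) orbF.
    by move=> /eqP e2; move: (v0 m); rewrite mE' e e2 !scale0r addr0 eqxx.
  have be0 : be' != 0.
    apply/eqP => e; move: rel; rewrite e mul0r addr0 => /eqP.
    by rewrite mulf_eq0 (negPf u0) (negPf al0).
  (* [u + ga *: z] represents the point [m] on the long line; since [a0] vanishes there, [ga] is in
     [Fs]. *)
  pose ga := be' / al'.
  have gaF : ga \in Fs.
    have -> : ga = - ((u *m a0) 0 0 / (z *m a0) 0 0).
      apply: (mulfI al0); apply: (mulIf zn); rewrite /ga mulrCA divff // mulr1 mulrN mulrA mulNr.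
      by rewrite divfK //; apply/eqP; rewrite -addr_eq0 addrC rel.
    by rewrite (FsN sF) // (FsM uF) // FsV.
  have ga0 : ga != 0 by rewrite mulf_neq0 // invr_eq0.
  have sB : onB (ga *: z + u).
    have -> : ga *: z + u = al'^-1 *: v m.
      by rewrite mE' scalerDr !scalerA mulVf // scale1r addrC mulrC.
    by apply: (onBZ C); rewrite ?invr_eq0 //; exact: onB_v C m.
  have wlk : w l k = 1%N by rewrite line_weightC.
  have := simple_line_Fs C kl wlk (_ : exists2 c, c != 0 & ga *: z = c *: v l)
     (_ : exists2 c, c != 0 & u = c *: v k) sB ga^-1.
  rewrite FsV // scalerA mulVf // scale1r; apply.
    by exists (ga * cl); [rewrite mulf_neq0 | rewrite zE2 scalerA].
  by exists ck.
have [k ka] := cf_span C a0n; exists k; exact: ka.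
Qed.

(** The long lines have weight [s], and they turn out to cover [B] from one of its points [O]. Seen
    from [O] all slope multiplicities are divisible by [s], so the lacunary polynomial is [H^s] with
    [H] of degree [s + 1], and its gap leaves only [H = X^s (X + a) + b X + c]. *)
Lemma plane_linear_s : d = s -> linear_config s v.
Proof.
move=> dE.
have longE k l : k != l -> (2 <= w k l)%N -> w k l = s.
  move=> kl /(long_line_weight C sd kl); rewrite dE => /andP [h1 h2].
  by apply/eqP; rewrite eqn_leq h1 h2.
have off_ex i j P : i != j -> (2 <= w i j)%N -> P \notin L i j -> exists2 k, k != P & (2 <= w P k)%N.
  move=> ij w2 PL; have [a1 [a2 [z1 z2 ind]]] := exists_point_pair C P.
  exact: (exists_long_through ij w2 PL z1 z2 ind (longE _ _ ij w2)).
have off_uniq i j P k l : i != j -> (2 <= w i j)%N -> P \notin L i j -> k != P -> l != P ->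
    (2 <= w P k)%N -> (2 <= w P l)%N -> l \in L P k.
  move=> ij w2 PL kP lP wk wl; have [a1 [a2 [z1 z2 ind]]] := exists_point_pair C P.
  exact: (long_through_unique ij PL z1 z2 ind (longE _ _ ij w2) dE kP lP wk wl).
have [i0 [j0 [ij0 w20]]] := exists_long_line C sd.
pose long (A : {set I}) := [exists i, exists j, [&& i != j, (2 <= w i j)%N & A == L i j]].
have longP A : reflect (exists i j, [/\ i != j, (2 <= w i j)%N & A = L i j]) (long A).
  apply: (iffP existsP) => [[i /existsP [j /and3P [ij w2 /eqP ->]]]|[i [j [ij w2 ->]]]].
    by exists i, j.
  by exists i; apply/existsP; exists j; rewrite ij w2 eqxx.
have [[[O A1] A2] /= [l1 l2 ne O1 O2]] : exists OA : I * {set I} * {set I},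
    [/\ long OA.1.2, long OA.2, OA.1.2 != OA.2, OA.1.1 \in OA.1.2 & OA.1.1 \in OA.2].
  case: (pickP (fun OA : I * {set I} * {set I} =>
      [&& long OA.1.2, long OA.2, OA.1.2 != OA.2, OA.1.1 \in OA.1.2 & OA.1.1 \in OA.2])).
    by move=> OA /and5P [h1 h2 h3 h4 h5]; exists OA.
  move=> none; exfalso.
  (* Long lines without a common point in [B] would partition [B] into sets of size [1 + s^2]. As
     [b + s = (s + 1) (1 + s^2)], this size would divide [s]. *)
  have part : partition [set A | long A] setT.
    apply/and3P; split.
    - apply/eqP/setP => Q; rewrite in_setT; apply/bigcupP.
      case: (boolP (Q \in L i0 j0)) => QL.
        by exists (L i0 j0) => //; rewrite inE; apply/longP; exists i0, j0.
      have [k kQ wk] := off_ex _ _ _ ij0 w20 QL; exists (L Q k); last exact: line_pts_l.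
      by rewrite inE; apply/longP; exists Q, k; rewrite eq_sym.
    - apply/trivIsetP => A B; rewrite !inE => lA lB AB; rewrite -setI_eq0.
      apply/set0Pn => -[O]; rewrite in_setI => /andP [OA OB].
      by have := none (O, A, B); rewrite /= lA lB AB OA OB.
    - rewrite inE; apply/negP => /longP [i [j [_ _ e]]].
      by have := line_pts_l v i j; rewrite -e inE.
  have := card_partition part; rewrite cardsT (eq_bigr (fun=> 1 + s * s)%N); last first.
    by move=> A; rewrite inE => /longP [i [j [ij w2 ->]]]; rewrite (card_line C ij) longE.
  rewrite sum_nat_const (card_points_eq C) dE (plane_q C) => bE.
  have : (1 + s * s %| s)%N.
    have h1 : (1 + s * s %| (s * s ^ 2 + 1 + s * s) + s)%N.
      have -> : (s * s ^ 2 + 1 + s * s + s = (s + 1) * (1 + s * s))%N by rewrite -mulnn; clear; lia.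
      by rewrite dvdn_mull.
    by move: h1; rewrite dvdn_addr // bE dvdn_mull.
  move/(dvdn_leq s0); rewrite leqNgt add1n ltnS leq_pmulr //.
have star P : P != O -> w O P = s.
  move=> PO.
  have [i [j [ij w2 PL OL]]] : exists i j, [/\ i != j, (2 <= w i j)%N, P \notin L i j & O \in L i j].
    have [i [j [ij w2 e1]]] := longP _ l1; have [k [l [kl w2' e2]]] := longP _ l2.
    case: (boolP (P \in L i j)) => P1; last by exists i, j; split=> //; rewrite -e1.
    case: (boolP (P \in L k l)) => P2; last by exists k, l; split=> //; rewrite -e2.
    case/negP: ne; rewrite e1 e2 -(line_pts_eq v0 v_inj ij P1 _ PO) -?e1 //.
    by rewrite (line_pts_eq v0 v_inj kl P2 _ PO) -?e2.
  have [m mP wm] := off_ex _ _ _ ij w2 PL; have Pm : P != m by rewrite eq_sym.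
  case: (boolP (O \in L P m)) => Om.
    by rewrite (line_weight_eq C Pm Om (line_pts_l _ _ _)) 1?eq_sym // longE.
  (* Otherwise [O] is off the long line [L P m] although two long lines pass through [O], against
     [off_uniq]. *)
  exfalso.
  have pick_on A : long A -> O \in A -> exists k, [/\ k != O, (2 <= w O k)%N & A = L O k].
    move=> /longP [x [y [xy wxy ->]]] OA.
    have [z [zL zO]] : exists z, z \in L x y /\ z != O.
      have [e|] := eqVneq x O; last by exists x; rewrite line_pts_l.
      by exists y; rewrite line_pts_r -e eq_sym.
    have Oz : O != z by rewrite eq_sym.
    exists z; rewrite (line_weight_eq C xy OA zL Oz); split=> //.
    by rewrite (line_pts_eq v0 v_inj xy OA zL Oz).
  have [k [kO wk e1]] := pick_on _ l1 O1; have [l [lO wl e2]] := pick_on _ l2 O2.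
  have := off_uniq _ _ _ _ _ Pm wm Om kO lO wk wl => lk.
  case/negP: ne; rewrite e1 e2; apply/eqP/esym; apply: (line_pts_eq v0 v_inj) => //; rewrite 1?eq_sym //.
  exact: line_pts_l.
have [a1 [a2 [z1 z2 ind]]] := exists_point_pair C O.
pose m x := slope_mult s v a1 a2 x.
have m_dvd x : m x = (m x %/ s * s)%N.
  case: (posnP (m x)) => [->|/(mu_witness C z1 z2 ind) [k kO <-]]; first by rewrite div0n.
  by rewrite /m (mu_xi C z1 z2 ind kO) star // divnn s0 mul1n.
have [f [g [PE mf szf szg]]] := point_lacunary C z1 z2 ind.
pose H : {poly F} := \prod_x ('X - x%:P) ^+ (m x %/ s).
have HE : H ^+ s = 'X^(s ^ 2) * f + g.
  rewrite -PE split_mset_seq /H -prodrXl; apply: eq_bigr => x _.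
  by rewrite -exprM -m_dvd.
have mH : H \is monic by apply: monic_prod => x _; rewrite monic_exp // monicXsubC.
have szH : size H = s.+2.
  have f0 : f != 0 by exact: monic_neq0.
  have gf : (size g < s ^ 2 + size f)%N.
    by rewrite szf (leq_ltn_trans szg) // -[X in (X < _)%N]add0n ltn_add2r expn_gt0 s0.
  have := size_exp H s; rewrite HE size_XnM_add // szf dE.
  rewrite addnS /= -mulnn addnC -mulSn => /eqP; rewrite eqn_pmul2r // => /eqP e.
  by rewrite -(prednK (_ : 0 < size H)%N) -?e // size_poly_gt0 monic_neq0.
(* At [k s < s^2] the coefficient of [H^s] is that of [g], whose degree is at most [d = s], below
   [2 s]. *)
have cH k : (2 <= k)%N -> (k < s)%N -> H`_k = 0.
  move=> k2 ks; have := coef_exp_frob sF H (k * s); rewrite dvdn_mull // mulnK // HE.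
  rewrite coefD coefXnM -mulnn ltn_pmul2r // ks add0r => e.
  have g0 : g`_(k * s) = 0.
    apply: coef_geq; apply: leq_trans szg _; rewrite dE.
    by apply: leq_trans (leq_mul k2 (leqnn s)); move: s7; clear; lia.
  by apply/eqP; move/eqP: e; rewrite g0 eq_sym expf_eq0 s0.
have HX : H = 'X^s * ('X + (H`_s)%:P) + (H`_1 *: 'X + (H`_0)%:P).
  apply/polyP => k; rewrite coefD coefXnM !coefD coefZ !coefX !coefC.
  have [ks|ks] := ltnP k s.
    rewrite add0r; case: k ks => [|[|k]] ks; rewrite ?mulr0 ?mulr1 ?add0r ?addr0 //.
    by rewrite cH.
  have [->|kn] := eqVneq k s.
    rewrite subnn /= add0r; have -> : (s == 1)%N = false by move: s1; clear; lia.
    by rewrite (gtn_eqF s0) mulr0 !addr0.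
  have [->|kn2] := eqVneq k s.+1.
    rewrite subSnn /= addr0; move: mH; rewrite monicE lead_coefE szH /= => /eqP ->.
    by rewrite eqSS (gtn_eqF s0) mulr0 !addr0.
  have -> : (k - s == 1)%N = false by move: kn2 ks; clear; lia.
  have -> : (k - s == 0)%N = false by move: kn ks; clear; lia.
  have -> : (k == 1)%N = false by move: s1 ks; clear; lia.
  have -> : (k == 0)%N = false by move: s1 ks; clear; lia.
  by rewrite coef_geq ?szH ?mulr0 ?addr0 //; move: ks kn kn2; clear; lia.
have key x : H.[x] = x ^+ s * (x + H`_s) + (H`_1 * x + H`_0) by rewrite {1}HX !hornerE.
have zsub : zr a1 \subset zr a2 by rewrite z1 sub1set.
apply: (@star_linear F I 3 p s v C a1 a2 ind zsub H`_s H`_1 H`_0) => k; rewrite z1 in_set1 => kO.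
have : H.[slope v a1 a2 k] = 0.
  apply/eqP; have : root (split_poly (mset_seq m)) (slope v a1 a2 k).
    by rewrite root_prod_XsubC mem_mset_seq /m (mu_xi C z1 z2 ind kO) star.
  by rewrite /m PE -HE /root horner_exp expf_eq0 s0.
by rewrite key.
Qed.

Lemma plane_linear : linear_config s v.
Proof. by case: (d_cases C sd) => [/plane_linear_s|/plane_linear_top]. Qed.

End Plane.

(** * From coordinates to the projective space *)

Lemma config_linear (F : finFieldType) (I : finType) (h p s : nat) (v : I -> 'rV[F]_h) :
  config p s v -> (5 * h < p + 11)%N -> (exists i j, i != j /\ ~~ (p %| line_weight s v i j)%N) ->
  linear_config s v.
Proof.
move=> C hp [i [j [ij pw]]].
have [h3|h3] := eqVneq h 3%N.
  by move: v C pw; rewrite h3 => v C pw; apply: (plane_linear C); exact: (plane_d_ge C ij pw).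
have h4 : (4 <= h)%N by have := cf_h C; move: h3; clear; lia.
have p_pr := pcharf_prime (cf_p C).
(* For [h >= 4] the hypothesis reads [p > 9], and 10 is not prime. *)
have p11 : (11 <= p)%N.
  have : (10 <= p)%N by move: hp h4; clear; lia.
  by rewrite leq_eqVlt => /orP [/eqP e|//]; move: p_pr; rewrite -e.
have s11 : (11 <= s)%N.
  have [e e0 ->] := cf_s C; apply: leq_trans p11 _.
  by rewrite -{1}[p]expn1 leq_exp2l // prime_gt1.
case: (boolP [exists k, exists l, (k != l) && (2 <= line_weight s v k l)%N]).
  move=> /existsP [k /existsP [l /andP [kl wkl]]].
  exact: (long_lambda C s11 p11 h4 kl ij wkl pw).
move=> /existsPn none; apply: (all_simple_linear C) => // k l kl.
have /existsPn /(_ l) := none k; rewrite kl /= -ltnNge ltnS => le.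
by apply/eqP; rewrite eqn_leq le (line_weight_gt0 C).
Qed.

Section Transport.
Variables (F : finFieldType) (n : nat) (B : {set pg_point F n}).
Local Notation V := 'rV[F]_n.+1.
Local Notation W := (pg_span B).
Local Notation h := (\dim W).
Local Notation I := {P : pg_point F n | P \in B}.

Definition rep (P : pg_point F n) : V := vpick (val P).

Lemma rep_neq0 P : rep P != 0.
Proof. by rewrite vpick0 -dimv_eq0 (eqP (valP P)). Qed.

Lemma repE P : val P = <[rep P]>%VS.
Proof.
apply/eqP; rewrite eq_sym eqEdim -memvE memv_pick dim_vline rep_neq0.
by rewrite (eqP (valP P)).
Qed.

Lemma mem_rep P (H : {vspace V}) : (val P <= H)%VS = (rep P \in H).
Proof. by rewrite repE memvE. Qed.

Lemma rep_span P : P \in B -> rep P \in W.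
Proof. by move=> PB; rewrite -mem_rep; exact: (sumv_sup P). Qed.

Definition crd (x : V) : 'rV[F]_h := \row_j coord (vbasis W) j x.
Definition rec (y : 'rV[F]_h) : V := \sum_j y 0 j *: (vbasis W)`_j.

Lemma crdK x : x \in W -> rec (crd x) = x.
Proof. by move=> xW; rewrite [RHS](coord_vbasis xW); apply: eq_bigr => j _; rewrite mxE. Qed.

Lemma recD c y z : rec (c *: y + z) = c *: rec y + rec z.
Proof.
by rewrite scaler_sumr -big_split; apply: eq_bigr => j _; rewrite !mxE scalerDl scalerA.
Qed.

Lemma rec0 : rec 0 = 0.
Proof. by rewrite /rec big1 // => j _; rewrite mxE scale0r. Qed.

Lemma recZ c y : rec (c *: y) = c *: rec y.
Proof. by rewrite -[c *: y]addr0 recD rec0 addr0. Qed.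

Definition pv (i : I) : 'rV[F]_h := crd (rep (val i)).

Lemma pvK i : rec (pv i) = rep (val i).
Proof. by rewrite crdK // rep_span // (valP i). Qed.

Lemma pv_neq0 i : pv i != 0.
Proof.
by apply: contraNneq (rep_neq0 (val i)) => e; rewrite -pvK e rec0.
Qed.

Lemma pv_inj i j : (pv i <= pv j)%MS -> i = j.
Proof.
move=> /sub_rVP [c e]; apply/val_inj/val_inj; have c0 : c != 0.
  by apply: contraNneq (pv_neq0 i) => c0; rewrite e c0 scale0r.
rewrite !repE -!pvK e recZ; apply/eqP; rewrite eqEdim.
by rewrite -memvE memvZ ?memv_line // !dim_vline scaler_eq0 (negPf c0); case: (_ == 0).
Qed.

(** [coord] is linear on the whole space, so this functional extends the one with the given values
    on the basis of the span. *)
Definition fun_of (a : 'cV[F]_h) : 'Hom(V, F^o) :=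
  \sum_j a j 0 *: linfun (coord (vbasis W) j : V -> F^o).

Lemma fun_ofE a x : fun_of a x = (crd x *m a) 0 0.
Proof.
rewrite sum_lfunE mxE; apply: eq_bigr => j _.
by rewrite scale_lfunE lfunE mxE mulrC.
Qed.

Lemma fun_of_basis a (j : 'I_h) : fun_of a (vbasis W)`_j = a j 0.
Proof.
have fr : free (vbasis W) by exact: basis_free (vbasisP W).
rewrite fun_ofE mxE (bigD1 j) //= big1 => [|k kj].
  by rewrite addr0 mxE coord_free // eqxx mul1r.
by rewrite mxE coord_free // eq_sym (negPf kj) mul0r.
Qed.

Lemma hyperplane_fun_of a : a != 0 -> hyperplane (lker (fun_of a)).
Proof.
move=> a0; have [j aj] : exists j, a j 0 != 0.
  apply/existsP; apply: contraNT a0 => /existsPn none; apply/eqP/matrixP => j k.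
  by rewrite ord1 mxE; apply/eqP; have := none j; rewrite negbK.
have dV : \dim {:V} = n.+1 by rewrite dimvf dim_matrix; exact: mul1n.
have := limg_ker_dim (fun_of a) fullv; rewrite capfv dV.
have : (0 < \dim (fun_of a @: fullv))%N.
  rewrite lt0n dimv_eq0; apply: contraNneq aj => e.
  by have := memv_img (fun_of a) (memvf (vbasis W)`_j); rewrite e memv0 fun_of_basis.
have : (\dim (fun_of a @: fullv) <= 1)%N by apply: leq_trans (dimvS (subvf _)) _; rewrite dimvf.
move=> le gt; have -> : \dim (limg (fun_of a)) = 1%N by apply/eqP; rewrite eqn_leq le gt.
by rewrite /hyperplane addn1 => -[->].
Qed.

Lemma card_meet H : #|pg_meet B H| = #|[set i : I | (val (val i) <= H)%VS]|.
Proof.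
rewrite -(card_imset _ (@val_inj _ _ (I : subType _))); apply: eq_card => P.
rewrite inE; apply/andP/imsetP => [[PB PH]|[i + ->]]; last first.
  by rewrite inE => iH; split=> //; exact: valP i.
by exists (Sub P PB : I); rewrite ?inE SubK.
Qed.

Lemma card_meet_fun a : #|pg_meet B (lker (fun_of a))| = #|zeros pv a|.
Proof.
rewrite card_meet; apply: eq_card => i; rewrite !inE mem_rep memv_ker fun_ofE.
by rewrite -/(pv i); apply/eqP/eqP => [e|->]; [apply/rowP => j; rewrite ord1 e mxE | rewrite mxE].
Qed.

Lemma pv_spans (a : 'cV[F]_h) : a != 0 -> exists i, pv i *m a != 0.
Proof.
move=> a0; apply/existsP; apply: contraNT a0 => /existsPn none.
have sub : (W <= lker (fun_of a))%VS.
  apply/subv_sumP => P PB; rewrite mem_rep memv_ker fun_ofE.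
  have := none (Sub P PB); rewrite negbK /pv SubK => /eqP ->.
  by rewrite mxE.
apply/eqP/matrixP => j k; rewrite ord1 mxE -fun_of_basis.
have jW : (vbasis W)`_j \in W by apply: vbasis_mem; apply: mem_nth; rewrite size_tuple.
by have := subvP sub _ jW; rewrite memv_ker => /eqP.
Qed.

Hypothesis blk : blocking B.

Lemma zr_pv_gt0 (a : 'cV[F]_h) : a != 0 -> (0 < #|zeros pv a|)%N.
Proof.
move=> a0; rewrite -card_meet_fun card_gt0.
exact: (implyP (forallP blk _) (hyperplane_fun_of a0)).
Qed.

(** A functional not zero on a one-dimensional span has no zero among the points of [B]. *)
Lemma rank_span_neq1 : h != 1%N.
Proof.
apply/eqP => h1; have a0 : const_mx 1 != 0 :> 'cV[F]_h.
  have lt : (0 < h)%N by rewrite h1.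
  by apply/eqP => /matrixP /(_ (Ordinal lt) 0) /eqP; rewrite !mxE oner_eq0.
have /card_gt0P [i] := zr_pv_gt0 a0; rewrite inE => /eqP e.
case/negP: (pv_neq0 i); apply/eqP/rowP => j; rewrite [RHS]mxE.
have := congr1 (fun y : 'rV_1 => y 0 0) e; rewrite !mxE (bigD1 j) //= big1 ?addr0 ?mxE ?mulr1 //.
have lt0 k : (k < h)%N -> k = 0%N by rewrite h1; case: k.
by move=> k; case/eqP; apply: val_inj; rewrite /= (lt0 _ (ltn_ord j)) (lt0 _ (ltn_ord k)).
Qed.

Lemma meets_two (H : {vspace V}) : h = 2%N -> hyperplane H -> ~~ (W <= H)%VS -> #|pg_meet B H| = 1%N.
Proof.
move=> h2 hH WH; apply/eqP; rewrite eqn_leq card_gt0 (implyP (forallP blk _) hH) andbT.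
apply/card_le1_eqP => P Q; rewrite !inE => /andP [PB PH] /andP [QB QH].
apply/eqP; apply: contraNT WH => PQ.
have sub : (val P + val Q <= W)%VS by rewrite subv_add !(sumv_sup _ _ (subvv _)).
suff -> : W = (val P + val Q)%VS by rewrite subv_add PH.
apply/eqP; rewrite eq_sym eqEdim sub h2.
rewrite leqNgt; apply: contra PQ => lt; apply/eqP/val_inj/eqP; rewrite eqEdim (eqP (valP P)) (eqP (valP Q)).
rewrite andbT; have : val P == (val P + val Q)%VS.
  by rewrite eqEdim addvSl (eqP (valP P)); move: lt; clear; lia.
by move/eqP => e; rewrite e addvSr.
Qed.

Lemma card_points : #|{: I}| = #|B|.
Proof. by rewrite card_sig; apply: eq_card => P; rewrite !inE. Qed.

(** A hyperplane not containing the two-dimensional span meets [B] in one point. Counting incidences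
    with the functionals on the span gives [#|B| = q + 1], which settles the hyperplanes that
    contain it. *)
Lemma meets_mod_q (H : {vspace V}) : h = 2%N -> hyperplane H -> #|pg_meet B H| = 1 %[mod #|F|].
Proof.
move=> h2 hH; case: (boolP (W <= H)%VS) => WH; last by rewrite meets_two.
have q1 : (1 < #|F|)%N := card_finField_gt1 F.
have -> : #|pg_meet B H| = #|{: I}|.
  rewrite card_meet -[RHS]cardsT; apply: eq_card => i; rewrite !inE mem_rep.
  by apply: (subvP WH); apply: rep_span; exact: valP i.
have one (a : 'cV[F]_h) : a != 0 -> #|zeros pv a| = 1%N.
  move=> a0; rewrite -card_meet_fun meets_two //; first exact: hyperplane_fun_of.
  apply/negP => sub; have [i /eqP[]] := pv_spans a0; apply/rowP => j; rewrite ord1.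
  have := subvP sub _ (rep_span (valP i)); rewrite memv_ker fun_ofE => /eqP ->.
  by rewrite mxE.
have e : (\sum_(a : 'cV[F]_h | a != 0%R) #|zeros pv a| = #|{: I}| * (#|F| - 1))%N.
  rewrite (eq_bigr (fun a => \sum_i (pv i *m a == 0)%R)%N); last first.
    by move=> a _; rewrite -sum1_card big_mkcond /=; apply: eq_bigr => i _; rewrite inE; case: eqP.
  rewrite exchange_big /= -sum_nat_const; apply: eq_bigr => i _.
  have := cardsD1 0 (ann (pv i)); rewrite mem_ann0 card_ann (rank_v pv_neq0) {1}h2 expn1 => ->.
  rewrite add1n subn1 /= -sum1_card big_mkcond [RHS]big_mkcond /=; apply: eq_bigr => a _.
  by rewrite in_setD1 mem_ann; case: (a != 0) => //=; case: eqP.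
move: e; rewrite (eq_bigr (fun=> 1%N)) => [|a a0]; last by rewrite one.
rewrite sum1_card; have -> : #|[pred a : 'cV[F]_h | a != 0]| = (#|F| ^ 2 - 1)%N.
  have qh : (#|F| ^ h = #|F| ^ 2)%N by rewrite h2.
  have := cardC1 (0 : 'cV[F]_h); rewrite card_mx muln1 qh subn1 => <-.
  by apply: eq_card => a; rewrite !inE.
have -> : (#|F| ^ 2 - 1 = (#|F| - 1) * (#|F| + 1))%N by have := subn_sqr #|F| 1; rewrite exp1n.
rewrite mulnC => /eqP; rewrite eqn_pmul2r ?subn_gt0 // => /eqP <-.
by rewrite modnDl.
Qed.

Lemma pv_line_closed (H : {vspace V}) : closed_set pv [set i : I | (val (val i) <= H)%VS].
Proof.
move=> i j; rewrite !inE !mem_rep => iH jH _; apply/subsetP => k; rewrite !inE mem_rep.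
move=> /row_addsP [a [c e]]; rewrite -pvK e recD -[c *: pv j]addr0 recD rec0 addr0 !pvK.
by rewrite memvD // memvZ.
Qed.

(** If [p] divided all weights, partitioning a hyperplane section into the lines through one of its
    points would make its size [1] modulo [p^(e+1)]. *)
Lemma exists_lambda_line p e : config p (p ^ e) pv -> ~ meets_1mod p e.+1 B ->
  exists i j, i != j /\ ~~ (p %| line_weight (p ^ e) pv i j)%N.
Proof.
move=> C nm; case: (boolP [exists i, exists j, (i != j) && ~~ (p %| line_weight (p ^ e) pv i j)%N]).
  by move=> /existsP [i /existsP [j /andP [ij pw]]]; exists i, j.
move=> /existsPn none; case: nm => H hH; rewrite card_meet; set S := [set i | _].
have cS : closed_set pv S := pv_line_closed (H := H).
have : (0 < #|S|)%N by rewrite -card_meet card_gt0; exact: (implyP (forallP blk _) hH).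
case/card_gt0P => i iS; rewrite (card_pencil (cf_v0 C) (cf_inj C) iS cS) -addn1 -modnDml.
suff /eqP -> : (p ^ e.+1 %| \sum_(A in pencil pv i S) #|A|)%N by [].
apply: dvdn_sum => A /imsetP [j]; rewrite in_setD1 eq_sym => /andP [ij _] ->.
rewrite (card_block C ij) expnSr dvdn_pmul2l; last by rewrite (leq_trans _ (cf_s7 C)).
by have /existsPn /(_ j) := none i; rewrite ij /= negbK.
Qed.

Lemma linear_transport p s : config p s pv -> linear_config s pv -> Fq_linear s B.
Proof.
move=> C [U [U0 Ucl Upt UB]]; have sF := pchar_nat_s C.
have s1 : (1 < s)%N := leq_trans (isT : (1 < 7)%N) (cf_s7 C).
exists (frob_fixed F s); split; last 2 first.
- exact: cardFs C.
- exists [set rec x | x in U].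
    split; first by apply/imsetP; exists 0; rewrite ?rec0.
    move=> a aF _ _ /imsetP [x xU ->] /imsetP [y yU ->].
    by apply/imsetP; exists (a *: x + y); [exact: Ucl | rewrite recD].
  move=> P; split=> [PB|[u]].
    pose i : I := Sub P PB; have [c c0 cU] := Upt i.
    have iP : rep (val i) = rep P by rewrite SubK.
    exists (c *: rep P).
      rewrite in_setD1 scaler_eq0 negb_or c0 rep_neq0; apply/imsetP.
      by exists (c *: pv i); rewrite // recZ pvK iP.
    rewrite repE; apply/eqP; rewrite eqEdim !dim_vline scaler_eq0 (negPf c0) /=.
    rewrite leqnn andbT -memvE; apply/vlineP; exists c^-1.
    by rewrite scalerA mulVf // scale1r.
  rewrite in_setD1 => /andP [u0 /imsetP [x xU uE]] PE.
  have x0 : x != 0 by apply: contraNneq u0 => x0; rewrite uE x0 rec0.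
  have /(onBP C) [i [c [c0 xE]]] := UB x xU x0.
  have -> : P = val i; last exact: valP i.
  apply: val_inj; rewrite [RHS]repE PE; apply/eqP; rewrite eqEdim uE xE recZ pvK.
  by rewrite !dim_vline scaler_eq0 (negPf c0) rep_neq0 andbT -memvE memvZ // memv_line.
split=> [|x y xF yF|x y xF yF].
- exact: (Fs1 F s).
- have : (x : F) - (y : F) \in frob_fixed F s by rewrite (FsD sF) ?(FsN sF).
  exact.
- have : (x : F) / (y : F) \in frob_fixed F s by rewrite FsM ?FsV.
  exact.
Qed.

End Transport.

Import Num.Theory.

Theorem mainTheorem1 (p t n e : nat) (F : finFieldType)
    (B : {set pg_point F n}) :
  prime p -> (1 <= t)%N -> #|F| = (p ^ t)%N ->
  small_set B -> minset (@blocking F n) B -> is_exponent p e B ->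
  let q0 := (p ^ e)%N in
  let h : rat := t%:R / e%:R in
  (7 <= q0)%N -> p%:R > 5%:R * h - 11%:R ->
  (\dim (pg_span B))%:R - 1 = h - 1 ->
  Fq_linear q0 B.
Proof.
move=> p_pr t1 qE small /minsetP [blk _] [exp1 expmax] q0 h q07 ph dimE.
have e0 : (0 < e)%N by move: q07; rewrite /q0; case: e {exp1 expmax q0 h ph dimE} => [|e] //; rewrite expn0.
have hE : h = (\dim (pg_span B))%:R by apply: (addIr (-1)); rewrite dimE.
set H := \dim (pg_span B) in hE.
have tE : t = (e * H)%N.
  have e0' : (e%:R : rat) != 0 by rewrite pnatr_eq0 -lt0n.
  apply/eqP; rewrite -(@eqr_nat rat) natrM -hE /h mulrC divfK //.
have h5 : (5 * H < p + 11)%N.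
  by rewrite -(ltr_nat rat) natrD natrM -hE -ltrBlDr.
(* If the span were a line, every hyperplane would meet [B] in [1] modulo [p^t] points, so [t <= e]
   by maximality, while [t = 2 e]. *)
have H2 : H != 2%N.
  apply/eqP => h2; have : (t <= e)%N.
    by apply: expmax => K hK; rewrite -qE; exact: (meets_mod_q blk h2 hK).
  by rewrite tE h2; move: e0; clear; lia.
have H1 : H != 1%N := rank_span_neq1 blk.
have H3 : (3 <= H)%N.
  have : (0 < H)%N by rewrite lt0n; apply: contraTneq t1 => e'; rewrite tE e' muln0.
  by move: H1 H2; clear; lia.
have C : config p q0 (@pv F n B).
  split.
  - exact: card_finPcharP qE p_pr.
  - by exists e.
  - exact: q07.
  - exact: H3.
  - by rewrite qE tE expnM.
  - exact: pv_neq0.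
  - exact: pv_inj.
  - exact: pv_spans.
  - by move=> a a0; rewrite -card_meet_fun; apply: exp1; exact: hyperplane_fun_of.
  - by rewrite card_points.
apply: (linear_transport C); apply: (config_linear C h5); apply: exists_lambda_line => //.
by move=> /expmax; rewrite ltnn.
Qed.
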